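(* Let $(M,\tau)$ be an abelian tracial von Neumann algebra. Then $\sigma(M,\tau)$ exists (that is, $\overline{\sigma}(M,\tau)=\underline{\sigma}(M,\tau)$) and \[ \sigma(M,\tau)=1-\sum_p\tau(p)^2, \] where the sum is over the minimal projections of $M$. In particular, for a probability space $(X,\Omega,\mu)$ with atoms $\mathcal{A}\subset\Omega$ one has \[ \sigma(L^\infty(X,\mu),\mathbb{E})=1-\sum_{A\in\mathcal{A}}\mu(A)^2. \]
   Context: A tracial von Neumann algebra $(M,\tau)$ is a finite von Neumann algebra $M$ with a faithful normal tracial state $\tau$; no separability of $M$ is assumed. $\mathbb{E}$ is integration against $\mu$; atoms are counted up to null sets. $M^\circ$ is the opposite algebra with trace $\tau^\circ$, and $M\bar\otimes M^\circ$ carries the trace $\tau\otimes\tau^\circ$. For a unital $*$-subalgebra $A\subset M$, $L^2(A\otimes A^\circ,\tau\otimes\tau^\circ)$ is the closure of $A\otimes A^\circ$ in $L^2(M\bar\otimes M^\circ,\tau\otimes\tau^\circ)$ and $(A\otimes A^\circ)''$ is the von Neumann algebra generated by $A\otimes A^\circ$. This Hilbert space is an $A$-$A$ bimodule via $x\cdot\xi\cdot y=(x\otimes y^\circ)\xi$, and has the commuting right action of $(A\otimes A^\circ)''$ by right multiplication. A derivation is a linear map $\delta\colon A\to L^2(A\otimes A^\circ,\tau\otimes\tau^\circ)$ with $\delta(xy)=x\cdot\delta(y)+\delta(x)\cdot y$. $\mathrm{Der}_{1\otimes1}(A,\tau)$ is the space of derivations $\delta$ such that $1\otimes1\in\mathrm{dom}(\delta^*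 )$, where $\delta$ is viewed as a densely defined operator $L^2(A,\tau)\to L^2(A\otimes A^\circ,\tau\otimes\tau^\circ)$. If $A=\mathbb{C}\langle Y\rangle$ is the unital $*$-algebra generated by a finite set $Y=Y^*$, then $\phi_Y(\delta)=(\delta(y))_{y\in Y}$ is an injective right $(A\otimes A^\circ)''$-linear map with closed range from the space of all derivations on $A$ into $L^2(A\otimes A^\circ,\tau\otimes\tau^\circ)^Y$, giving the norm $\|\delta\|_Y=(\sum_{y\in Y}\|\delta(y)\|^2)^{1/2}$; the topology is independent of $Y$, and closures are taken in it. The free Stein dimension of such an $A$ is \[\sigma(A,\tau)=\dim\overline{\mathrm{Der}_{1\otimes1}(A,\tau)}_{(A\otimes A^\circ)''},\] the von Neumann dimension (with respect to $\tau\otimes\tau^\circ$) of the right Hilbert $(A\otimes A^\circ)''$-module $\phi_Y\big(\overline{\mathrm{Der}_{1\otimes1}(A,\tau)}\big)\subset L^2(A\otimes A^\circ,\tau\otimes\tau^\circ)^Y$; it does not depend on $Y$. The upper and lower free Stein dimensions of $M$ are $\overline{\sigma}(M,\tau)=\limsup_{Y}\sigma(\mathbb{C}\langle Y\rangle,\tau)$ and $\underline{\sigma}(M,\tau)=\liminf_Y\sigma(\mathbb{C}\langle Y\rangle,\tau)$ in $[0,\infty]$, over the directed set of finite self-adjoint subsets $Y=Y^*\subset M$ ordered by inclusion. If they agree, the common value is denoted $\sigma(M,\tau)$. *)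

(* Defs.v *)
From HB Require Import structures.
From mathcomp Require Import all_boot all_order all_algebra.
From mathcomp Require Import all_classical all_reals all_analysis.
From mathcomp Require Import measurable_realfun.
From mathcomp Require Import finmap.
From mathcomp Require Import ring_quotient sesquilinear complex.

Set Implicit Arguments.
Unset Strict Implicit.
Unset Printing Implicit Defensive.

Import Order.TTheory GRing.Theory Num.Theory.
Import numFieldNormedType.Exports.

Local Open Scope classical_set_scope.
Local Open Scope ring_scope.

HB.mixin Record isStarAlgebra (R : realType) M & GRing.Algebra R[i] M := {
  star : M -> M;
  starK : involutive star;
  star_antilinear : forall (c : R[i]) x y,
    star (c *: x + y) = c^* *: star x + star y;
  starM : forall x y, star (x * y) = star y * star x
}.

#[short(type="starAlgType")]
HB.structure Definition StarAlgebra (R : realType) :=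
  { M of GRing.Algebra R[i] M & isStarAlgebra R M }.

(* A completeNormedModType (possibly non-separable) over R[i] whose norm comes
   from an inner product, linear in its first argument. *)
Record hilbertType (R : realType) := HilbertType {
  hilbert_sort :> completeNormedModType R[i];
  inner : {dot hilbert_sort for Num.conj};
  inner_norm : forall u, inner u u = `|u| ^+ 2
}.

Section VonNeumannAlgebras.
Context {R : realType}.

Definition bounded_op (H : hilbertType R) (T : H -> H) :=
  linear T /\ continuous T.

Definition commutant (H : hilbertType R) (S : set (H -> H)) : set (H -> H) :=
  [set T | bounded_op T /\ forall s, S s -> T \o s = s \o T].

(* M is *-isomorphic to a unital *-algebra of bounded operators on a Hilbert
   space equal to its bicommutant. *)
Definition is_von_neumann (M : starAlgType R) :=
  exists (H : hilbertType R) (pi : M -> H -> H),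
    [/\ injective pi /\ forall x, bounded_op (pi x),
        forall c x y v, pi (c *: x + y) v = c *: pi x v + pi y v,
        pi 1 = id /\ forall x y, pi (x * y) = pi x \o pi y,
        forall x u v, inner H (pi x u) v = inner H u (pi (star x) v)
      & range pi = commutant (commutant (range pi))].

Definition star_le (M : starAlgType R) (x y : M) :=
  exists z, y - x = star z * z.

(* tau preserves suprema of bounded increasing nets of positive elements, nets
   being presented as directed sets. *)
Definition is_normal (M : starAlgType R) (tau : M -> R[i]) :=
  forall (D : set M) (s : M),
    D !=set0 ->
    (forall x, D x -> star_le 0 x) ->
    (forall x y, D x -> D y -> exists z, [/\ D z, star_le x z & star_le y z]) ->
    (forall x, D x -> star_le x s) ->
    (forall t, (forall x, D x -> star_le x t) -> star_le s t) ->
    complex.Re (tau s) = sup [set complex.Re (tau x) | x in D].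

(* Finiteness of M follows from the faithful normal tracial state. *)
Record is_tracial_von_neumann (M : starAlgType R) (tau : M -> R[i]) : Prop := {
  tvn_von_neumann : is_von_neumann M;
  tvn_linear : scalar tau;
  tvn_unital : tau 1 = 1;
  tvn_positive : forall x, 0 <= tau (star x * x);
  tvn_faithful : forall x, tau (star x * x) = 0 -> x = 0;
  tvn_tracial : forall x y, tau (x * y) = tau (y * x);
  tvn_normal : is_normal tau
}.

Definition is_abelian (M : starAlgType R) := forall x y : M, x * y = y * x.

Definition is_projection (M : starAlgType R) (p : M) :=
  star p = p /\ p * p = p.

Definition minimal_projections (M : starAlgType R) : set M :=
  [set p | [/\ is_projection p, p != 0 &
    forall q, is_projection q -> q * p = q -> q = 0 \/ q = p]].

End VonNeumannAlgebras.

(* L^2(M (x) M^op, tau (x) tau^op) with its left M (x) M^op-module structure,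
   as the Hilbert space completion of the algebraic tensor product for
   <a(x)b^op, c(x)d^op> = tau(c^* a) tau^op((d^op)^* b^op)
                        = tau(c^* a) tau(b d^* ).
   These data are unique up to a unique unitary respecting [tens].
   [tens a b] is the vector a(x)b^op and [lact x y] is left multiplication by
   x(x)y^op, that is xi |-> x.xi.y, so that
   (x(x)y^op)(a(x)b^op) = (xa)(x)(by)^op. *)
Record tensorL2 (R : realType) (M : starAlgType R) (tau : M -> R[i]) :=
  TensorL2 {
  L2space :> hilbertType R;
  tens : M -> M -> L2space;
  tens_linearl : forall b, linear (fun a => tens a b);
  tens_linearr : forall a, linear (tens a);
  inner_tens : forall a b c d,
    inner L2space (tens a b) (tens c d) =
    tau (star c * a) * tau (b * star d);
  tens_total : closure [set xi | exists s : seq (M * M),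
    xi = \sum_(ab <- s) tens ab.1 ab.2] = setT;
  lact : M -> M -> L2space -> L2space;
  lact_bounded : forall x y, bounded_op (lact x y);
  lact_tens : forall x y a b, lact x y (tens a b) = tens (x * a) (b * y)
}.

Arguments lact {R M tau} t x y xi.

Section FreeSteinDimension.
Context {R : realType} {M : starAlgType R} {tau : M -> R[i]}.
Variable L : tensorL2 tau.

Definition is_star_subalg (B : set M) :=
  [/\ B 1, forall (c : R[i]) x y, B x -> B y -> B (c *: x + y),
      forall x y, B x -> B y -> B (x * y)
    & forall x, B x -> B (star x)].

(* C<Y> *)
Definition star_alg_gen (Y : set M) : set M :=
  [set a | forall B, is_star_subalg B -> Y `<=` B -> B a].

(* L^2(A (x) A^op) *)
Definition L2sub (A : set M) : set L :=
  closure [set xi | exists s : seq (M * M),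
    (forall ab, ab \in s -> A ab.1 /\ A ab.2) /\
    xi = \sum_(ab <- s) tens L ab.1 ab.2].

(* A derivation on A is represented by a map on M, of which only the values on
   A are relevant. *)
Definition is_derivation (A : set M) (delta : M -> L) :=
  [/\ forall a, A a -> L2sub A (delta a),
      forall (c : R[i]) a b, A a -> A b ->
        delta (c *: a + b) = c *: delta a + delta b
    & forall a b, A a -> A b ->
        delta (a * b) = lact L a 1 (delta b) + lact L 1 b (delta a)].

(* xi is in the domain of delta^*: the functional a |-> <delta a, xi> on A is
   bounded for the norm |a|_2 = tau(a^* a)^(1/2) of L^2(A, tau). *)
Definition in_dom_adjoint (A : set M) (delta : M -> L) (xi : L) :=
  exists c : R[i], forall a, A a ->
    `|inner L (delta a) xi| <= c * sqrtC (tau (star a * a)).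

Definition Der11 (A : set M) : set (M -> L) :=
  [set delta | is_derivation A delta /\ in_dom_adjoint A delta (tens L 1 1)].

Definition der_norm (Y : {fset M}) (delta : M -> L) : R[i] :=
  sqrtC (\sum_(y : Y) `|delta (val y)| ^+ 2).

Definition Der11_closure (Y : {fset M}) : set (M -> L) :=
  let A := star_alg_gen [set` Y] in
  [set delta | is_derivation A delta /\
    forall e : R[i], 0 < e ->
      exists2 delta', Der11 A delta' & der_norm Y (delta - delta') < e].

Definition phi (Y : {fset M}) (delta : M -> L) : {ffun Y -> L} :=
  [ffun y : Y => delta (val y)].

Definition innerY (Y : {fset M}) (u v : {ffun Y -> L}) : R[i] :=
  \sum_y inner L (u y) (v y).

(* The orthogonal projection of u onto K; it exists when K is a closed subspace. *)
Definition projY (Y : {fset M}) (K : set {ffun Y -> L}) (u : {ffun Y -> L}) :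
    {ffun Y -> L} :=
  xget 0 [set w | K w /\ forall k, K k -> innerY (u - w) k = 0].

Definition unitY (Y : {fset M}) (y : Y) : {ffun Y -> L} :=
  [ffun z : Y => if z == y then tens L 1 1 else 0].

(* The von Neumann dimension over N = (A (x) A^op)'' of a closed right
   N-submodule K of L^2(N)^Y: the projection P onto K commutes with the right
   action of N, hence is a matrix (P_yz) over N acting on the left, and
   dim K = (Tr (x) tau_N)(P) = sum_y <P_yy 1, 1> = sum_y <P e_y, e_y>, where
   e_y is 1(x)1 in coordinate y. *)
Definition vn_dim (Y : {fset M}) (K : set {ffun Y -> L}) : R :=
  \sum_(y : Y) complex.Re (innerY (projY K (unitY y)) (unitY y)).

(* sigma(C<Y>, tau) *)
Definition free_stein_dim (Y : {fset M}) : R :=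
  vn_dim (@phi Y @` Der11_closure Y).

Definition self_adjoint_fset : set {fset M} :=
  [set Y : {fset M} | forall y, y \in Y -> star y \in Y].

Definition fset_tail (Y0 : {fset M}) : set {fset M} :=
  [set Y | self_adjoint_fset Y /\ (Y0 `<=` Y)%fset].

Definition upper_free_stein_dim : \bar R :=
  ereal_inf [set ereal_sup [set (free_stein_dim Y)%:E | Y in fset_tail Y0]
            | Y0 in self_adjoint_fset].

Definition lower_free_stein_dim : \bar R :=
  ereal_sup [set ereal_inf [set (free_stein_dim Y)%:E | Y in fset_tail Y0]
            | Y0 in self_adjoint_fset].

End FreeSteinDimension.

Section LInfinity.
Context {d : measure_display} {X : measurableType d} {R : realType}.
Variable mu : probability X R.
Local Open Scope complex_scope.
Local Open Scope quotient_scope.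

Definition cmeasurable (f : X -> R[i]) :=
  measurable_fun setT (fun x => complex.Re (f x)) /\
  measurable_fun setT (fun x => complex.Im (f x)).

Definition ess_bounded (f : X -> R[i]) :=
  exists c : R, {ae mu, forall x, `|f x| <= c%:C}.

Definition Linf_pred : {pred (X -> R[i])} :=
  fun f => `[< cmeasurable f /\ ess_bounded f >].

Lemma Linf_subring : subring_closed Linf_pred.
Proof.
split.
- apply/asboolP; split; first by split; exact: measurable_cst.
  by exists 1; apply: filterE => x; rewrite normr1.
- move=> f g /asboolP[[f1 f2] [a fa]] /asboolP[[g1 g2] [b gb]].
  apply/asboolP; split.
    split.
      rewrite [X in measurable_fun _ X](_ : _ =
        (fun x => complex.Re (f x)) \- (fun x => complex.Re (g x))).
        exact: measurable_funB.
      by apply/funext => x; rewrite /GRing.add /GRing.opp/=; case: (f x); case: (g x).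
    rewrite [X in measurable_fun _ X](_ : _ =
      (fun x => complex.Im (f x)) \- (fun x => complex.Im (g x))).
      exact: measurable_funB.
    by apply/funext => x; rewrite /GRing.add /GRing.opp/=; case: (f x); case: (g x).
  exists (a + b); apply: filterS2 fa gb => x fx gx.
  by rewrite rmorphD/= (le_trans (ler_normB _ _))// lerD.
- move=> f g /asboolP[[f1 f2] [a fa]] /asboolP[[g1 g2] [b gb]].
  apply/asboolP; split.
    split.
      rewrite [X in measurable_fun _ X](_ : _ =
        ((fun x => complex.Re (f x)) \* (fun x => complex.Re (g x))) \-
        ((fun x => complex.Im (f x)) \* (fun x => complex.Im (g x)))).
        by apply: measurable_funB; exact: measurable_funM.
      by apply/funext => x; rewrite /GRing.mul/=; case: (f x); case: (g x).
    rewrite [X in measurable_fun _ X](_ : _ =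
        ((fun x => complex.Re (f x)) \* (fun x => complex.Im (g x))) \+
        ((fun x => complex.Im (f x)) \* (fun x => complex.Re (g x)))).
      by apply: measurable_funD; exact: measurable_funM.
    by apply/funext => x; rewrite /GRing.mul/=; case: (f x); case: (g x).
  exists (a * b); apply: filterS2 fa gb => x fx gx.
  by rewrite rmorphM/= normrM ler_pM.
Qed.

HB.instance Definition _ := GRing.isSubringClosed.Build _ Linf_pred Linf_subring.

Definition Linf_fun := {f : X -> R[i] | f \in Linf_pred}.
HB.instance Definition _ := SubType.on Linf_fun.
HB.instance Definition _ := Choice.on Linf_fun.
HB.instance Definition _ := [SubChoice_isSubComNzRing of Linf_fun by <:].

Definition ae_zero : {pred Linf_fun} :=
  fun f => `[< {ae mu, forall x, val f x = 0} >].

Lemma ae_zero_ideal : idealr_closed ae_zero.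
Proof.
split.
- by apply/asboolP; exact: filterE.
- apply/negP => /asboolP[N [mN N0 /= sN]].
  have : (mu setT <= mu N)%E.
    apply: le_measure; [exact/mem_set/measurableT|exact/mem_set|].
    by move=> x _; apply: sN => /= /eqP; rewrite oner_eq0.
  by rewrite N0 probability_setT lee_fin leNgt ltr01.
- move=> a u v /asboolP u0 /asboolP v0; apply/asboolP.
  apply: filterS2 u0 v0 => x ux vx.
  by rewrite rmorphD rmorphM/= /GRing.add/= /GRing.mul/= ux vx mulr0 addr0.
Qed.

HB.instance Definition _ := isIdealr.Build Linf_fun ae_zero ae_zero_ideal.

(* L^oo(X, mu): complex-valued essentially bounded measurable functions modulo
   almost everywhere equality. *)
Definition Linfty := {ideal_quot ae_zero}.
HB.instance Definition _ := GRing.ComNzRing.on Linfty.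
HB.instance Definition _ := EqQuotient.on Linfty.

Lemma Linf_cst_subproof (c : R[i]) : cst c \in Linf_pred.
Proof.
apply/asboolP; split; first by split; exact: measurable_cst.
by exists (complex.Re `|c|); apply: filterE => x; rewrite RRe_real ?normr_real.
Qed.

Definition Linf_cst c : Linf_fun := Sub (cst c) (Linf_cst_subproof c).

Definition Linfty_scale (c : R[i]) (u : Linfty) : Linfty :=
  \pi_Linfty (Linf_cst c) * u.

Lemma Linfty_scalerA a b u :
  Linfty_scale a (Linfty_scale b u) = Linfty_scale (a * b) u.
Proof.
rewrite /Linfty_scale mulrA -rmorphM/=; congr (\pi_Linfty _ * u).
by apply: val_inj; rewrite rmorphM.
Qed.

Lemma Linfty_scale1r : left_id 1 Linfty_scale.
Proof.
move=> u; rewrite /Linfty_scale (_ : Linf_cst 1 = 1) ?rmorph1 ?mul1r//.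
exact: val_inj.
Qed.

Lemma Linfty_scalerDr : right_distributive Linfty_scale +%R.
Proof. by move=> a u v; rewrite /Linfty_scale mulrDr. Qed.

Lemma Linfty_scalerDl u : {morph Linfty_scale^~ u : a b / a + b}.
Proof.
move=> a b; rewrite /Linfty_scale -mulrDl -rmorphD/=.
by congr (\pi_Linfty _ * u); apply: val_inj; rewrite rmorphD.
Qed.

HB.instance Definition _ := GRing.Zmodule_isLmodule.Build R[i] Linfty
  Linfty_scalerA Linfty_scale1r Linfty_scalerDr Linfty_scalerDl.

Lemma Linfty_scalerAl (c : R[i]) (u v : Linfty) : c *: (u * v) = (c *: u) * v.
Proof. exact: mulrA. Qed.

HB.instance Definition _ :=
  GRing.Lmodule_isLalgebra.Build R[i] Linfty Linfty_scalerAl.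

Lemma Linfty_scalerAr (c : R[i]) (u v : Linfty) : c *: (u * v) = u * (c *: v).
Proof. exact: mulrCA. Qed.

HB.instance Definition _ :=
  GRing.Lalgebra_isAlgebra.Build R[i] Linfty Linfty_scalerAr.

Lemma Linf_conj_subproof (f : Linf_fun) :
  (fun x => (val f x)^*) \in Linf_pred.
Proof.
case: f => f /= /asboolP[[f1 f2] [c fc]]; apply/asboolP; split.
  split.
    rewrite [X in measurable_fun _ X](_ : _ = (fun x => complex.Re (f x)))//.
    by apply/funext => x; case: (f x).
  rewrite [X in measurable_fun _ X](_ : _ = \- (fun x => complex.Im (f x))).
    exact: measurable_funN.
  by apply/funext => x /=; case: (f x).
exists c; apply: filterS fc => x.
by rewrite normcJ.
Qed.

Definition Linf_conj (f : Linf_fun) : Linf_fun :=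
  Sub (fun x => (val f x)^*) (Linf_conj_subproof f).

Definition Linfty_star (u : Linfty) : Linfty := \pi_Linfty (Linf_conj (repr u)).

Lemma Linfty_eqP (f g : Linf_fun) :
  {ae mu, forall x, val f x = val g x} <-> \pi_Linfty f = \pi_Linfty g.
Proof.
split => [fg|/eqP].
  apply/eqP; rewrite -Quotient.idealrBE; apply/asboolP.
  by apply: filterS fg => x fgx; rewrite rmorphB/= fctE fgx subrr.
rewrite -Quotient.idealrBE => /asboolP fg; apply: filterS fg => x.
by rewrite rmorphB/= => /eqP; rewrite fctE subr_eq0 => /eqP.
Qed.

Lemma Linfty_star_pi (f : Linf_fun) :
  Linfty_star (\pi_Linfty f) = \pi_Linfty (Linf_conj f).
Proof.
have /Linfty_eqP h : \pi_Linfty (repr (\pi_Linfty f)) = \pi_Linfty f.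
  by rewrite reprK.
by apply/Linfty_eqP; apply: filterS h => x /= ->.
Qed.

Lemma Linfty_starK : involutive Linfty_star.
Proof.
elim/quotW => f; rewrite (Linfty_star_pi f) Linfty_star_pi; congr (\pi_Linfty _).
by apply: val_inj; apply/funext => x /=; rewrite conjcK.
Qed.

Lemma Linfty_star_antilinear (c : R[i]) (u v : Linfty) :
  Linfty_star (c *: u + v) = c^*%R *: Linfty_star u + Linfty_star v.
Proof.
elim/quotW: u => f; elim/quotW: v => g.
have piE a (h k : Linf_fun) : a *: (\pi_Linfty h) + \pi_Linfty k =
    \pi_Linfty (Linf_cst a * h + k).
  by rewrite /GRing.scale/= /Linfty_scale -rmorphM -rmorphD.
rewrite (Linfty_star_pi f) (Linfty_star_pi g) !piE Linfty_star_pi.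
congr (\pi_Linfty _); apply: val_inj; apply/funext => x.
change ((c * val f x + val g x)^* = c^*%R * (val f x)^* + (val g x)^*).
by rewrite rmorphD rmorphM.
Qed.

Lemma Linfty_starM (u v : Linfty) :
  Linfty_star (u * v) = Linfty_star v * Linfty_star u.
Proof.
elim/quotW: u => f; elim/quotW: v => g.
rewrite mulrC (Linfty_star_pi f) (Linfty_star_pi g) -!rmorphM/= Linfty_star_pi.
congr (\pi_Linfty _); apply: val_inj; apply/funext => x.
change ((val g x * val f x)^* = (val g x)^* * (val f x)^* ).
by rewrite rmorphM.
Qed.

HB.instance Definition _ := isStarAlgebra.Build R Linfty
  Linfty_starK Linfty_star_antilinear Linfty_starM.

Definition expect (u : Linfty) : R[i] :=
  (\int[mu]_x complex.Re (val (repr u) x))%R +i*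
  (\int[mu]_x complex.Im (val (repr u) x))%R.

End LInfinity.

Arguments Linfty {d X R} mu.
Arguments expect {d X R} mu u.

Section Atoms.
Context {d : measure_display} {X : measurableType d} {R : realType}.
Variable mu : probability X R.

Definition atom (A : set X) :=
  [/\ measurable A, (0 < mu A)%E &
    forall B, measurable B -> B `<=` A -> mu B = 0%E \/ mu B = mu A].

(* AA lists the atoms of mu up to null sets, without repetition. *)
Definition atoms_upto_null (AA : set (set X)) :=
  [/\ AA `<=` atom,
      forall A, atom A -> exists2 B, AA B & mu ((A `\` B) `|` (B `\` A)) = 0%E
    & forall A B, AA A -> AA B -> mu ((A `\` B) `|` (B `\` A)) = 0%E -> A = B].

End Atoms.

(* Main.v *)
(* For a finite self-adjoint Y, let E_Y be the projection of L^2(M (x) M^op) onto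
   the vectors commuting with Y: the restriction to the diagonal.  Then
     sigma(C<Y>) = 1 - |E_Y (1 (x) 1)|^2.
   Inner derivations a |-> [a, h] belong to Der_{1(x)1}, and the projection onto
   the closure of their values (y (x) 1 - 1 (x) y)_y h has the right trace, as seen
   from the Laplacian W = sum_y |y (x) 1 - 1 (x) y|^2, whose kernel projection E_Y
   is a strong limit of powers of 1 - W / C.
   Conversely a derivation delta in Der_{1(x)1} vanishes on the diagonal.  Let
   y = y^* with |y| <= 1/2, and let T_k, U_k be the Chebyshev polynomials.  Then
   T_k(y) / k tends to 0 while delta(T_k(y)) / k stays bounded, so the latter
   tends weakly to 0 by closability of delta; its diagonal part U_{k-1}(y) zeta,
   zeta = E_Y delta(y), therefore tends weakly to 0.  By Pell's identity
   T_k^2 + (1 - y^2) U_{k-1}^2 = 1 and the product structure of L^2(M (x) M^op),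
   which makes the diagonal measure atomic, this forces zeta = 0.
   Finally |E_Y (1 (x) 1)|^2 >= sum_p tau(p)^2 over the minimal projections, with
   equality up to epsilon as soon as Y contains a fine enough partition of 1 into
   minimal projections and projections of trace at most epsilon.  For M a von
   Neumann algebra the latter uses normality of tau, and p minimal gives
   M p = C p through square roots and kernel projections; for L^oo one argues
   with measurable sets. *)
From HB Require Import structures.
Require Import Defs.
From mathcomp Require Import all_boot all_order all_algebra.
From mathcomp Require Import all_classical all_reals all_analysis.
From mathcomp Require Import complex.
From mathcomp Require Import measurable_realfun finmap sesquilinear ring lra.

Set Implicit Arguments.
Unset Strict Implicit.
Unset Printing Implicit Defensive.

Import Order.TTheory GRing.Theory Num.Theory.
Import numFieldNormedType.Exports.
Local Open Scope classical_set_scope.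
Local Open Scope ring_scope.

(** * Norms and inner products *)

(** The argument stays inside the bimodule: spectral calculus on the square of the spectrum is
    replaced by limits of polynomials in multiplication operators. Polynomials also suit
    derivations, which are defined on C<Y> only. The Laplacian W need not have a bounded inverse off
    its kernel, so its truncated inverses g_n need not converge. What converges is W g_n and, with
    D_y multiplication by y (x) 1 - 1 (x) y, the second differences of g_n (1 (x) 1). This suffices,
    since the projection onto the closure of the vectors (D_y h)_y is formally D W^{-1} D^*. On the
    diagonal delta(T_k(y)) is k U_{k-1}(y) zeta, so division by k leaves exactly U_{k-1}(y) zeta.
    The bound |y| <= 1/2 keeps 1 - y^2 away from 0, so U_{k-1}(y) is bounded uniformly in k. The
    product structure enters as follows: for q a limit of vectors a (x) 1, the operator v (x) v
    applied to q and tested on b (x) c factors into two numbers, one tending to 0 with v and one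
    bounded. Against diagonal vectors v (x) v acts as v^2 (x) 1, so v^2 tends weakly to 0 as well;
    for v = T_k and v = U_{k-1} this contradicts Pell's identity unless q vanishes on the
    diagonal. *)

Section ComplexModulus.
Context {R : realType}.
Implicit Types c d : R[i].

(** Norms take values in [R[i]]. The real-valued [cabs] and, below, [nrm] make the real order and
    [lra] available. *)
Definition cabs c : R := complex.Re `|c|.

Lemma cabsE c : `|c| = (cabs c)%:C%C.
Proof. by rewrite /cabs RRe_real ?normr_real. Qed.

Lemma rcD (x y : R) : (x + y)%:C%C = x%:C%C + y%:C%C :> R[i].
Proof. exact: rmorphD. Qed.
Lemma rcB (x y : R) : (x - y)%:C%C = x%:C%C - y%:C%C :> R[i].
Proof. exact: rmorphB. Qed.
Lemma rcM (x y : R) : (x * y)%:C%C = x%:C%C * y%:C%C :> R[i].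
Proof. exact: rmorphM. Qed.
Lemma rcV (x : R) : (x^-1)%:C%C = x%:C%C^-1 :> R[i].
Proof. exact: fmorphV. Qed.
Lemma rcX (x : R) n : (x ^+ n)%:C%C = x%:C%C ^+ n :> R[i].
Proof. exact: rmorphXn. Qed.

Lemma rc_gt0 (x : R) : (0 < x%:C%C :> R[i]) = (0 < x).
Proof. by rewrite (ltcR 0). Qed.

Lemma cabs_ge0 c : 0 <= cabs c.
Proof. by rewrite -ler0c -cabsE. Qed.

Lemma cabsM c d : cabs (c * d) = cabs c * cabs d.
Proof. by apply: complexI; rewrite rmorphM/= -!cabsE normrM. Qed.

Lemma cabsD c d : cabs (c + d) <= cabs c + cabs d.
Proof. by rewrite -lecR rmorphD/= -!cabsE ler_normD. Qed.

Lemma cabsN c : cabs (- c) = cabs c.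
Proof. by rewrite /cabs normrN. Qed.

Lemma cabs0 : cabs 0 = 0.
Proof. by rewrite /cabs normr0. Qed.

Lemma cabs_eq0 c : cabs c = 0 -> c = 0.
Proof. by move=> c0; apply/eqP; rewrite -normr_eq0 cabsE c0. Qed.

Lemma cabs_real (x : R) : cabs x%:C%C = `|x|.
Proof. by rewrite /cabs normc_def/= expr0n/= addr0 sqrtr_sqr. Qed.

Lemma cabsJ c : cabs c^* = cabs c.
Proof. by rewrite /cabs norm_conjC. Qed.

Lemma Re_conj c : complex.Re c^* = complex.Re c.
Proof. by case: c. Qed.

Lemma ReD c d : complex.Re (c + d) = complex.Re c + complex.Re d.
Proof. exact: raddfD. Qed.

Lemma ReN c : complex.Re (- c) = - complex.Re c.
Proof. exact: raddfN. Qed.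

Lemma ReB c d : complex.Re (c - d) = complex.Re c - complex.Re d.
Proof. exact: raddfB. Qed.

Lemma conj_realC (x : R) : (x%:C%C : R[i])^* = x%:C%C.
Proof. by apply: conj_Creal; apply/complex_realP; exists x. Qed.

Lemma Re_le_cabs c : `|complex.Re c| <= cabs c.
Proof. by rewrite -lecR -cabsE normc_ge_Re. Qed.

Lemma cabs2 c : ((cabs c) ^+ 2)%:C%C = c * c^*.
Proof. by rewrite rmorphXn/= -cabsE normCK. Qed.

Lemma ge0_ReE c : 0 <= c -> c = (complex.Re c)%:C%C.
Proof. by move=> c0; rewrite RRe_real ?ger0_real. Qed.

End ComplexModulus.

Section HilbertNorm.
Context {R : realType} (H : hilbertType R).
Implicit Types (u v w : H) (S : set H) (s : nat -> H).

Local Notation ip := (inner H).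

Definition nrm u : R := complex.Re `|u|.

Lemma nrmE u : `|u| = (nrm u)%:C%C.
Proof. by rewrite /nrm RRe_real ?normr_real. Qed.

Lemma ipE u : ip u u = ((nrm u) ^+ 2)%:C%C.
Proof. by rewrite inner_norm nrmE rmorphXn. Qed.

Lemma nrm_ge0 u : 0 <= nrm u.
Proof. by rewrite -ler0c -nrmE. Qed.

Lemma nrm0 : nrm 0 = 0.
Proof. by rewrite /nrm normr0. Qed.

Lemma nrm_eq0 u : nrm u = 0 -> u = 0.
Proof. by move=> u0; apply/eqP; rewrite -normr_eq0 nrmE u0. Qed.

Lemma nrmD u v : nrm (u + v) <= nrm u + nrm v.
Proof. by rewrite -lecR rmorphD/= -!nrmE ler_normD. Qed.

Lemma nrmN u : nrm (- u) = nrm u.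
Proof. by rewrite /nrm normrN. Qed.

Lemma nrmB u v : nrm (u - v) <= nrm u + nrm v.
Proof. by rewrite (le_trans (nrmD _ _))// nrmN. Qed.

Lemma nrmC u v : nrm (u - v) = nrm (v - u).
Proof. by rewrite -nrmN opprB. Qed.

Lemma nrmDist u v w : nrm (u - w) <= nrm (u - v) + nrm (v - w).
Proof. by rewrite (le_trans _ (nrmD _ _))// addrA subrK. Qed.

Lemma nrmZ c u : nrm (c *: u) = cabs c * nrm u.
Proof. by apply: complexI; rewrite rmorphM/= -nrmE -cabsE normrZ -nrmE. Qed.

Lemma ipC u v : ip u v = (ip v u)^*.
Proof. by rewrite hermC expr0 mul1r. Qed.

Lemma ipDl u v w : ip (u + v) w = ip u w + ip v w.
Proof. exact: linearDl. Qed.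
Lemma ipDr u v w : ip w (u + v) = ip w u + ip w v.
Proof. exact: linearDr. Qed.
Lemma ipBl u v w : ip (u - v) w = ip u w - ip v w.
Proof. exact: linearBl. Qed.
Lemma ipBr u v w : ip w (u - v) = ip w u - ip w v.
Proof. exact: linearBr. Qed.
Lemma ipNl u w : ip (- u) w = - ip u w.
Proof. exact: linearNl. Qed.
Lemma ip0l w : ip 0 w = 0.
Proof. exact: linear0l. Qed.
Lemma ip0r w : ip w 0 = 0.
Proof. exact: linear0r. Qed.
Lemma ipZl c u w : ip (c *: u) w = c * ip u w.
Proof. by rewrite linearZl_LR. Qed.
Lemma ipZr c u w : ip w (c *: u) = c^* * ip w u.
Proof. by rewrite linearZr_LR. Qed.

Lemma CS u v : cabs (ip u v) <= nrm u * nrm v.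
Proof.
have [/nrm_eq0 -> |v0] := eqVneq (nrm v) 0.
  by rewrite ip0r cabs0 nrm0 mulr0.
set a := ip u v; set N := nrm v ^+ 2.
have N0 : 0 < N by rewrite exprn_gt0// lt_def v0 nrm_ge0.
(* The vector |v|^2 u - <u, v> v has nonnegative squared norm; scaling by |v|^2 avoids a
   division. *)
have /(congr1 (@complex.Re R)) := ipE (N%:C%C *: u - a *: v).
rewrite ipBl !ipBr !ipZl !ipZr (ipC v u) -/a !ipE -/N conj_realC.
rewrite (_ : _ - _ = (N * (N * nrm u ^+ 2 - cabs a ^+ 2))%:C%C); last first.
  by rewrite rcM rcB rcM cabs2; ring.
move=> /= h; have : 0 <= N * (N * nrm u ^+ 2 - cabs a ^+ 2) by rewrite h sqr_ge0.
rewrite pmulr_rge0// subr_ge0 /N -exprMn mulrC.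
by rewrite ler_sqr ?nnegrE ?cabs_ge0// mulr_ge0 ?nrm_ge0.
Qed.

Lemma nrmD2 u v :
  nrm (u + v) ^+ 2 = nrm u ^+ 2 + nrm v ^+ 2 + 2 * complex.Re (ip u v).
Proof.
have /(congr1 (@complex.Re R)) := ipE (u + v).
by rewrite ipDl !ipDr !ipE (ipC v u) !ReD Re_conj /= => <-; ring.
Qed.

Lemma nrmB2 u v :
  nrm (u - v) ^+ 2 = nrm u ^+ 2 + nrm v ^+ 2 - 2 * complex.Re (ip u v).
Proof.
by rewrite nrmD2 nrmN -scaleN1r ipZr rmorphN rmorph1 mulN1r raddfN/= mulrN.
Qed.

Lemma ip_self0 u : ip u u = 0 -> u = 0.
Proof.
rewrite ipE => /(congr1 (@complex.Re R))/= /eqP.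
by rewrite sqrf_eq0 => /eqP/nrm_eq0.
Qed.

Lemma nrm2_Re u : nrm u ^+ 2 = complex.Re (ip u u).
Proof. by rewrite ipE. Qed.

Lemma eq_nrm u v : ip u u = ip v v -> nrm u = nrm v.
Proof.
move=> uv; apply/eqP; rewrite -(@eqrXn2 _ 2) ?nrm_ge0//; apply/eqP.
by rewrite !nrm2_Re uv.
Qed.

Lemma closure_nrm S u :
  closure S u <-> forall e : R, 0 < e -> exists2 v, S v & nrm (u - v) < e.
Proof.
split=> [cu e e0|h B].
  have /cu [v [Sv /=]] : nbhs u (ball u e%:C%C).
    by apply: nbhsx_ballx; rewrite rc_gt0.
  by rewrite -ball_normE/= nrmE ltcR => uv; exists v.
rewrite -nbhs_ballE => -[e /= e0 eB].
have eE : e = (complex.Re e)%:C%C by apply: ge0_ReE; exact: ltW.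
have [|v Sv uv] := h (complex.Re e); first by rewrite -ltcR -eE.
exists v; split => //; apply: eB.
by rewrite -ball_normE/= nrmE eE ltcR.
Qed.

Definition tends s u := forall e : R, 0 < e ->
  exists N, forall n, (N <= n)%N -> nrm (s n - u) < e.

Lemma cauchy_tends s :
  (forall e : R, 0 < e -> exists N, forall m n, (N <= m)%N -> (m <= n)%N ->
     nrm (s n - s m) < e) ->
  exists u, tends s u.
Proof.
move=> h.
have cs : cauchy (s @ \oo).
  apply: cauchy_exP => e /= e0.
  have eE : e = (complex.Re e)%:C%C by apply: ge0_ReE; exact: ltW.
  have [|N hN] := h (complex.Re e); first by rewrite -ltcR -eE.
  exists (s N); exists N => // n /= Nn.
  by rewrite /= -ball_normE/= distrC nrmE eE ltcR hN.
have /cauchy_cvgP/cvg_ex[u /cvgrPdist_lt su] := cs.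
exists u => e e0.
have [|N _ hN] := su e%:C%C; first by rewrite rc_gt0.
exists N => n Nn; have := hN n Nn.
by rewrite /= nrmE ltcR nrmC.
Qed.

Lemma bounded_opP (T : H -> H) : bounded_op T <->
  linear T /\ exists2 C : R, 0 <= C & forall v, nrm (T v) <= C * nrm v.
Proof.
split=> [[lT cT]|[lT [C C0 TC]]].
  split=> //; pose T' : {linear H -> H} := HB.pack T (GRing.isLinear.Build _ _ _ _ T lT).
  have /linear_boundedP[M [Mr hM]] := @continuous_linear_bounded _ _ _ 0 T' (cT 0).
  have [M' M'0 MM'] : exists2 M' : R, 0 <= M' & M < M'%:C%C.
    exists (`|complex.Re M| + 1); first by rewrite addr_ge0.
    rewrite -(RRe_real Mr) ltcR; have := ler_norm (complex.Re M); lra.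
  exists M' => // v; have := hM _ MM' v.
  by rewrite /= !nrmE -rmorphM/= lecR.
split=> //; pose T' : {linear H -> H} := HB.pack T (GRing.isLinear.Build _ _ _ _ T lT).
apply: (@bounded_linear_continuous _ _ _ T').
apply/linear_boundedP; exists C%:C%C; split; first by rewrite ger0_real// ler0c.
move=> x Cx v; rewrite !nrmE.
apply: le_trans (_ : (C * nrm v)%:C%C <= _); first by rewrite lecR.
by rewrite rmorphM/= ler_wpM2r ?ler0c ?nrm_ge0// ltW.
Qed.

End HilbertNorm.

(** * Convergence and closest points *)

Section NullSequences.
Context {R : realType}.
Implicit Types a b : nat -> R.

Definition null a := a @ \oo --> (0 : R).

Lemma nullP a : null a <->
  forall e : R, 0 < e -> exists N, forall n, (N <= n)%N -> `|a n| < e.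
Proof.
split=> [/cvgrPdist_lt h e e0|h].
  have [N _ hN] := h e e0; exists N => n Nn.
  by have := hN n Nn; rewrite /= sub0r normrN.
apply/cvgrPdist_lt => e e0; have [N hN] := h e e0.
by exists N => // n Nn /=; rewrite sub0r normrN; exact: hN.
Qed.

Lemma null_le b a : null b -> (forall n, `|a n| <= b n) -> null a.
Proof.
move=> /nullP nb ab; apply/nullP => e /nb[N hN]; exists N => n /hN.
by apply: le_lt_trans; rewrite (le_trans (ab n))// ler_norm.
Qed.

Lemma nullD a b : null a -> null b -> null (fun n => a n + b n).
Proof. by move=> na nb; rewrite /null -[0]addr0; apply: cvgD. Qed.

Lemma nullZ c a : null a -> null (fun n => c * a n).
Proof. by move=> na; rewrite /null -[0](mulr0 c); apply: cvgM => //; exact: cvg_cst. Qed.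

Lemma null_cst c : null (fun=> c) -> c = 0.
Proof.
move=> /nullP h; apply/eqP; apply: contraT; rewrite -normr_gt0 => c0.
by have [N /(_ N (leqnn N))] := h _ c0; rewrite ltxx.
Qed.

Lemma null0 : null (fun=> 0).
Proof. exact: cvg_cst. Qed.

Lemma null_ext b a : null b -> (forall n, a n = b n) -> null a.
Proof. by move=> nb ab; rewrite (_ : a = b)//; apply/funext. Qed.

Lemma null_sum I (r : seq I) (F : I -> nat -> R) :
  (forall i, null (F i)) -> null (fun n => \sum_(i <- r) F i n).
Proof.
move=> h; elim: r => [|i r IH].
  by apply: null_ext null0 _ => n; rewrite big_nil.
by apply: null_ext (nullD (h i) IH) _ => n; rewrite big_cons.
Qed.

Lemma null_inv c : null (fun n => c / n.+1%:R).
Proof. by apply: nullZ; exact: cvg_harmonic. Qed.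

Lemma null_shift a k : null a -> null (fun n => a (n + k)%N).
Proof. by move=> na; rewrite /null cvg_shiftn. Qed.

Lemma null_bounded a : null a -> exists2 C, 0 <= C & forall n, `|a n| <= C.
Proof.
move=> na; have [|C [Cr hC]] := @cvg_seq_bounded _ _ a; first by apply/cvg_ex; exists 0.
exists (`|C| + 1) => [|n]; first by rewrite addr_ge0.
by apply: hC => //; rewrite (le_lt_trans (ler_norm _))// ltrDl.
Qed.

Lemma null_ge0 a l : null (fun n => a n - l) -> (forall n, 0 <= a n) -> 0 <= l.
Proof.
move=> /nullP h a0; rewrite leNgt; apply/negP => l0.
have [|N /(_ N (leqnn N))] := h (- l); first by rewrite oppr_gt0.
by have := a0 N; have := ler_norm (a N - l); lra.
Qed.

Lemma null_approx a : (forall e : R, 0 < e -> exists2 b, null b &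
   forall n, `|a n| <= e + b n) -> null a.
Proof.
move=> h; apply/nullP => e e0.
have [|b /nullP nb ab] := h (e / 2); first by rewrite divr_gt0.
have [|N hN] := nb (e / 2); first by rewrite divr_gt0.
exists N => n /hN bn; have := ab n; have := ler_norm (b n); lra.
Qed.

End NullSequences.

Section HilbertConvergence.
Context {R : realType} {H : hilbertType R}.
Implicit Types (u v w : H) (S : set H) (s : nat -> H).
Local Notation ip := (inner H).

Lemma tendsE s u : tends s u <-> null (fun n => nrm (s n - u)).
Proof.
split=> [h|/nullP h e e0].
  apply/nullP => e /h[N hN]; exists N => n /hN.
  by rewrite ger0_norm// nrm_ge0.
have [N hN] := h e e0; exists N => n /hN.
by rewrite ger0_norm// nrm_ge0.
Qed.

Lemma tends_unique s u v : tends s u -> tends s v -> u = v.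
Proof.
move=> /tendsE su /tendsE sv; apply/eqP; rewrite -subr_eq0; apply/eqP/nrm_eq0.
apply: null_cst; apply: null_le (nullD su sv) _ => n.
by rewrite ger0_norm ?nrm_ge0// (nrmC (s n) u) nrmDist.
Qed.

Lemma tends_cst u : tends (fun=> u) u.
Proof. by apply/tendsE; apply: null_ext null0 _ => n; rewrite subrr nrm0. Qed.

Lemma tendsD s t u v : tends s u -> tends t v -> tends (fun n => s n + t n) (u + v).
Proof.
move=> /tendsE su /tendsE tv; apply/tendsE; apply: null_le (nullD su tv) _ => n.
by rewrite ger0_norm ?nrm_ge0// opprD addrACA nrmD.
Qed.

Lemma tendsZ c s u : tends s u -> tends (fun n => c *: s n) (c *: u).
Proof.
move=> /tendsE su; apply/tendsE; apply: null_ext (nullZ (cabs c) su) _ => n.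
by rewrite -scalerBr nrmZ.
Qed.

Lemma tendsB s t u v : tends s u -> tends t v -> tends (fun n => s n - t n) (u - v).
Proof.
move=> su tv; have := tendsD su (tendsZ (-1) tv).
by rewrite scaleN1r (_ : (fun _ => _) = (fun n => s n - t n))//; apply/funext => n; rewrite scaleN1r.
Qed.

Lemma tends_ext t s u : tends t u -> (forall n, s n = t n) -> tends s u.
Proof. by move=> tu st; rewrite (_ : s = t)//; apply/funext. Qed.

Lemma tends_op (T : H -> H) s u : bounded_op T -> tends s u ->
  tends (fun n => T (s n)) (T u).
Proof.
move=> /bounded_opP[lT [C C0 TC]] /tendsE su; apply/tendsE.
apply: null_le (nullZ C su) _ => n; rewrite ger0_norm ?nrm_ge0//.
have -> : T (s n) - T u = T (s n - u).
  have := lT (-1) u (s n).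
  by rewrite !scaleN1r => h; rewrite (addrC (s n)) h addrC.
exact: TC.
Qed.

Lemma tends_nrm_le s u (C : R) : tends s u -> (forall n, nrm (s n) <= C) -> nrm u <= C.
Proof.
move=> su sC; apply/ler_addgt0Pr => e e0; have [N /(_ N (leqnn N))] := su e e0.
have := sC N; have := nrmDist u (s N) 0; rewrite !subr0 (nrmC u); lra.
Qed.

Lemma tends_ip s u v : tends s u -> null (fun n => cabs (ip (s n) v - ip u v)).
Proof.
move=> /tendsE su; apply: null_le (nullZ (nrm v) su) _ => n.
by rewrite ger0_norm ?cabs_ge0// -ipBl mulrC CS.
Qed.

(** Uniqueness of scalar limits: identities between inner products are passed to the limit through
    it. *)
Lemma cnull_eq (a : nat -> R[i]) c d : null (fun n => cabs (a n - c)) ->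
  null (fun n => cabs (a n - d)) -> c = d.
Proof.
move=> ac ad; apply/eqP; rewrite -subr_eq0; apply/eqP/cabs_eq0.
apply: null_cst; apply: null_le (nullD ac ad) _ => n; rewrite ger0_norm ?cabs_ge0//.
have -> : c - d = - (a n - c) + (a n - d) by rewrite opprB addrA subrK.
by rewrite (le_trans (cabsD _ _))// cabsN.
Qed.

Lemma tends_ip2 s t u v : tends s u -> tends t v ->
  null (fun n => cabs (ip (s n) (t n) - ip u v)).
Proof.
move=> su tv; have [C C0 sC] : exists2 C, 0 <= C & forall n, nrm (s n) <= C.
  move/tendsE: su => /null_bounded[C C0 hC]; exists (C + nrm u).
    by rewrite addr_ge0 ?nrm_ge0.
  move=> n; have := nrmDist (s n) u 0; rewrite !subr0.
  by move=> /le_trans; apply; rewrite lerD2r (le_trans _ (hC n))// ler_norm.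
move/tendsE: tv => tv.
apply: null_le (nullD (nullZ C tv) (tends_ip v su)) _ => n.
rewrite ger0_norm ?cabs_ge0//.
have -> : ip (s n) (t n) - ip u v = ip (s n) (t n - v) + (ip (s n) v - ip u v).
  by rewrite ipBr addrA subrK.
rewrite (le_trans (cabsD _ _))// lerD2r (le_trans (CS _ _))//.
by rewrite ler_wpM2r ?nrm_ge0.
Qed.

Lemma closure_tends S u : closure S u -> exists2 s, (forall n, S (s n)) & tends s u.
Proof.
move=> /closure_nrm h.
have /choice[s hs] : forall n : nat, exists v, S v /\ nrm (u - v) < n.+1%:R^-1.
  by move=> n; have [|v] := h n.+1%:R^-1 => //; exists v.
exists s => [n|]; first by have [] := hs n.
apply/tendsE; apply: null_le (null_inv 1) _ => n.
by rewrite ger0_norm ?nrm_ge0// nrmC div1r ltW//; have [] := hs n.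
Qed.

Lemma tends_closure S s u : (forall n, S (s n)) -> tends s u -> closure S u.
Proof.
move=> Ss su; apply/closure_nrm => e /su[N /(_ N (leqnn N))].
by exists (s N) => //; rewrite nrmC.
Qed.

Lemma closure_ortho S u : (forall v, S v -> ip u v = 0) ->
  forall v, closure S v -> ip u v = 0.
Proof.
move=> h v /closure_tends[s Ss sv].
have h0 : null (fun n => cabs (ip (s n) u - 0)).
  by apply: null_ext null0 _ => n; rewrite (ipC (s n)) h// conjC0 subr0 cabs0.
by rewrite ipC (cnull_eq (tends_ip u sv) h0) conjC0.
Qed.

(** Weak convergence to 0 tested on a single vector, so that the set of admissible test vectors can
    be enlarged gradually. *)
Definition wnull s v := null (fun n => cabs (ip (s n) v)).

Lemma wnullD s u v : wnull s u -> wnull s v -> wnull s (u + v).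
Proof.
move=> su sv; apply: null_le (nullD su sv) _ => n.
by rewrite ger0_norm ?cabs_ge0// ipDr cabsD.
Qed.

Lemma wnullZ c s u : wnull s u -> wnull s (c *: u).
Proof.
move=> su; apply: null_ext (nullZ (cabs c) su) _ => n.
by rewrite ipZr cabsM cabsJ.
Qed.

(** Replacing the test vector by a nearby one costs at most C times the distance, uniformly in n. *)
Lemma wnull_closure s S C : (forall n, nrm (s n) <= C) -> (forall v, S v -> wnull s v) ->
  forall v, closure S v -> wnull s v.
Proof.
move=> sC h v /closure_nrm cv; have C0 : 0 <= C := le_trans (nrm_ge0 _) (sC 0%N).
apply: null_approx => e e0.
have [|w Sw vw] := cv (e / (C + 1)); first by rewrite divr_gt0// ltr_wpDl.
exists (fun n => cabs (ip (s n) w)); first exact: h.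
move=> n; rewrite ger0_norm ?cabs_ge0// -[v in ip _ v](subrK w) ipDr.
rewrite (le_trans (cabsD _ _))// lerD2r (le_trans (CS _ _))//.
rewrite (le_trans (ler_pM (nrm_ge0 _) (nrm_ge0 _) (sC n) (ltW vw)))//.
rewrite mulrCA ger_pMr// ler_pdivrMr ?mul1r ?lerDl// ltr_wpDl//.
Qed.

(* The closest point is the limit of a minimizing sequence, Cauchy by the
   parallelogram law. *)
Lemma projection_exists S u : S 0 -> (forall c v w, S v -> S w -> S (c *: v + w)) ->
  exists2 q, closure S q & forall v, closure S v -> ip (u - q) v = 0.
Proof.
move=> S0 SL.
pose D := [set nrm (u - v) ^+ 2 | v in S]; pose d := inf D.
have hD : has_inf D.
  split; first by exists (nrm (u - 0) ^+ 2); exists 0.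
  by exists 0 => _ [v _ <-]; exact: sqr_ge0.
have dle v : S v -> d <= nrm (u - v) ^+ 2.
  by move=> Sv; apply: ge_inf; [exact: hD.2|exists v].
have /choice[s hs] : forall n : nat, exists v, S v /\ nrm (u - v) ^+ 2 < d + n.+1%:R^-1.
  move=> n; have [|_ [v Sv <-] hv] := @inf_adherent _ D (n.+1%:R^-1) _ hD => //.
  by exists v.
have par m n : nrm (s n - s m) ^+ 2 <= 2 * m.+1%:R^-1 + 2 * n.+1%:R^-1.
  have [Sm dm] := hs m; have [Sn dn] := hs n.
  have mid : S (2^-1 *: (s n + s m)).
    rewrite -[X in S X]addr0; apply: (SL) => //.
    by rewrite -[s n]scale1r; apply: (SL).
  (* The midpoint of two almost minimizers lies in S, hence is no closer to u than the infimum; the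
     parallelogram law turns this into a bound on their distance. *)
  have := dle _ mid.
  have e1 : s n - s m = (u - s m) - (u - s n) by rewrite opprB [RHS]addrC subrKA.
  have e2 : nrm (u - 2^-1 *: (s n + s m)) ^+ 2 = 4^-1 * nrm ((u - s m) + (u - s n)) ^+ 2.
    have -> : (u - s m) + (u - s n) = 2 *: (u - 2^-1 *: (s n + s m)).
      rewrite scalerBr scalerA divff ?pnatr_eq0// scale1r scaler_nat mulr2n.
      by rewrite addrACA -opprD (addrC (s m)).
    rewrite nrmZ (_ : cabs 2 = 2) ?exprMn; last first.
      by rewrite (_ : 2 = 2%:C%C) ?cabs_real ?ger0_norm// rmorph_nat.
    by rewrite mulrA (_ : 4^-1 * _ = 1) ?mul1r//; field.
  rewrite e2 e1 nrmB2 nrmD2; move: dm dn.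
  set x := _^-1; set y := _^-1; lra.
have [|q sq] := @cauchy_tends _ _ s.
  move=> e e0.
  have /nullP/(_ (e ^+ 2)) := @null_inv R 4.
  move=> []; first by rewrite exprn_gt0.
  move=> N hN; exists N => m n Nm mn.
  rewrite -ltr_sqr ?nnegrE ?nrm_ge0 ?(ltW e0)//.
  apply: le_lt_trans (par m n) _; apply: le_lt_trans (hN N (leqnn N)).
  rewrite (le_trans _ (ler_norm _))//.
  have l k : (N <= k)%N -> (k.+1%:R^-1 : R) <= N.+1%:R^-1.
    by move=> Nk; rewrite lef_pV2 ?posrE// ler_nat.
  have := l m Nm; have := l n (leq_trans Nm mn).
  set x := m.+1%:R^-1; set y := n.+1%:R^-1; set z := N.+1%:R^-1; lra.
have cq : closure S q by apply: tends_closure sq => n; have [] := hs n.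
exists q => //.
have opt v : S v -> nrm (u - q) ^+ 2 <= nrm (u - q - v) ^+ 2.
  move=> Sv.
  have usq : tends (fun n => u - s n) (u - q) by apply: tendsB => //; exact: tends_cst.
  have uv : tends (fun n => u - s n - v) (u - q - v) by apply: tendsB => //; exact: tends_cst.
  have c1 := tends_ip2 usq usq; have c2 := tends_ip2 uv uv.
  rewrite -subr_le0; apply/ler_addgt0Pr => e e0; rewrite add0r.
  move/nullP: c1 => /(_ (e / 4))[|N1 h1]; first by rewrite divr_gt0.
  move/nullP: c2 => /(_ (e / 4))[|N2 h2]; first by rewrite divr_gt0.
  move/nullP: (null_inv (1 : R)) => /(_ (e / 4))[|N3 h3]; first by rewrite divr_gt0.
  pose n := maxn N1 (maxn N2 N3).
  have := h1 n (leq_maxl _ _).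
  have := h2 n (leq_trans (leq_maxl _ _) (leq_maxr _ _)).
  have := h3 n (leq_trans (leq_maxr _ _) (leq_maxr _ _)).
  rewrite div1r !ipE -!rcB !cabs_real !normr_id !ltr_norml.
  move=> /andP[_ a1] /andP[_ a2] /andP[a3 _].
  have [Sn dn] := hs n.
  have Sv' : S (s n + v) by rewrite -[s n]scale1r; exact: SL.
  have := dle _ Sv'; rewrite opprD addrA.
  move: a1 a2 a3 dn; set x := _^-1; set y1 := nrm _ ^+ 2; set y2 := nrm _ ^+ 2.
  lra.
apply: closure_ortho => v Sv.
set w := u - q; set a := ip w v.
have [/nrm_eq0 v0|v0] := eqVneq (nrm v) 0; first by rewrite /a v0 ip0r.
have N0 : 0 < nrm v ^+ 2 by rewrite exprn_gt0// lt_def v0 nrm_ge0.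
(* The optimal multiple of v: subtracting it from w lowers the squared norm by |a|^2 / |v|^2, which
   minimality forbids unless a = 0. *)
have Sv2 : S ((a / (nrm v ^+ 2)%:C%C) *: v) by rewrite -[_ *: v]addr0; exact: SL.
have := opt _ Sv2; rewrite -/w nrmB2 nrmZ ipZr -/a.
have -> : (a / (nrm v ^+ 2)%:C%C)^* * a = (cabs a ^+ 2 / nrm v ^+ 2)%:C%C.
  by rewrite rmorphM/= fmorphV/= conj_realC (rcM (cabs a ^+ 2)) rcV cabs2; ring.
rewrite /= cabsM exprMn.
have -> : cabs (nrm v ^+ 2)%:C%C^-1 = (nrm v ^+ 2)^-1.
  by rewrite -rcV cabs_real ger0_norm// invr_ge0 ltW.
move=> h; apply: cabs_eq0; apply/eqP; rewrite -sqrf_eq0 eq_le sqr_ge0 andbT.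
move: h; rewrite exprMn.
rewrite (_ : cabs a ^+ 2 * (nrm v ^+ 2)^-1 ^+ 2 * nrm v ^+ 2 = cabs a ^+ 2 / nrm v ^+ 2); last first.
  by field.
move=> h; have : cabs a ^+ 2 / nrm v ^+ 2 <= 0 by lra.
by rewrite pmulr_lle0// invr_gt0.
Qed.

End HilbertConvergence.

(** * Powers of self-adjoint contractions *)

Lemma nonincreasing_cauchy (R : realType) (a : nat -> R) :
  (forall n, 0 <= a n) -> (forall n, a n.+1 <= a n) ->
  forall e, 0 < e -> exists N, forall m n, (N <= m)%N -> (m <= n)%N -> a m - a n < e.
Proof.
move=> a0 aS e e0.
have mono m n : (m <= n)%N -> a n <= a m.
  by apply: (@homo_leq _ a (fun x y => y <= x)) => // x y z xy yz; exact: le_trans xy.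
have hA : has_inf (range a).
  by split; [exists (a 0%N); exists 0%N|exists 0 => _ [n _ <-]].
have [_ [N _ <-] hN] := inf_adherent e0 hA.
exists N => m n Nm mn.
have := mono _ _ Nm; have : inf (range a) <= a n.
  by apply: ge_inf; [exact: hA.2|exists n].
move: hN; lra.
Qed.

Section SelfAdjointContraction.
Context {R : realType} {H : hilbertType R}.
Implicit Types (u v w : H) (S : set H) (B T : H -> H).
Local Notation ip := (inner H).

Definition sa_contraction B := [/\ linear B, forall v, nrm (B v) <= nrm v &
  forall u v, ip (B u) v = ip u (B v)].

Lemma linearop0 T : linear T -> T 0 = 0.
Proof. by move=> lT; have := lT (-1) 0 0; rewrite !scaleN1r oppr0 addr0 addNr. Qed.
Lemma linearopD T u v : linear T -> T (u + v) = T u + T v.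
Proof. by move=> lT; have := lT 1 u v; rewrite !scale1r. Qed.
Lemma linearopZ T c u : linear T -> T (c *: u) = c *: T u.
Proof. by move=> lT; have := lT c u 0; rewrite (linearop0 lT) !addr0. Qed.
Lemma linearopN T u : linear T -> T (- u) = - T u.
Proof. by move=> lT; rewrite -scaleN1r linearopZ// scaleN1r. Qed.
Lemma linearopB T u v : linear T -> T (u - v) = T u - T v.
Proof. by move=> lT; rewrite linearopD// linearopN. Qed.
Lemma linearop_sum T I (r : seq I) (F : I -> H) : linear T ->
  T (\sum_(i <- r) F i) = \sum_(i <- r) T (F i).
Proof.
move=> lT; elim: r => [|i r IH]; first by rewrite !big_nil linearop0.
by rewrite !big_cons linearopD// IH.
Qed.


Lemma bounded_op_id : bounded_op (@idfun H).
Proof. by apply/bounded_opP; split=> //; exists 1 => // v; rewrite mul1r. Qed.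

Lemma bounded_op_comp (S T : H -> H) :
  bounded_op S -> bounded_op T -> bounded_op (fun u => S (T u)).
Proof.
move=> [lS cS] [lT cT]; split; first by move=> c u w; rewrite lT lS.
by move=> u; apply: continuous_comp; [exact: cT|exact: cS].
Qed.

Lemma bounded_op_lin c (S T : H -> H) :
  bounded_op S -> bounded_op T -> bounded_op (fun u => c *: S u + T u).
Proof.
move=> /bounded_opP[lS [C C0 hC]] /bounded_opP[lT [D D0 hD]]; apply/bounded_opP.
split.
  move=> d u w; rewrite lS lT !scalerDr !scalerA mulrC -!addrA; congr (_ + _).
  by rewrite addrCA.
exists (cabs c * C + D) => [|v]; first by rewrite addr_ge0// mulr_ge0// cabs_ge0.
by rewrite (le_trans (nrmD _ _))// mulrDl lerD// nrmZ -mulrA ler_wpM2l ?cabs_ge0.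
Qed.

Lemma bounded_op0 : bounded_op (fun _ : H => 0 : H).
Proof.
apply/bounded_opP; split; first by move=> c u w; rewrite scaler0 addr0.
by exists 0 => // v; rewrite nrm0 mul0r.
Qed.

(** Even powers only: -1 may be an eigenvalue of B, and there the powers themselves oscillate. The
    limit is the projection onto the vectors fixed by B^2. *)
Definition power_limit B v := xget 0 [set u | tends (fun n => iter n.*2 B v) u].

Section Properties.
Variable B : H -> H.
Hypothesis cB : sa_contraction B.

Lemma iter_linear n : linear (iter n B).
Proof.
case: cB => lB _ _; elim: n => [//|n IH] c u v /=.
by rewrite IH lB.
Qed.

Lemma iter_sym n u v : ip (iter n B u) v = ip u (iter n B v).
Proof. by case: cB => _ _ sB; elim: n u v => [//|n IH] u v; rewrite iterSr IH -sB. Qed.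

Lemma iter_nrm n v : nrm (iter n B v) <= nrm v.
Proof. by case: cB => _ nB _; elim: n => [//|n IH] /=; rewrite (le_trans (nB _)). Qed.

(** With a_k = |B^k v|^2, self-adjointness gives |B^{2n} v - B^{2m} v|^2 = a_{2n} + a_{2m} - 2
    a_{m+n}. For m <= n this is at most a_{2m} - a_{2n}, because a is nonincreasing. *)
Lemma power_limitP v : tends (fun n => iter n.*2 B v) (power_limit B v).
Proof.
case: (cB) => lB nB sB.
suff : exists u, tends (fun n => iter n.*2 B v) u.
  by move=> [u hu]; rewrite /power_limit; apply: (@xgetPex _ 0 [set u | tends _ u]); exists u.
apply: cauchy_tends => e e0; pose a k := nrm (iter k B v) ^+ 2.
have aS k : a k.+1 <= a k by rewrite /a /= ler_sqr ?nnegrE ?nrm_ge0.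
have [N hN] := nonincreasing_cauchy (fun n => sqr_ge0 _) aS (exprn_gt0 2 e0).
exists N => m n Nm mn; rewrite -ltr_sqr ?nnegrE ?nrm_ge0 ?(ltW e0)//.
rewrite nrmB2 iter_sym -iterD addnC.
have -> : (m.*2 + n.*2 = (m + n) + (m + n))%N by rewrite addnn doubleD.
rewrite iterD -iter_sym -nrm2_Re.
have mono k l : (k <= l)%N -> a l <= a k.
  by apply: (@homo_leq _ a (fun x y => y <= x)) => // x y z xy yz; exact: le_trans xy.
have : a n.*2 <= a (m + n)%N by apply: mono; rewrite -addnn leq_add2r.
have : a m.*2 - a n.*2 < e ^+ 2.
  by apply: hN; rewrite ?leq_double// (leq_trans Nm)// -addnn leq_addr.
rewrite /a; lra.
Qed.

Lemma power_limit_eq v u : tends (fun n => iter n.*2 B v) u -> power_limit B v = u.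
Proof. by apply: tends_unique; exact: power_limitP. Qed.

Lemma power_limit_fix v : B v = v -> power_limit B v = v.
Proof.
move=> Bv; apply: power_limit_eq; apply: tends_ext (tends_cst v) _ => n.
by elim: n.*2 => [//|k IH]; rewrite iterS IH.
Qed.

Lemma power_limit_linear : linear (power_limit B).
Proof.
move=> c u v; apply: power_limit_eq.
apply: tends_ext (tendsD (tendsZ c (power_limitP u)) (power_limitP v)) _ => n.
exact: iter_linear.
Qed.

Lemma power_limit_nrm v : nrm (power_limit B v) <= nrm v.
Proof. by apply: tends_nrm_le (power_limitP v) _ => n; exact: iter_nrm. Qed.

Lemma power_limit_sym u v : ip (power_limit B u) v = ip u (power_limit B v).
Proof.
apply: cnull_eq (tends_ip v (power_limitP u)) _.
apply: null_ext (tends_ip u (power_limitP v)) _ => n.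
by rewrite iter_sym ipC (ipC u) -rmorphB/= cabsJ.
Qed.

Lemma power_limit_comm T v : bounded_op T -> (forall w, B (T w) = T (B w)) ->
  power_limit B (T v) = T (power_limit B v).
Proof.
move=> bT BT; apply: power_limit_eq.
apply: tends_ext (tends_op bT (power_limitP v)) _ => n.
by elim: n.*2 => [//|k IH]; rewrite iterS IH BT.
Qed.

Lemma contraction_bounded : bounded_op B.
Proof.
case: cB => lB nB _; apply/bounded_opP; split => //.
by exists 1 => // v; rewrite mul1r.
Qed.

Lemma power_limit_BB v : B (B (power_limit B v)) = power_limit B v.
Proof.
have bB := contraction_bounded.
have h := tends_op bB (tends_op bB (power_limitP v)).
apply: tends_unique h _; apply/tendsE.
have /tendsE/(null_shift 1) := power_limitP v.
by move=> /null_ext; apply => n; rewrite addn1.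
Qed.

Lemma power_limit_idem v : power_limit B (power_limit B v) = power_limit B v.
Proof.
apply: power_limit_eq; apply: tends_ext (tends_cst _) _.
by elim=> [//|n IH]; rewrite doubleS 2!iterS IH power_limit_BB.
Qed.

Lemma power_limit_closed S v : (forall w, S w -> S (B w)) ->
  S v -> closure S (power_limit B v).
Proof.
move=> SB Sv; apply: tends_closure (power_limitP v) => n.
by elim: n.*2 => [//|k IH]; rewrite iterS; exact: SB.
Qed.

(** The limit vectors are known to be fixed by B^2 only. Isometry of B on them is what combines with
    a strict norm loss, such as [markov_nrm], to locate them. *)
Lemma power_limit_isometric v : nrm (B (power_limit B v)) = nrm (power_limit B v).
Proof.
case: (cB) => _ nB _; apply/eqP; rewrite eq_le nB/=.
by rewrite -{1}power_limit_BB nB.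
Qed.

End Properties.
End SelfAdjointContraction.

(** * The bimodule of an abelian algebra *)

Section StarAlgebra.
Context {R : realType} {M : starAlgType R}.
Implicit Types x y : M.

Lemma star1 : star (1 : M) = 1.
Proof. by rewrite -[LHS]mul1r -{1}(starK (1 : M)) -starM mul1r starK. Qed.
Lemma starD x y : star (x + y) = star x + star y.
Proof. by rewrite -{1}[x]scale1r star_antilinear rmorph1 scale1r. Qed.
Lemma star0 : star (0 : M) = 0.
Proof. by apply: (@addrI _ (star (0 : M))); rewrite -starD !addr0. Qed.
Lemma starZ (c : R[i]) x : star (c *: x) = c^* *: star x.
Proof. by rewrite -[c *: x]addr0 star_antilinear star0 addr0. Qed.
Lemma starN x : star (- x) = - star x.
Proof. by rewrite -scaleN1r starZ rmorphN rmorph1 scaleN1r. Qed.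
Lemma starB x y : star (x - y) = star x - star y.
Proof. by rewrite starD starN. Qed.

Section Subalgebra.
Variables (A : set M) (sA : is_star_subalg A).

Lemma subalg1 : A 1. Proof. by case: sA. Qed.
Lemma subalgP (c : R[i]) x y : A x -> A y -> A (c *: x + y).
Proof. by case: sA => _ h _ _; exact: h. Qed.
Lemma subalgM x y : A x -> A y -> A (x * y).
Proof. by case: sA => _ _ h _; exact: h. Qed.
Lemma subalg_star x : A x -> A (star x).
Proof. by case: sA => _ _ _ h; exact: h. Qed.
Lemma subalg0 : A 0.
Proof. by have := subalgP (-1) subalg1 subalg1; rewrite scaleN1r addNr. Qed.
Lemma subalgZ (c : R[i]) x : A x -> A (c *: x).
Proof. by move=> Ax; rewrite -[_ *: _]addr0; apply: subalgP => //; exact: subalg0. Qed.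
Lemma subalgD x y : A x -> A y -> A (x + y).
Proof. by move=> Ax Ay; rewrite -[x]scale1r; exact: subalgP. Qed.
Lemma subalgN x : A x -> A (- x).
Proof. by rewrite -scaleN1r; exact: subalgZ. Qed.
Lemma subalgB x y : A x -> A y -> A (x - y).
Proof. by move=> Ax Ay; apply: subalgD => //; exact: subalgN. Qed.

End Subalgebra.

Lemma star_alg_gen_subalg (Y : set M) : is_star_subalg (star_alg_gen Y).
Proof.
split=> [B|c x y Ax Ay B|x y Ax Ay B|x Ax B] sB YB.
- exact: subalg1.
- by apply: subalgP => //; [exact: Ax|exact: Ay].
- by apply: subalgM => //; [exact: Ax|exact: Ay].
- by apply: subalg_star => //; exact: Ax.
Qed.

Lemma subset_star_alg_gen (Y : set M) : Y `<=` star_alg_gen Y.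
Proof. by move=> y Yy B _; exact. Qed.

End StarAlgebra.

Section Bimodule.
Context {R : realType} {M : starAlgType R} {tau : M -> R[i]} (L : tensorL2 tau).
Hypothesis comm : is_abelian M.
Hypothesis tau1 : tau 1 = 1.
Implicit Types (a b x y : M) (u w : L) (A : set M).

Local Notation ip := (inner L).
Local Notation o := (tens L 1 1).

Lemma starMc x y : star (x * y) = star x * star y.
Proof. by rewrite starM comm. Qed.

Lemma tensDl a a' b : tens L (a + a') b = tens L a b + tens L a' b.
Proof. by have := tens_linearl L b 1 a a'; rewrite !scale1r. Qed.
Lemma tens0l b : tens L 0 b = 0.
Proof. by apply: (@addrI _ (tens L 0 b)); rewrite -tensDl !addr0. Qed.
Lemma tensZl (c : R[i]) a b : tens L (c *: a) b = c *: tens L a b.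
Proof. by have := tens_linearl L b c a 0; rewrite !addr0 tens0l addr0. Qed.
Lemma tensDr a b b' : tens L a (b + b') = tens L a b + tens L a b'.
Proof. by have := tens_linearr L a 1 b b'; rewrite !scale1r. Qed.
Lemma tens0r a : tens L a 0 = 0.
Proof. by apply: (@addrI _ (tens L a 0)); rewrite -tensDr !addr0. Qed.
Lemma tensZr (c : R[i]) a b : tens L a (c *: b) = c *: tens L a b.
Proof. by have := tens_linearr L a c b 0; rewrite !addr0 tens0r addr0. Qed.

Lemma ip_tens a b c d :
  ip (tens L a b) (tens L c d) = tau (star c * a) * tau (b * star d).
Proof. exact: inner_tens. Qed.

Lemma ip_tens1 a c : ip (tens L a 1) (tens L c 1) = tau (star c * a).
Proof. by rewrite ip_tens star1 mulr1 tau1 mulr1. Qed.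

Lemma tauE a : tau a = ip (tens L a 1) o.
Proof. by rewrite ip_tens1 star1 mul1r. Qed.

Lemma nrm_one : nrm o = 1.
Proof.
have /(congr1 (@complex.Re R)) := ipE o.
rewrite ip_tens1 star1 mulr1 tau1/= => /esym/eqP.
by rewrite sqrp_eq1 ?nrm_ge0// => /eqP.
Qed.

Lemma L2sub_ind A (P : set L) : (forall a b, A a -> A b -> P (tens L a b)) ->
  P 0 -> (forall u w, P u -> P w -> P (u + w)) -> closure P `<=` P ->
  L2sub A `<=` P.
Proof.
move=> Pt P0 PD Pc u; move=> Lu; apply: Pc.
apply: closure_subset Lu => _ [s [As ->]].
elim: s As => [|ab s IH] As; first by rewrite big_nil.
rewrite big_cons; apply: PD.
  by have [] := As ab (mem_head _ _); exact: Pt.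
by apply: IH => cd cds; apply: As; rewrite in_cons cds orbT.
Qed.

Lemma L2subT u : L2sub setT u.
Proof.
have : setT u by []. rewrite -(tens_total L); apply: closure_subset.
by move=> _ [s ->]; exists s.
Qed.

Arguments L2subT : clear implicits.

Lemma L2_ind (P : set L) : (forall a b, P (tens L a b)) ->
  P 0 -> (forall u w, P u -> P w -> P (u + w)) -> closure P `<=` P ->
  forall u, P u.
Proof.
move=> Pt P0 PD Pc u; have h : (L2sub setT : set L) `<=` P.
  by apply: L2sub_ind => // a b _ _; exact: Pt.
exact: h (L2subT u).
Qed.

Lemma bounded_op_eq (T1 T2 : L -> L) A : bounded_op T1 -> bounded_op T2 ->
  (forall a b, A a -> A b -> T1 (tens L a b) = T2 (tens L a b)) ->
  forall u, L2sub A u -> T1 u = T2 u.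
Proof.
move=> b1 b2 T12; have l1 : linear T1 by case: b1.
have l2 : linear T2 by case: b2.
apply: L2sub_ind => //=.
- by rewrite !linearop0.
- by move=> u w /= Tu Tw; rewrite !linearopD// Tu Tw.
- move=> u /closure_tends[s Ts su] /=.
  apply: tends_unique (tends_op b1 su) _.
  by apply: tends_ext (tends_op b2 su) _ => n; exact: Ts.
Qed.

Lemma lactb x y : bounded_op (lact L x y).
Proof. exact: lact_bounded. Qed.

Lemma lact_lin x y : linear (lact L x y).
Proof. by case: (lactb x y). Qed.

(** [lact] is specified on simple tensors alone; by density a bounded operator with the same values
    there coincides with it. The algebraic rules for [lact] below come from this. *)
Lemma lact_eq (T : L -> L) x y : bounded_op T ->
  (forall a b, T (tens L a b) = tens L (x * a) (b * y)) -> T =1 lact L x y.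
Proof.
move=> bT hT u; apply: (bounded_op_eq bT (lactb x y) _ (L2subT u)) => a b _ _.
by rewrite hT lact_tens.
Qed.

Lemma lactM x y x' y' u :
  lact L x y (lact L x' y' u) = lact L (x * x') (y * y') u.
Proof.
apply: (lact_eq (bounded_op_comp (lactb x y) (lactb x' y'))) => a b.
by rewrite !lact_tens -!mulrA (comm y').
Qed.

Lemma lact11 u : lact L 1 1 u = u.
Proof. by apply/esym; apply: (lact_eq bounded_op_id) => a b; rewrite mul1r mulr1. Qed.

Lemma lactDl c x x' y u : lact L (c *: x + x') y u = c *: lact L x y u + lact L x' y u.
Proof.
apply/esym; apply: (lact_eq (bounded_op_lin c (lactb x y) (lactb x' y))) => a b.
by rewrite !lact_tens mulrDl tensDl -scalerAl tensZl.
Qed.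

Lemma lactDr c x y y' u : lact L x (c *: y + y') u = c *: lact L x y u + lact L x y' u.
Proof.
apply/esym; apply: (lact_eq (bounded_op_lin c (lactb x y) (lactb x y'))) => a b.
by rewrite !lact_tens mulrDr tensDr -scalerAr tensZr.
Qed.

Lemma lactC x y x' y' u : lact L x y (lact L x' y' u) = lact L x' y' (lact L x y u).
Proof. by rewrite !lactM comm (comm y). Qed.

Lemma lact_split x y u : lact L x y u = lact L x 1 (lact L 1 y u).
Proof. by rewrite lactM mulr1 mul1r. Qed.

Lemma lact_one a b : lact L a b o = tens L a b.
Proof. by rewrite lact_tens mulr1 mul1r. Qed.

Lemma lact_adj x y u w : ip (lact L x y u) w = ip u (lact L (star x) (star y) w).
Proof.
move: u w; apply: L2_ind => [a b|w|u u' hu hu' w|u cu w].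
- apply: L2_ind => [c d||w w' hw hw'|w /closure_tends[s Ts sw]].
  + rewrite !lact_tens !ip_tens !starMc !starK; congr (tau _ * tau _).
      by rewrite mulrA (comm _ x).
    by rewrite -mulrA (comm y).
  + by rewrite (linearop0 (lact_lin _ _)) !ip0r.
  + by rewrite (linearopD _ _ (lact_lin _ _)) !ipDr hw hw'.
  + rewrite ipC [RHS]ipC; congr (_^*).
    apply: cnull_eq (tends_ip _ sw) _.
    apply: null_ext (tends_ip _ (tends_op (lactb (star x) (star y)) sw)) _ => n.
    congr (cabs (_ - _)); have := Ts n => /= /(congr1 Num.conj).
    by rewrite -!ipC.
- by rewrite (linearop0 (lact_lin _ _)) !ip0l.
- by rewrite (linearopD _ _ (lact_lin _ _)) !ipDl hu hu'.
- move/closure_tends: cu => [s Ts su].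
  apply: cnull_eq (tends_ip _ (tends_op (lactb x y) su)) _.
  by apply: null_ext (tends_ip _ su) _ => n; rewrite Ts.
Qed.

(** Multiplication by a (x) 1 - 1 (x) a. As an operator in u it measures the distance to the
    diagonal; as a function of a it is the inner derivation given by u. *)
Definition comd a u : L := lact L a 1 u - lact L 1 a u.

Lemma comdb a : bounded_op (comd a).
Proof.
have := bounded_op_lin (-1) (lactb 1 a) (lactb a 1).
by congr bounded_op; apply/funext => u; rewrite scaleN1r addrC.
Qed.

Lemma comd_lin a : linear (comd a).
Proof. by case: (comdb a). Qed.

Lemma comd_lact a x y u : comd a (lact L x y u) = lact L x y (comd a u).
Proof.
by rewrite /comd (linearopB _ _ (lact_lin x y)) (lactC a) (lactC 1).
Qed.

Lemma comdC a b u : comd a (comd b u) = comd b (comd a u).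
Proof. by rewrite {1}/comd -!comd_lact -(linearopB _ _ (comd_lin b)). Qed.

Lemma comd_comb c a b u : comd (c *: a + b) u = c *: comd a u + comd b u.
Proof. by rewrite /comd lactDl lactDr scalerBr opprD addrACA. Qed.

Lemma comdM a b u : comd (a * b) u = lact L a 1 (comd b u) + lact L 1 b (comd a u).
Proof.
rewrite /comd !(linearopB _ _ (lact_lin _ _)) !lactM !mulr1 !mul1r (comm b a).
by rewrite addrA subrK.
Qed.

Lemma comd1 u : comd 1 u = 0.
Proof. by rewrite /comd subrr. Qed.

Lemma comd_adj a u w : ip (comd a u) w = ip u (comd (star a) w).
Proof. by rewrite /comd ipBl ipBr !lact_adj star1. Qed.

(** Normality: multiplication operators commute with their adjoints. *)
Lemma comd_nrm_star a u : nrm (comd (star a) u) = nrm (comd a u).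
Proof.
apply: eq_nrm.
by rewrite !comd_adj !starK comdC.
Qed.

Section SubBimodule.
Variables (A : set M) (sA : is_star_subalg A).

Lemma L2sub_closed : closure (L2sub A : set L) `<=` L2sub A.
Proof. by move=> u; rewrite /L2sub; rewrite -(closure_id _).1//; exact: closed_closure. Qed.

Lemma L2sub_tens a b : A a -> A b -> L2sub A (tens L a b).
Proof.
move=> Aa Ab; apply: subset_closure; exists [:: (a, b)]; rewrite big_seq1.
by split=> // ab; rewrite inE => /eqP ->.
Qed.

Lemma L2sub0 : L2sub A (0 : L).
Proof. by rewrite -(tens0l 1); apply: L2sub_tens; [exact: subalg0|exact: subalg1]. Qed.

Lemma L2subD u w : L2sub A u -> L2sub A w -> L2sub A (u + w).
Proof.
move=> /closure_tends[s Ss su] /closure_tends[t St tw].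
apply: tends_closure (tendsD su tw) => n.
have [p [Ap ->]] := Ss n; have [q [Aq ->]] := St n.
exists (p ++ q); rewrite big_cat; split=> // ab; rewrite mem_cat => /orP[]; first exact: Ap.
exact: Aq.
Qed.

Lemma L2sub_lact x y u : A x -> A y -> L2sub A u -> L2sub A (lact L x y u).
Proof.
move=> Ax Ay; move: u; apply: L2sub_ind => /=.
- by move=> a b Aa Ab; rewrite lact_tens; apply: L2sub_tens; exact: subalgM.
- by rewrite (linearop0 (lact_lin _ _)); exact: L2sub0.
- by move=> u w Lu Lw; rewrite (linearopD _ _ (lact_lin _ _)); exact: L2subD.
- move=> u /closure_tends[s Ss su]; apply: L2sub_closed.
  exact: tends_closure (tends_op (lactb x y) su).
Qed.

Lemma L2subZ c u : L2sub A u -> L2sub A (c *: u).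
Proof.
move=> Lu; have -> : c *: u = lact L (c *: 1) 1 u.
  have := lactDl c 1 0 1 u; rewrite addr0 => ->; rewrite lact11.
  have := lactDl 1 0 0 1 u; rewrite scaler0 addr0 scale1r => /eqP.
  by rewrite -subr_eq subrr => /eqP <-; rewrite addr0.
by apply: L2sub_lact => //; [apply: subalgZ => //|]; exact: subalg1.
Qed.

Lemma L2subB u w : L2sub A u -> L2sub A w -> L2sub A (u - w).
Proof. by move=> Lu Lw; rewrite -scaleN1r; apply: L2subD => //; exact: L2subZ. Qed.

Lemma L2sub_comd a u : A a -> L2sub A u -> L2sub A (comd a u).
Proof. by move=> Aa Lu; apply: L2subB; apply: L2sub_lact => //; exact: subalg1. Qed.

Lemma L2sub_sum I (r : seq I) (F : I -> L) : (forall i, L2sub A (F i)) ->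
  L2sub A (\sum_(i <- r) F i).
Proof.
move=> h; elim: r => [|i r IH]; first by rewrite big_nil; exact: L2sub0.
by rewrite big_cons; exact: L2subD.
Qed.

(** Moving a across the inner product, <[a, h], 1 (x) 1> becomes the pairing of h with
    [comd (star a)] of 1 (x) 1, whose norm is at most twice the 2-norm of a. *)
Lemma inner_der11 h : L2sub A h -> Der11 A (fun a => comd a h).
Proof.
move=> Lh; split.
  split=> [a Aa|c a b Aa Ab|a b Aa Ab]; first exact: L2sub_comd.
    exact: comd_comb.
  exact: comdM.
exists (nrm h * 2)%:C%C => a Aa.
rewrite comd_adj cabsE.
have -> : sqrtC (tau (star a * a)) = (nrm (tens L a 1))%:C%C.
  rewrite -ip_tens1 ipE rmorphXn/= sqrCK// ler0c nrm_ge0.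
  by [].
rewrite -rcM lecR (le_trans (CS _ _))// -mulrA ler_wpM2l ?nrm_ge0//.
rewrite comd_nrm_star (le_trans (nrmB _ _))// !lact_one.
suff -> : nrm (tens L 1 a) = nrm (tens L a 1) by rewrite mulrDl mul1r.
apply: eq_nrm.
by rewrite !ip_tens star1 !mulr1 tau1 mulr1 mul1r (comm a).
Qed.

End SubBimodule.
End Bimodule.

(** * The Laplacian of a generating set *)

Section CentralProjection.
Context {R : realType} {M : starAlgType R} {tau : M -> R[i]} (L : tensorL2 tau).
Hypothesis comm : is_abelian M.
Hypothesis tau1 : tau 1 = 1.
Variable Y : {fset M}.
Hypothesis saY : self_adjoint_fset Y.
Implicit Types (a b x y : M) (u w : L).

Local Notation ip := (inner L).
Local Notation o := (tens L 1 1).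
Local Notation A := (star_alg_gen [set` Y]).
Local Notation sA := (star_alg_gen_subalg [set` Y]).

Definition laplacian u : L := \sum_(y : Y) comd (star (val y)) (comd (val y) u).

Lemma laplacian_bounded : bounded_op laplacian.
Proof.
suff h (s : seq Y) :
    bounded_op (fun u : L => \sum_(y <- s) comd (star (val y)) (comd (val y) u)) by exact: h.
elim: s => [|y s IH].
  by have := @bounded_op0 R L; congr bounded_op; apply/funext => u; rewrite big_nil.
have := bounded_op_lin 1 (bounded_op_comp (comdb L (star (val y))) (comdb L (val y))) IH.
by congr bounded_op; apply/funext => u; rewrite big_cons scale1r.
Qed.

Lemma laplacian_lin : linear laplacian.
Proof. by case: laplacian_bounded. Qed.

Lemma ip_laplacian u w : ip (laplacian u) w = \sum_(y : Y) ip (comd (val y) u) (comd (val y) w).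
Proof.
rewrite /laplacian.
have -> : ip (\sum_(y : Y) comd (star (val y)) (comd (val y) u)) w =
   \sum_(y : Y) ip (comd (star (val y)) (comd (val y) u)) w.
  by elim/big_ind2 : _ => [|? ? ? ? <- <-|//]; rewrite ?ip0l ?ipDl.
by apply: eq_bigr => y _; rewrite comd_adj// starK.
Qed.

Definition energy u : R := \sum_(y : Y) nrm (comd (val y) u) ^+ 2.

Lemma energy_ge0 u : 0 <= energy u.
Proof. by apply: sumr_ge0 => y _; exact: sqr_ge0. Qed.

Lemma energyE u : ip (laplacian u) u = (energy u)%:C%C.
Proof.
rewrite ip_laplacian /energy rmorph_sum/=.
by apply: eq_bigr => y _; rewrite ipE.
Qed.

Lemma laplacian_sym u w : ip (laplacian u) w = ip u (laplacian w).
Proof.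
rewrite ip_laplacian [RHS]ipC ip_laplacian rmorph_sum/=.
by apply: eq_bigr => y _; rewrite -ipC.
Qed.

Lemma energy_eq0 u : energy u = 0 -> forall y : Y, comd (val y) u = 0.
Proof.
move=> /eqP; rewrite psumr_eq0 => [/allP h y|y _]; last exact: sqr_ge0.
by have := h y (mem_index_enum y); rewrite sqrf_eq0 => /eqP/nrm_eq0.
Qed.

(** Since W is positive and bounded by some K, W^2 <= K W. The argument uses only the quadratic
    form, and the summand 1 in K keeps it positive when Y is empty. *)
Lemma laplacian_estimate : exists2 C : R, 0 < C &
  forall u, nrm (laplacian u) ^+ 2 <= C * energy u.
Proof.
have /choice[c hc] : forall y : Y, exists c : R, forall u, nrm (comd (val y) u) <= c * nrm u.
  by move=> y; have /bounded_opP[_ [c _ hc]] := comdb L (val y); exists c.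
pose K := 1 + \sum_(y : Y) c y ^+ 2.
have K0 : 0 < K by rewrite ltr_wpDr// sumr_ge0// => y _; exact: sqr_ge0.
have hK w : energy w <= K * nrm w ^+ 2.
  rewrite /K mulrDl mul1r ler_wpDl ?sqr_ge0// mulr_suml.
  apply: ler_sum => y _; rewrite -exprMn lerXn2r ?nnegrE ?nrm_ge0//.
  by rewrite (le_trans (nrm_ge0 _) (hc y w)).
exists K => // u; set w := laplacian u.
(* The inequality 2 p q <= K p^2 + q^2 / K is applied termwise in Y; the part with [energy w] is
   then absorbed into the left-hand side. *)
suff : nrm w ^+ 2 <= 2^-1 * (K * energy u + K^-1 * energy w).
  have : K^-1 * energy w <= nrm w ^+ 2 by rewrite ler_pdivrMl.
  by lra.
rewrite nrm2_Re {1}/w ip_laplacian raddf_sum/= /energy !mulr_sumr -big_split/= mulr_sumr.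
apply: ler_sum => y _.
rewrite (le_trans (ler_norm _))// (le_trans (Re_le_cabs _))// (le_trans (CS _ _))//.
set p := nrm _; set q := nrm _.
rewrite -subr_ge0.
have -> : 2^-1 * (K * p ^+ 2 + K^-1 * q ^+ 2) - p * q =
    (2 * K)^-1 * (K * p - q) ^+ 2.
  by field; rewrite gt_eqF.
by rewrite mulr_ge0 ?sqr_ge0// invr_ge0 mulr_ge0// ltW.
Qed.

(** The estimate yields mere existence; choosing one constant makes [markov] and [green] functions.
    The default 1 is not reached. *)
Definition laplacian_cst : R :=
  xget 1 [set C | 0 < C /\ forall u, nrm (laplacian u) ^+ 2 <= C * energy u].

Lemma laplacian_cstP :
  0 < laplacian_cst /\ forall u, nrm (laplacian u) ^+ 2 <= laplacian_cst * energy u.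
Proof.
rewrite /laplacian_cst; case: xgetP => [C _ //|h]; exfalso.
by have [C C0 hC] := laplacian_estimate; apply: (h C).
Qed.

Local Notation C := laplacian_cst.

Definition markov u : L := u - C^-1%:C%C *: laplacian u.

(** The cross term removes twice [energy u] / C and [laplacian_estimate] gives back at most one of
    them. The remaining loss shows that isometry forces zero energy. *)
Lemma markov_nrm u : nrm (markov u) ^+ 2 <= nrm u ^+ 2 - C^-1 * energy u.
Proof.
have [C0 hC] := laplacian_cstP.
rewrite /markov nrmB2 ipZr conj_realC nrmZ cabs_real ger0_norm ?invr_ge0 ?(ltW C0)//.
rewrite -laplacian_sym energyE -rcM/= exprMn.
have : C^-1 ^+ 2 * nrm (laplacian u) ^+ 2 <= C^-1 * energy u.
  rewrite expr2 -mulrA ler_wpM2l ?invr_ge0 ?(ltW C0)//.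
  by rewrite ler_pdivrMl.
lra.
Qed.

Lemma markov_contraction : sa_contraction markov.
Proof.
have [C0 _] := laplacian_cstP; split.
- move=> c u w; rewrite /markov laplacian_lin !scalerDr !scalerA scalerN !scalerA.
  by rewrite (mulrC _ c) opprD !addrA; congr (_ - _); rewrite addrAC.
- move=> u; rewrite -ler_sqr ?nnegrE ?nrm_ge0//; apply: le_trans (markov_nrm u) _.
  by rewrite gerBl mulr_ge0 ?energy_ge0// invr_ge0 ltW.
- move=> u w; rewrite /markov ipBl ipBr ipZl ipZr conj_realC.
  by rewrite laplacian_sym.
Qed.

Lemma laplacian_comm (T : L -> L) u : linear T -> (forall a w, comd a (T w) = T (comd a w)) ->
  laplacian (T u) = T (laplacian u).
Proof.
move=> lT hT; rewrite /laplacian (linearop_sum _ _ lT).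
by apply: eq_bigr => y _; rewrite !hT.
Qed.

Lemma markov_comm (T : L -> L) u : linear T -> (forall a w, comd a (T w) = T (comd a w)) ->
  markov (T u) = T (markov u).
Proof. by move=> lT hT; rewrite /markov (linearopB _ _ lT) (linearopZ _ _ lT) laplacian_comm. Qed.

Lemma L2sub_markov u : L2sub A u -> L2sub A (markov u).
Proof.
move=> Lu; apply: L2subB => //; first exact: sA.
apply: L2subZ => //; first exact: sA.
apply: L2sub_sum => [|y]; first exact: sA.
have Ay : A (val y) by apply: subset_star_alg_gen; exact: (valP y).
apply: L2sub_comd => //; [exact: sA|exact: subalg_star sA _ Ay|].
by apply: L2sub_comd => //; exact: sA.
Qed.

Definition centralE := power_limit markov.
Local Notation E := centralE.

Lemma centralE_lin : linear E.
Proof. exact: power_limit_linear markov_contraction. Qed.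

Lemma centralE_sym u w : ip (E u) w = ip u (E w).
Proof. exact: power_limit_sym markov_contraction _ _. Qed.

Lemma centralE_nrm u : nrm (E u) <= nrm u.
Proof. exact: power_limit_nrm markov_contraction _. Qed.

Lemma centralE_idem u : E (E u) = E u.
Proof. exact: power_limit_idem markov_contraction _. Qed.

Lemma centralE_lact x y u : E (lact L x y u) = lact L x y (E u).
Proof.
apply: (power_limit_comm markov_contraction _ (lactb L x y)) => w.
by apply: markov_comm => [|a w']; [exact: lact_lin|exact: comd_lact].
Qed.

Lemma centralE_comd a u : E (comd a u) = comd a (E u).
Proof. by rewrite /comd (linearopB _ _ centralE_lin) !centralE_lact. Qed.

Lemma L2sub_centralE u : L2sub A u -> L2sub A (E u).
Proof.
move=> Lu; apply: L2sub_closed.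
by apply: (power_limit_closed markov_contraction) Lu => w; exact: L2sub_markov.
Qed.

Lemma comd_centralE u a : A a -> comd a (E u) = 0.
Proof.
have hY (y : Y) : comd (val y) (E u) = 0.
  apply: energy_eq0; apply/eqP; rewrite eq_le energy_ge0 andbT.
  (* [E u] is fixed by the square of [markov], so [markov] preserves its norm and the energy loss
     must vanish. *)
  have := markov_nrm (E u); rewrite /E (power_limit_isometric markov_contraction).
  have [C0 _] := laplacian_cstP.
  rewrite -/E => h; have : C^-1 * energy (E u) <= 0 by move: h; lra.
  by rewrite pmulr_rle0// invr_gt0.
(* Vanishing extends from Y to the generated algebra: the elements a with [comd a (E u) = 0] form a
   star subalgebra, stable under [star] by [comd_nrm_star]. *)
move=> Aa; apply: (Aa [set a | comd a (E u) = 0]).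
  split=> [|c x y /= hx hy|x y /= hx hy|x /= hx]; rewrite /=.
  - exact: comd1.
  - by rewrite comd_comb// hx hy scaler0 addr0.
  - by rewrite comdM// hx hy !(linearop0 (lact_lin _ _)) addr0.
  - by apply: nrm_eq0; rewrite comd_nrm_star// hx nrm0.
by move=> y Yy; exact: (hY [` Yy]%fset).
Qed.

Lemma centralE_fix u : (forall y, y \in Y -> comd y u = 0) -> E u = u.
Proof.
move=> h; apply: (power_limit_fix markov_contraction).
rewrite /markov /laplacian big1 ?scaler0 ?subr0// => y _.
by rewrite (h _ (fsvalP y)) (linearop0 (comd_lin _)).
Qed.

Lemma lact_centralE u a b : A a -> A b ->
  lact L a b (E u) = lact L (a * b) 1 (E u).
Proof.
move=> Aa Ab; rewrite lact_split// -[in RHS](mulr1 1) -lactM//.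
congr lact; apply/eqP; rewrite eq_sym -subr_eq0; apply/eqP.
exact: comd_centralE.
Qed.

(* [green n] approximates the inverse of the Laplacian on the range of [1 - E]. *)
Definition green n u : L := C^-1%:C%C *: \sum_(j < n.*2) iter j markov u.

(** W equals C times (1 - [markov]), so the geometric sum telescopes. *)
Lemma laplacian_green n u : laplacian (green n u) = u - iter n.*2 markov u.
Proof.
rewrite /green (linearopZ _ _ laplacian_lin) (linearop_sum _ _ laplacian_lin) scaler_sumr.
elim: n.*2 => [|k IH]; first by rewrite big_ord0 subrr.
rewrite big_ord_recr /= IH; set x := iter k markov u.
by rewrite [markov x]/markov opprB addrA addrAC.
Qed.

Lemma green_bounded n : bounded_op (green n).
Proof.
have bs k : bounded_op (fun u => \sum_(j < k) iter j markov u).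
  elim: k => [|k IH].
    by have := @bounded_op0 R L; congr bounded_op; apply/funext => u; rewrite big_ord0.
  have bi : bounded_op (iter k markov).
    apply/bounded_opP; split; first exact: iter_linear markov_contraction _.
    by exists 1 => // v; rewrite mul1r; exact: iter_nrm markov_contraction _ _.
  have := bounded_op_lin 1 bi IH.
  by congr bounded_op; apply/funext => u; rewrite big_ord_recr/= scale1r addrC.
have := bounded_op_lin C^-1%:C%C (bs n.*2) (@bounded_op0 R L).
by congr bounded_op; apply/funext => u; rewrite addr0.
Qed.

Lemma green_comm n (T : L -> L) u : linear T -> (forall a w, comd a (T w) = T (comd a w)) ->
  green n (T u) = T (green n u).
Proof.
move=> lT hT; rewrite /green (linearopZ _ _ lT) (linearop_sum _ _ lT); congr (_ *: _).
apply: eq_bigr => j _; elim: (j : nat) => [//|k IH]; rewrite !iterS IH.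
exact: markov_comm.
Qed.

Lemma L2sub_green n u : L2sub A u -> L2sub A (green n u).
Proof.
move=> Lu; apply: L2subZ => //; first exact: sA.
apply: L2sub_sum => [|j]; first exact: sA.
by elim: (j : nat) => [//|k IH]; rewrite iterS; exact: L2sub_markov.
Qed.

Lemma tends_laplacian_green u : tends (fun n => laplacian (green n u)) (u - E u).
Proof.
apply: tends_ext (tendsB (tends_cst u) (power_limitP markov_contraction u)) _ => n.
exact: laplacian_green.
Qed.

End CentralProjection.

(** * Chebyshev polynomials of self-adjoint elements *)

(* [chebyshev x k] is the pair (T_{k+1}(x), U_k(x)). *)
Fixpoint chebyshev (S : nzRingType) (x : S) k : S * S :=
  if k is k'.+1 then
    (x * (chebyshev x k').1 - (1 - x * x) * (chebyshev x k').2,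
     (chebyshev x k').1 + x * (chebyshev x k').2)
  else (x, 1).

Definition chebT (S : nzRingType) (x : S) k := (chebyshev x k).1.
Definition chebU (S : nzRingType) (x : S) k := (chebyshev x k).2.

Section ChebyshevCommutative.
Variables (S : comNzRingType) (x : S).

Lemma cheb_pell k : chebT x k * chebT x k + (1 - x * x) * (chebU x k * chebU x k) = 1.
Proof.
rewrite /chebT /chebU; elim: k => [|k IH] /=; first by ring.
by rewrite -[RHS]IH; ring.
Qed.

Lemma chebT_rec k : chebT x k.+2 = 2%:R * (x * chebT x k.+1) - chebT x k.
Proof. by rewrite /chebT /=; ring. Qed.

Lemma chebU_rec k : chebU x k.+2 = 2%:R * (x * chebU x k.+1) - chebU x k.
Proof. by rewrite /chebU /=; ring. Qed.

Lemma chebT1 : chebT x 1 = 2%:R * (x * x) - 1.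
Proof. by rewrite /chebT /=; ring. Qed.

(** The three-term recursion of [chebT], differentiated in x, with (k+1) [chebU x k] in the place of
    the derivative of [chebT x k]. *)
Lemma chebU_deriv k : k.+2%:R * (2%:R * (x * chebU x k.+1)) + 2%:R * chebT x k.+1
   - k.+1%:R * chebU x k = k.+3%:R * chebU x k.+2.
Proof.
rewrite (_ : chebT x k.+1 = chebU x k.+2 - x * chebU x k.+1); last first.
  by rewrite /chebU /chebT /=; ring.
by rewrite chebU_rec -!natr1; ring.
Qed.

End ChebyshevCommutative.

Section ChebyshevAbelian.
Context {R : realType} {M : starAlgType R}.
Hypothesis comm : is_abelian M.
Variable x : M.

(** The same ring with its commutativity recorded in the structure: identities obtained by [ring]
    there hold in M by conversion. *)
Let M' : comNzRingType := HB.pack (GRing.NzRing.sort M)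
  (GRing.PzRing_hasCommutativeMul.Build M comm).

Local Notation T := (chebT x).
Local Notation U := (chebU x).

Lemma chebA_pell k : T k * T k + (1 - x * x) * (U k * U k) = 1.
Proof. exact: (@cheb_pell M' x k). Qed.
Lemma chebAT_rec k : T k.+2 = 2%:R * (x * T k.+1) - T k.
Proof. exact: (@chebT_rec M' x k). Qed.
Lemma chebAU_rec k : U k.+2 = 2%:R * (x * U k.+1) - U k.
Proof. exact: (@chebU_rec M' x k). Qed.
Lemma chebAT1 : T 1 = 2%:R * (x * x) - 1.
Proof. exact: (@chebT1 M' x). Qed.
Lemma chebAU_deriv k : k.+2%:R * (2%:R * (x * U k.+1)) + 2%:R * T k.+1
   - k.+1%:R * U k = k.+3%:R * U k.+2.
Proof. exact: (@chebU_deriv M' x k). Qed.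

Lemma cheb_star : star x = x -> forall k, star (T k) = T k /\ star (U k) = U k.
Proof.
move=> sx; elim=> [|k [IT IU]]; first by rewrite /chebT /chebU/= star1.
have -> : T k.+1 = x * T k - (1 - x * x) * U k by [].
have -> : U k.+1 = T k + x * U k by [].
by rewrite starB starD !(starMc comm) starB star1 (starMc comm) sx IT IU.
Qed.

Lemma cheb_subalg (A : set M) : is_star_subalg A -> A x ->
  forall k, A (T k) /\ A (U k).
Proof.
move=> sA Ax; elim=> [|k [IT IU]]; first by split => //; exact: subalg1.
split.
  apply: subalgB => //; first exact: subalgM.
  by apply: subalgM => //; apply: subalgB; [|exact: subalg1|exact: subalgM].
by apply: subalgD => //; exact: subalgM.
Qed.

(* With |x| <= 1/2, the Pell identity T^2 + (1 - x^2) U^2 = 1 bounds T by 1 and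
   U by 2 in any *-representation. *)
Lemma cheb_bound (H : hilbertType R) (rho : M -> H -> H) :
  (forall c a b u, rho (c *: a + b) u = c *: rho a u + rho b u) ->
  (forall u, rho 1 u = u) ->
  (forall a b u, rho (a * b) u = rho a (rho b u)) ->
  (forall a u w, inner H (rho a u) w = inner H u (rho (star a) w)) ->
  star x = x -> (forall u, nrm (rho x u) <= 2^-1 * nrm u) ->
  forall k u, nrm (rho (T k) u) <= nrm u /\ nrm (rho (U k) u) <= 2 * nrm u.
Proof.
move=> rP r1 rM rS sx xb k u; have [sT sU] := cheb_star sx k.
have r0 w : rho 0 w = 0.
  by have := rP (-1) 0 0 w; rewrite !scaleN1r oppr0 addr0 addNr.
have rD a b w : rho (a + b) w = rho a w + rho b w.
  by have := rP 1 a b w; rewrite !scale1r.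
have rN a w : rho (- a) w = - rho a w.
  by have := rP (-1) a 0 w; rewrite r0 !addr0 !scaleN1r.
have sq a : star a = a -> inner H (rho (a * a) u) u = (nrm (rho a u) ^+ 2)%:C%C.
  by move=> sa; rewrite rM rS sa ipE.
have /(congr1 (inner H ^~ u)) := r1 u; rewrite -{1}(chebA_pell k) mulrBl mul1r ipE.
rewrite (_ : x * x * (U k * U k) = (x * U k) * (x * U k)); last first.
  by rewrite -!mulrA; congr (x * _); rewrite !mulrA (comm x).
rewrite !rD rN !ipDl ipNl !sq ?(starMc comm) ?sx ?sU ?sT//.
rewrite -rcB -rcD => /(congr1 (@complex.Re R)) /=.
have := xb (rho (U k) u); rewrite -rM.
set p := nrm (rho (T k) u); set q := nrm (rho (U k) u); set s := nrm (rho (x * U k) u).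
have p0 : 0 <= p by exact: nrm_ge0.
have q0 : 0 <= q by exact: nrm_ge0.
have s0 : 0 <= s by exact: nrm_ge0.
move=> hs e; have u0 := nrm_ge0 u.
(* Paired with u, Pell's identity reads |T u|^2 + |U u|^2 - |x U u|^2 = |u|^2. The negative term
   takes away at most a quarter of |U u|^2. *)
have ss : s ^+ 2 <= 4^-1 * q ^+ 2.
  have -> : 4^-1 * q ^+ 2 = (2^-1 * q) ^+ 2 by field.
  by rewrite lerXn2r ?nnegrE ?mulr_ge0.
have p2 := sqr_ge0 p; have q2 := sqr_ge0 q.
split; rewrite -ler_sqr ?nnegrE ?mulr_ge0 ?exprMn//; lra.
Qed.

End ChebyshevAbelian.

Lemma two_step_ind (P : nat -> Prop) : P 0%N -> P 1%N ->
  (forall k, P k -> P k.+1 -> P k.+2) -> forall k, P k.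
Proof.
move=> P0 P1 PS k; suff [] : P k /\ P k.+1 by [].
by elim: k => [//|k [IH1 IH2]]; split=> //; exact: PS.
Qed.

(** * Derivations evaluated on Chebyshev polynomials *)

Section Derivations.
Context {R : realType} {M : starAlgType R} {tau : M -> R[i]} (L : tensorL2 tau).
Hypothesis comm : is_abelian M.
Variables (A : set M) (sA : is_star_subalg A) (delta : M -> L).
Hypothesis hd : is_derivation A delta.
Implicit Types (a b x y : M) (u w : L).

Lemma derM a b : A a -> A b ->
  delta (a * b) = lact L a 1 (delta b) + lact L 1 b (delta a).
Proof. by case: hd => _ _; exact. Qed.

Lemma der_comb c a b : A a -> A b -> delta (c *: a + b) = c *: delta a + delta b.
Proof. by case: hd => _ + _; exact. Qed.

Lemma der_L2sub a : A a -> L2sub A (delta a).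
Proof. by case: hd => + _ _; exact. Qed.

Lemma der1 : delta 1 = 0.
Proof.
have := derM (subalg1 sA) (subalg1 sA); rewrite mulr1 !lact11// => /eqP.
by rewrite -subr_eq subrr => /eqP.
Qed.

Lemma der0 : delta 0 = 0.
Proof.
by have := der_comb (-1) (subalg1 sA) (subalg1 sA); rewrite !scaleN1r !addNr.
Qed.

Lemma derZ c a : A a -> delta (c *: a) = c *: delta a.
Proof.
by move=> Aa; have := der_comb c Aa (subalg0 sA); rewrite der0 !addr0.
Qed.

Lemma derB a b : A a -> A b -> delta (a - b) = delta a - delta b.
Proof.
move=> Aa Ab; have := der_comb (-1) Ab Aa.
by rewrite !scaleN1r addrC => ->; rewrite addrC.
Qed.

(** Compare the Leibniz rule for a b and for b a. This symmetry lets a commutator with [delta b] be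
    estimated through [delta a], and makes closure elements limits of inner derivations. *)
Lemma der_comd a b : A a -> A b -> comd a (delta b) = comd b (delta a).
Proof.
move=> Aa Ab; have := derM Aa Ab; rewrite (comm a) derM// => e.
by apply/eqP; rewrite /comd subr_eq addrAC e addrK.
Qed.

Section Chebyshev.
Variable x : M.
Hypothesis (sx : star x = x) (Ax : A x).
Hypothesis xl : forall u : L, nrm (lact L x 1 u) <= 2^-1 * nrm u.
Hypothesis xr : forall u : L, nrm (lact L 1 x u) <= 2^-1 * nrm u.
Local Notation T := (chebT x).
Local Notation U := (chebU x).
Local Notation D := (delta x).

Lemma cheb_boundl k u : nrm (lact L (T k) 1 u) <= nrm u /\ nrm (lact L (U k) 1 u) <= 2 * nrm u.
Proof.
apply: (@cheb_bound _ _ comm x L (fun a u => lact L a 1 u)) => //.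
- by move=> *; exact: lactDl.
- by move=> *; rewrite lact11.
- by move=> *; rewrite lactM// mulr1.
- by move=> *; rewrite lact_adj// star1.
Qed.

Lemma cheb_boundr k u : nrm (lact L 1 (T k) u) <= nrm u /\ nrm (lact L 1 (U k) u) <= 2 * nrm u.
Proof.
apply: (@cheb_bound _ _ comm x L (fun a u => lact L 1 a u)) => //.
- by move=> *; exact: lactDr.
- by move=> *; rewrite lact11.
- by move=> *; rewrite lactM// mulr1.
- by move=> *; rewrite lact_adj// star1.
Qed.

Let AT k : A (T k). Proof. by have [] := cheb_subalg sA Ax k. Qed.
Let AU k : A (U k). Proof. by have [] := cheb_subalg sA Ax k. Qed.

Lemma scale2M a : 2%:R * a = (2%:R : R[i]) *: a.
Proof. by rewrite mulr_natl scaler_nat. Qed.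

Lemma lactZl c a b u : lact L (c *: a) b u = c *: lact L a b u.
Proof.
have l0 : lact L 0 b u = 0.
  by have := @lactDl _ _ _ L (-1) 0 0 b u; rewrite !scaleN1r oppr0 addr0 addNr.
by have := @lactDl _ _ _ L c a 0 b u; rewrite l0 !addr0.
Qed.

Lemma lactZr c a b u : lact L a (c *: b) u = c *: lact L a b u.
Proof.
have l0 : lact L a 0 u = 0.
  by have := @lactDr _ _ _ L (-1) a 0 0 u; rewrite !scaleN1r oppr0 addr0 addNr.
by have := @lactDr _ _ _ L c a b 0 u; rewrite l0 !addr0.
Qed.

Lemma lactBl a a' b u : lact L (a - a') b u = lact L a b u - lact L a' b u.
Proof.
have := @lactDl _ _ _ L (-1) a' a b u.
by rewrite !scaleN1r addrC => ->; rewrite addrC.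
Qed.

Lemma der_chebT1 : delta (T 1) = 2%:R *: (lact L x 1 D + lact L 1 x D).
Proof.
rewrite chebAT1// scale2M derB ?derZ ?der1 ?subr0 ?derM//.
- exact: subalgM.
- by apply: subalgZ => //; exact: subalgM.
- exact: subalg1.
Qed.

Lemma der_chebT_rec k : delta (T k.+2) =
  2%:R *: (lact L x 1 (delta (T k.+1)) + lact L 1 (T k.+1) D) - delta (T k).
Proof.
have Axt : A (x * T k.+1) by exact: subalgM.
rewrite chebAT_rec// scale2M derB ?derZ ?derM//.
exact: subalgZ.
Qed.

(** By [der_chebT_rec], [delta (T k)] obeys the Chebyshev recursion for left multiplication by x,
    with a source 2 (1 (x) T) D. This is Duhamel's sum for half that source, with U as fundamental
    solution; the homogeneous part U D is added in [der_chebT]. *)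
Definition cheb_conv k : L := \sum_(j < k) lact L (U (k - j.+1)) (T j) D.

Lemma cheb_conv_rec k : cheb_conv k.+2 =
  2%:R *: lact L x 1 (cheb_conv k.+1) - cheb_conv k + lact L 1 (T k.+1) D.
Proof.
have U0 : U 0 = 1 by [].
have U1 : U 1 = 2%:R *: x.
  rewrite -scale2M; have -> : U 1 = x + x * 1 by [].
  by rewrite mulr1 mulr_natl mulr2n.
rewrite /cheb_conv big_ord_recr/= subnn U0 big_ord_recr/= subSnn U1.
rewrite [in RHS]big_ord_recr/= subnn U0.
rewrite (linearopD _ _ (lact_lin _ _)) scalerDr lactM// mulr1 mul1r lactZl.
congr (_ + _); rewrite addrAC; congr (_ + _).
rewrite (linearop_sum _ _ (lact_lin _ _)) scaler_sumr -sumrB.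
apply: eq_bigr => j _; have jk := ltn_ord j.
rewrite lactM// mul1r (_ : (k.+2 - j.+1 = (k - j.+1).+2)%N); last first.
  by rewrite subSS subSn ?(ltnW jk)// subnSK.
rewrite chebAU_rec// scale2M lactBl lactZl.
by rewrite subnSK// subSS.
Qed.

Lemma der_chebT k : delta (T k) = 2%:R *: cheb_conv k + lact L (U k) 1 D.
Proof.
move: k; apply: two_step_ind.
- by rewrite /cheb_conv big_ord0 scaler0 add0r lact11.
- rewrite der_chebT1 /cheb_conv big_ord1 scalerDr addrC; congr (_ + _).
  rewrite (_ : U 1 = 2%:R *: x) ?lactZl// -scale2M.
  by have -> : U 1 = x + x * 1 by []; rewrite mulr1 mulr_natl mulr2n.
- move=> k IH0 IH1; rewrite der_chebT_rec IH0 IH1 cheb_conv_rec.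
  rewrite chebAU_rec// scale2M lactBl lactZl.
  rewrite (linearopD _ _ (lact_lin _ _)) (linearopZ _ _ (lact_lin _ _)) lactM// mulr1.
  rewrite !scalerDr !scalerN opprD.
  rewrite -!addrA; congr (_ + _).
  rewrite [in LHS]addrCA [in RHS]addrCA; congr (_ + _).
  by rewrite addrCA.
Qed.

Lemma cheb_conv_nrm k : nrm (cheb_conv k) <= k%:R * (2 * nrm D).
Proof.
rewrite /cheb_conv.
have -> : k%:R * (2 * nrm D) = \sum_(j < k) (2 * nrm D).
  by rewrite sumr_const card_ord mulr_natl.
apply: (big_ind2 (fun (u : L) (c : R) => nrm u <= c)); first by rewrite nrm0.
  by move=> u c w d hu hw; rewrite (le_trans (nrmD _ _))// lerD.
move=> j _; rewrite lact_split//.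
apply: le_trans (cheb_boundl _ _).2 _.
by rewrite ler_wpM2l// (cheb_boundr _ _).1.
Qed.

Definition cheb_quot k : L := (k.+1%:R^-1)%:C%C *: delta (T k).

(** The convolution has k terms of norm at most 2 |D|. Doubled, and with the term in U k, this gives
    at most (4 k + 2) |D|, against the divisor k + 1, which is the degree of T k. *)
Lemma cheb_quot_nrm k : nrm (cheb_quot k) <= 4 * nrm D.
Proof.
rewrite /cheb_quot nrmZ cabs_real ger0_norm ?invr_ge0//.
rewrite ler_pdivrMl// der_chebT (le_trans (nrmD _ _))//.
rewrite nrmZ (_ : cabs 2%:R = 2); last first.
  by rewrite (_ : 2%:R = 2%:C%C) ?cabs_real ?ger0_norm// rmorph_nat.
have := cheb_conv_nrm k; have := (cheb_boundl k D).2.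
have := nrm_ge0 D; rewrite -natr1; set n := nrm D; set p := nrm _; set q := nrm _.
lra.
Qed.

(** By [der_comd] the commutator of a with [delta (T k)] is that of T k with [delta a]. It stays
    bounded since T k is a contraction, so the division by k + 1 sends it to 0. *)
Lemma cheb_quot_comd a : A a -> null (fun k => nrm (comd a (cheb_quot k))).
Proof.
move=> Aa; apply: null_le (null_inv (2 * nrm (delta a))) _ => k.
rewrite ger0_norm ?nrm_ge0// /cheb_quot (linearopZ _ _ (comd_lin _)) nrmZ.
rewrite cabs_real ger0_norm ?invr_ge0// mulrC ler_pM2r ?invr_gt0//.
rewrite der_comd// (le_trans (nrmB _ _))// mulrDl mul1r lerD//.
  exact: (cheb_boundl _ _).1.
exact: (cheb_boundr _ _).1.
Qed.

(* By the Leibniz rule, 1 (x) 1 in dom(delta^* ) forces A (x) A into it as well. *)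
Lemma cheb_quot_wnull b c : in_dom_adjoint A delta (tens L 1 1) -> tau 1 = 1 ->
  A b -> A c -> wnull cheb_quot (tens L b c).
Proof.
move=> [C0 hC0] tau1 Ab Ac; pose C := cabs C0.
have hC a : A a -> cabs (inner L (delta a) (tens L 1 1)) <= C * nrm (tens L a 1).
  move=> Aa; have := hC0 a Aa.
  have -> : sqrtC (tau (star a * a)) = (nrm (tens L a 1))%:C%C.
    by rewrite -(ip_tens1 L tau1) ipE rmorphXn/= sqrCK// ler0c nrm_ge0.
  move=> h; have /ger0_norm e := le_trans (normr_ge0 _) h.
  by move: h; rewrite -e !cabsE lecR cabsM cabs_real ger0_norm ?nrm_ge0.
pose K := C * nrm (tens L (star b * star c) 1) +
  nrm (delta (star c)) * nrm (tens L b 1) +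
  nrm (delta (star b)) * nrm (tens L 1 c).
apply: null_le (null_inv K) _ => k; rewrite ger0_norm ?cabs_ge0//.
rewrite /cheb_quot ipZl cabsM cabs_real ger0_norm ?invr_ge0// mulrC ler_pM2r ?invr_gt0//.
have [Tk Asb Asc] : [/\ A (T k), A (star b) & A (star c)].
  by split=> //; exact: subalg_star.
have ATc : A (T k * star c) by exact: subalgM.
rewrite -(lact_one L b c) -{1}(starK b) -{1}(starK c) -lact_adj//.
(* The Leibniz rule, solved for the term where delta falls on T k. Against 1 (x) 1 the first term is
   controlled by the domain of the adjoint, the other two by contractivity of T k; none grows with
   k. *)
have -> : lact L (star b) (star c) (delta (T k)) =
    delta (star b * (T k * star c)) - lact L (star b) 1 (lact L (T k) 1 (delta (star c)))
    - lact L 1 (star c) (lact L 1 (T k) (delta (star b))).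
  rewrite derM// derM// (linearopD _ _ (lact_lin _ _)) (lactM comm 1 (star c)).
  rewrite mulr1 (comm (star c)) addrAC addrK addrC addKr.
  by rewrite lactM// mulr1 mul1r.
rewrite !ipBl (le_trans (cabsD _ _))// cabsN lerD//; last first.
  rewrite lact_adj// star1 starK lact_one (le_trans (CS _ _))//.
  by rewrite ler_wpM2r ?nrm_ge0// (cheb_boundr _ _).1.
rewrite (le_trans (cabsD _ _))// cabsN lerD//; last first.
  rewrite lact_adj// star1 starK lact_one (le_trans (CS _ _))//.
  by rewrite ler_wpM2r ?nrm_ge0// (cheb_boundl _ _).1.
apply: le_trans (hC _ (subalgM sA Asb ATc)) _; rewrite ler_wpM2l ?cabs_ge0//.
rewrite mulrA (comm (star b)) -mulrA -[tens _ _ 1](lact_one L).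
have -> : lact L (T k * (star b * star c)) 1 (tens L 1 1) =
   lact L (T k) 1 (tens L (star b * star c) 1) by rewrite !lact_tens !mulr1.
exact: (cheb_boundl _ _).1.
Qed.

End Chebyshev.
End Derivations.

(** * Derivations in Der_{1(x)1} vanish on the diagonal *)

Section Der11Vanishing.
Context {R : realType} {M : starAlgType R} {tau : M -> R[i]} (L : tensorL2 tau).
Hypothesis comm : is_abelian M.
Hypothesis tau1 : tau 1 = 1.
Variable Y : {fset M}.
Hypothesis saY : self_adjoint_fset Y.
Implicit Types (a b x y : M) (u w : L).

Local Notation ip := (inner L).
Local Notation o := (tens L 1 1).
Local Notation A := (star_alg_gen [set` Y]).
Local Notation sA := (star_alg_gen_subalg [set` Y]).
Local Notation E := (@centralE R M tau L Y).

Lemma centralE_tens a b : A a -> A b -> E (tens L a b) = lact L (a * b) 1 (E o).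
Proof. by move=> Aa Ab; rewrite -lact_one centralE_lact// lact_centralE. Qed.

Section Chebyshev.
Variable x : M.
Hypothesis (sx : star x = x) (Ax : A x).
Hypothesis xl : forall u : L, nrm (lact L x 1 u) <= 2^-1 * nrm u.
Hypothesis xr : forall u : L, nrm (lact L 1 x u) <= 2^-1 * nrm u.
Local Notation T := (chebT x).
Local Notation U := (chebU x).

Let AT k : A (T k). Proof. by have [] := cheb_subalg sA Ax k. Qed.
Let AU k : A (U k). Proof. by have [] := cheb_subalg sA Ax k. Qed.
Let sT k : star (T k) = T k. Proof. by have [] := cheb_star comm sx k. Qed.
Let sU k : star (U k) = U k. Proof. by have [] := cheb_star comm sx k. Qed.
Let Tl k u : nrm (lact L (T k) 1 u) <= nrm u.
Proof. exact: (cheb_boundl comm sx xl _ _).1. Qed.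
Let Ul k u : nrm (lact L (U k) 1 u) <= 2 * nrm u.
Proof. exact: (cheb_boundl comm sx xl _ _).2. Qed.
Let Tr k u : nrm (lact L 1 (T k) u) <= nrm u.
Proof. exact: (cheb_boundr comm sx xr _ _).1. Qed.
Let Ur k u : nrm (lact L 1 (U k) u) <= 2 * nrm u.
Proof. exact: (cheb_boundr comm sx xr _ _).2. Qed.

Lemma lact_centralEr u a : A a -> lact L 1 a (E u) = lact L a 1 (E u).
Proof. by move=> Aa; rewrite lact_centralE ?mul1r//; exact: subalg1 sA. Qed.

Section Derivation.
Variable delta : M -> L.
Hypothesis hd : Der11 A delta.
Local Notation zeta := (E (delta x)).

(** On the diagonal the left and right actions agree, so E delta is an ordinary derivation there: it
    sends a polynomial to its derivative times zeta. *)
Lemma centralE_der_chebT k :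
  E (delta (T k)) = (k.+1%:R : R[i]) *: lact L (U k) 1 zeta.
Proof.
have dd := hd.1; have lE : linear E by exact: centralE_lin.
move: k; apply: two_step_ind.
- by rewrite scale1r lact11.
- rewrite (der_chebT1 comm sA dd Ax) (linearopZ _ _ lE) (linearopD _ _ lE).
  rewrite !centralE_lact// lact_centralEr//; congr (_ *: _).
  have -> : U 1 = 2%:R *: x.
    have -> : U 1 = x + x * 1 by []; rewrite mulr1.
    by rewrite scaler_nat mulr2n.
  by rewrite lactZl scaler_nat mulr2n.
- move=> k IH0 IH1; rewrite (der_chebT_rec comm sA dd Ax).
  rewrite (linearopB _ _ lE) (linearopZ _ _ lE) (linearopD _ _ lE) !centralE_lact//.
  rewrite IH0 IH1 lact_centralEr// (linearopZ _ _ (lact_lin _ _)) lactM// mulr1.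
  rewrite -!lactZl.
  have zD a b u : lact L (a + b) 1 u = lact L a 1 u + lact L b 1 u.
    by have := lactDl 1 a b 1 u; rewrite !scale1r.
  rewrite -zD -lactZl -lactBl; congr (lact L _ 1 _).
  have := chebAU_deriv comm x k.
  have nz n (z : M) : n%:R * z = (n%:R : R[i]) *: z by rewrite mulr_natl scaler_nat.
  rewrite !nz => <-.
  rewrite scalerDr !scalerA; congr (_ *: _ + _ - _).
  by rewrite mulrC.
Qed.

Lemma centralE_cheb_quot k : E (cheb_quot delta x k) = lact L (U k) 1 zeta.
Proof.
have lE : linear E by exact: centralE_lin.
rewrite /cheb_quot (linearopZ _ _ lE) centralE_der_chebT.
rewrite scalerA (_ : _ * _ = 1) ?scale1r//.
by rewrite rcV rmorph_nat mulVf// pnatr_eq0.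
Qed.

(** E eta is eta minus (eta - E eta). The quotients are weakly null against eta by
    [cheb_quot_wnull], and against eta - E eta because that vector is a limit of values of the
    Laplacian, where [cheb_quot_comd] applies after moving one commutator across. *)
Lemma centralE_cheb_wnull b c : A b -> A c ->
  wnull (fun k => lact L (U k) 1 zeta) (tens L b c).
Proof.
move=> Ab Ac; set eta := tens L b c.
have w1 : wnull (cheb_quot delta x) eta.
  exact: (cheb_quot_wnull comm sA hd.1 sx Ax xl xr hd.2 tau1 Ab Ac).
have w2 : wnull (cheb_quot delta x) (eta - E eta).
  have := tends_closure _ (tends_laplacian_green comm Y eta).
  move=> /(_ [set laplacian Y u | u in setT]) cl.
  apply: (wnull_closure (cheb_quot_nrm comm sA hd.1 sx Ax xl xr) _ (cl _)).
    move=> _ [g _ <-]; apply: null_le _.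
      apply: (null_sum (index_enum Y) (F := fun (y : Y) k =>
        nrm (comd (val y) g) * nrm (comd (val y) (cheb_quot delta x k)))) => y.
      apply: nullZ; apply: (cheb_quot_comd comm sA hd.1 sx Ax xl xr).
      by apply: subset_star_alg_gen; exact: fsvalP.
    move=> k; rewrite ger0_norm ?cabs_ge0// -laplacian_sym// ip_laplacian//.
    elim/big_ind2 : _ => [|c1 d1 c2 d2 h1 h2|y _]; first by rewrite cabs0.
      by rewrite (le_trans (cabsD _ _))// lerD.
    by rewrite mulrC CS.
  by move=> n; exists (green Y n eta).
apply: null_ext (wnullD w1 (wnullZ (-1) w2)) _ => k.
rewrite scaleN1r opprB addrC subrK -centralE_sym// centralE_cheb_quot.
by [].
Qed.

End Derivation.

(* The measure on the diagonal attached to a central vector is atomic, so the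
   unitaries T_k + i (1 - x^2)^{1/2} U_{k-1} cannot tend weakly to 0 on it. *)
Lemma central_wnull_eq0 zeta : L2sub A zeta -> E zeta = zeta ->
  (forall b, A b -> wnull (fun k => lact L (U k) 1 zeta) (tens L b 1)) ->
  zeta = 0.
Proof.
(* q is the projection of zeta onto the closure of A (x) 1, where inner products of tensors factor.
   It is shown to vanish first. *)
move=> Lz Ez hw; pose S := [set tens L a 1 | a in A].
have [||q Sq hq] := @projection_exists R L S zeta.
- by exists 0; [exact: subalg0 sA|rewrite tens0l].
- move=> c _ _ [a Aa <-] [b Ab <-]; exists (c *: a + b); first exact: subalgP sA _ _ _ Aa Ab.
  by rewrite tensDl tensZl.
have Uq b : A b -> wnull (fun k => lact L (U k) 1 q) (tens L b 1).
  move=> Ab; apply: null_ext (hw b Ab) _ => k.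
  rewrite !lact_adj// star1 sU lact_tens mulr1; congr (cabs _).
  apply/eqP; rewrite eq_sym -subr_eq0 -ipBl hq//.
  by apply: subset_closure; exists (U k * b) => //; exact: subalgM sA _ _ (AU k) Ab.
(* [chebT] is recovered from [chebU] by T k = U (k+1) - x U k. *)
have Tq b : A b -> wnull (fun k => lact L (T k) 1 q) (tens L b 1).
  move=> Ab.
  have hs := null_shift 1 (Uq b Ab).
  have hx : wnull (fun k => lact L (U k) 1 q) (tens L (x * b) 1).
    by apply: Uq; exact: subalgM sA _ _ Ax Ab.
  apply: null_le (nullD hs hx) _ => k.
  rewrite ger0_norm ?cabs_ge0// addn1.
  have -> : lact L (T k) 1 q = lact L (U k.+1) 1 q - lact L x 1 (lact L (U k) 1 q).
    rewrite lactM// mulr1 -lactBl; congr (lact L _ 1 _).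
    have -> : U k.+1 = T k + x * U k by [].
    by rewrite addrK.
  rewrite ipBl (le_trans (cabsD _ _))// cabsN lerD//.
  by rewrite [in X in X <= _]lact_adj// star1 sx lact_tens mulr1.
(* For q = a (x) 1 the left-hand side is a product of two traces, one per leg; the identity passes
   to limits of such vectors. *)
have ip_right v b c r : A b -> A c -> A r -> A v -> star v = v ->
   ip (lact L v (v * r) q) (tens L b c) = ip (lact L v 1 q) (tens L b 1) * tau (v * r * star c).
  move=> Ab Ac Ar Av sv.
  have /closure_tends[s Ss sq] := Sq.
  apply: cnull_eq (tends_ip _ (tends_op (lactb L v (v * r)) sq)) _.
  apply: null_ext (nullZ (cabs (tau (v * r * star c)))
     (tends_ip (tens L b 1) (tends_op (lactb L v 1) sq))) _ => n.
  rewrite -cabsM; congr (cabs _); have [a Aa <-] := Ss n.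
  by rewrite !lact_tens !ip_tens star1 !mulr1 !mul1r tau1 mulr1; ring.
have tau_bound v r c : (forall u, nrm (lact L v 1 u) <= 2 * nrm u) ->
   cabs (tau (v * r * star c)) <= 2 * nrm (tens L r 1) * nrm (tens L c 1).
  move=> hv; rewrite (comm _ (star c)) -(ip_tens1 L tau1).
  rewrite (le_trans (CS _ _))// ler_wpM2r ?nrm_ge0//.
  by have := hv (tens L r 1); rewrite lact_tens mulr1.
have nT k u : nrm (lact L (T k) 1 u) <= 2 * nrm u.
  by rewrite (le_trans (Tl _ _))// ler_peMl ?nrm_ge0//; lra.
have nTr k u : nrm (lact L 1 (T k) u) <= 2 * nrm u.
  by rewrite (le_trans (Tr _ _))// ler_peMl ?nrm_ge0//; lra.
have weak (v : nat -> M) r : A r -> (forall k, A (v k)) -> (forall k, star (v k) = v k) ->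
    (forall k u, nrm (lact L (v k) 1 u) <= 2 * nrm u) ->
    (forall k u, nrm (lact L 1 (v k) u) <= 2 * nrm u) ->
    (forall b, A b -> wnull (fun k => lact L (v k) 1 q) (tens L b 1)) ->
    wnull (fun k => lact L (v k * v k * r) 1 q) (E o).
  move=> Ar Av sv vl vr vq.
  have Lo : L2sub A (E o).
    by apply: L2sub_centralE => //; apply: L2sub_tens; exact: subalg1 sA.
  (* On tensors the left leg gives a null factor and the right leg a bounded one. Uniform norm
     bounds extend this to E o, against which the right leg may be moved to the left one, producing
     the square of v k. *)
  have main : wnull (fun k => lact L (v k) (v k * r) q) (E o).
    have [_ [C C0 hC]] := (bounded_opP (lact L 1 r)).1 (lactb L 1 r).
    apply: (@wnull_closure _ _ _ _ (2 * (2 * (C * nrm q))) _ _ (E o) Lo).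
      move=> k; rewrite lact_split// (le_trans (vl _ _))// ler_wpM2l//.
      have -> : lact L 1 (v k * r) q = lact L 1 (v k) (lact L 1 r q).
        by rewrite lactM// mulr1.
      by rewrite (le_trans (vr _ _))// ler_wpM2l.
    move=> _ [s [As ->]].
    elim: s As => [|[b c] s IH] As.
      by rewrite big_nil; apply: null_ext null0 _ => n; rewrite ip0r cabs0.
    rewrite big_cons; apply: wnullD; last first.
      by apply: IH => bc bcs; apply: As; rewrite in_cons bcs orbT.
    have /= [Ab Ac] := As _ (mem_head _ _).
    apply: null_le (nullZ (2 * nrm (tens L r 1) * nrm (tens L c 1)) (vq b Ab)) _ => k.
    rewrite ger0_norm ?cabs_ge0// ip_right// cabsM mulrC ler_wpM2r ?cabs_ge0//.
    exact: tau_bound (vl k).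
  apply: null_ext main _ => k; congr (cabs _).
  rewrite !lact_adj// !star1 !(starMc comm) sv.
  rewrite [in RHS]lact_centralE//; first by rewrite mulrA.
  exact: (subalgM sA (Av k) (subalg_star sA Ar)).
(* By Pell's identity the constant r is T^2 r + U^2 (1 - x^2) r, a sum of two expressions that tend
   weakly to 0, so the constant pairing is 0. *)
have rq r : A r -> ip (lact L r 1 q) (E o) = 0.
  move=> Ar; apply: cabs_eq0; apply: null_cst.
  have Ar' : A ((1 - x * x) * r).
    exact: (subalgM sA (subalgB sA (subalg1 sA) (subalgM sA Ax Ax)) Ar).
  have h1 := weak T r Ar AT sT nT nTr Tq.
  have h2 := weak U _ Ar' AU sU Ul Ur Uq.
  apply: null_le (nullD h1 h2) _ => k.
  rewrite ger0_norm ?cabs_ge0//.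
  have {1}-> : r = T k * T k * r + U k * U k * ((1 - x * x) * r).
    by rewrite mulrA (comm (U k * U k)) -mulrDl chebA_pell// mul1r.
  have := lactDl 1 (T k * T k * r) (U k * U k * ((1 - x * x) * r)) 1 q.
  by rewrite !scale1r => ->; rewrite ipDl cabsD.
(* zeta is central, so only E q matters, and E (b (x) c) is b c applied to E o: all these pairings
   are covered by [rq]. *)
have ipq : ip q zeta = 0.
  rewrite -Ez -centralE_sym//; apply: closure_ortho Lz => _ [s [As ->]].
  elim: s As => [|[b c] s IH] As; first by rewrite big_nil ip0r.
  rewrite big_cons ipDr IH ?addr0; last first.
    by move=> bc bcs; apply: As; rewrite in_cons bcs orbT.
  have /= [Ab Ac] := As _ (mem_head _ _).
  rewrite centralE_sym// centralE_tens// -[b * c]starK -[X in lact L _ X]star1.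
  rewrite -lact_adj//; apply: rq.
  exact: (subalg_star sA (subalgM sA Ab Ac)).
have q0 : q = 0.
  apply: ip_self0; have := hq q Sq; rewrite ipBl => /eqP.
  by rewrite subr_eq0 => /eqP <-; rewrite ipC ipq conjC0.
(* With q = 0, zeta is orthogonal to A (x) 1. A central vector pairs with b (x) c as with b c (x) 1,
   so zeta is orthogonal to the whole space it lies in. *)
apply: ip_self0; apply: closure_ortho Lz => _ [s [As ->]].
elim: s As => [|[b c] s IH] As; first by rewrite big_nil ip0r.
rewrite big_cons ipDr IH ?addr0; last first.
  by move=> bc bcs; apply: As; rewrite in_cons bcs orbT.
have /= [Ab Ac] := As _ (mem_head _ _).
have Abc := subalgM sA Ab Ac.
rewrite -Ez centralE_sym// centralE_tens// -centralE_lact// lact_one -centralE_sym// Ez.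
have := hq (tens L (b * c) 1); rewrite q0 subr0; apply.
by apply: subset_closure; exists (b * c).
Qed.

End Chebyshev.

Lemma der11_central delta a : Der11 A delta -> A a -> E (delta a) = 0.
Proof.
move=> hd.
have dd := hd.1; have lE : linear E by exact: centralE_lin.
have sa x : star x = x -> A x -> E (delta x) = 0.
  move=> sx Ax.
  have [_ [C C0 hC]] := (bounded_opP (lact L x 1)).1 (lactb L x 1).
  have [_ [C' C'0 hC']] := (bounded_opP (lact L 1 x)).1 (lactb L 1 x).
  (* This scale brings left and right multiplication by x to norm at most 1/2; the summand 1 keeps
     the denominator positive. *)
  pose t : R := (2 * (C + C' + 1))^-1.
  have t0 : 0 < t by rewrite invr_gt0; lra.
  pose x' := t%:C%C *: x.
  have sx' : star x' = x' by rewrite starZ conj_realC sx.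
  have Ax' : A x' by exact: (subalgZ sA _ Ax).
  have tC c : 0 <= c -> c <= C + C' + 1 -> t * c <= 2^-1.
    move=> c0 cC; rewrite /t invfM -mulrA ler_piMr// ler_pdivrMl ?mulr1//.
    by rewrite (lt_le_trans _ (_ : 1 <= _))//; lra.
  have E0 : E (delta x') = 0.
    apply: (@central_wnull_eq0 x' sx' Ax').
    - move=> u; rewrite lactZl nrmZ cabs_real gtr0_norm//.
      rewrite (le_trans (ler_wpM2l (ltW t0) (hC u)))// mulrA ler_wpM2r ?nrm_ge0//.
      by apply: tC => //; lra.
    - move=> u; rewrite lactZr nrmZ cabs_real gtr0_norm//.
      rewrite (le_trans (ler_wpM2l (ltW t0) (hC' u)))// mulrA ler_wpM2r ?nrm_ge0//.
      by apply: tC => //; lra.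
    - by apply: L2sub_centralE => //; exact: (der_L2sub dd Ax').
    - exact: centralE_idem.
    - move=> b Ab; apply: centralE_cheb_wnull => //; last exact: subalg1 sA.
      + move=> u; rewrite lactZl nrmZ cabs_real gtr0_norm//.
        rewrite (le_trans (ler_wpM2l (ltW t0) (hC u)))// mulrA ler_wpM2r ?nrm_ge0//.
        by apply: tC => //; lra.
      + move=> u; rewrite lactZr nrmZ cabs_real gtr0_norm//.
        rewrite (le_trans (ler_wpM2l (ltW t0) (hC' u)))// mulrA ler_wpM2r ?nrm_ge0//.
        by apply: tC => //; lra.
  move: E0; rewrite /x' (derZ sA dd)// (linearopZ _ _ lE) => /eqP.
  rewrite scaler_eq0 => /orP[|/eqP//] /eqP/(congr1 (@complex.Re R)) /= t00.
  by rewrite t00 ltxx in t0.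
(* A general element reduces to self-adjoint ones through 2 a = p - i q. *)
move=> Aa; have Asa := subalg_star sA Aa.
pose p := a + star a; pose q := 'i *: (a - star a).
have sp : star p = p by rewrite starD starK addrC.
have sq : star q = q by rewrite starZ conjCi starB starK scaleNr -scalerN opprB.
have Ap : A p by exact: (subalgD sA Aa Asa).
have Aq : A q by exact: (subalgZ sA _ (subalgB sA Aa Asa)).
have e : a = (2^-1 : R[i]) *: (p - 'i *: q).
  have -> : p - 'i *: q = (2%:R : R[i]) *: a.
    rewrite /q scalerA -expr2 sqrCi scaleN1r opprK /p addrACA subrr addr0.
    by rewrite scaler_nat mulr2n.
  by rewrite scalerA mulVf ?scale1r// pnatr_eq0.
have Aiq : A ('i *: q) := subalgZ sA _ Aq.
have -> : delta a = (2^-1 : R[i]) *: (delta p - 'i *: delta q).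
  rewrite [in LHS]e (derZ sA dd _ (subalgB sA Ap Aiq)) (derB dd Ap Aiq).
  by rewrite (derZ sA dd 'i Aq).
rewrite (linearopZ _ _ lE) (linearopB _ _ lE) (linearopZ _ _ lE) !sa//.
by rewrite scaler0 subr0 scaler0.
Qed.

End Der11Vanishing.

(** * The dimension for a finite generating set *)

Section Dimension.
Context {R : realType} {M : starAlgType R} {tau : M -> R[i]} (L : tensorL2 tau).
Hypothesis comm : is_abelian M.
Hypothesis tau1 : tau 1 = 1.
Variable Y : {fset M}.
Hypothesis saY : self_adjoint_fset Y.
Implicit Types (a b x y : M) (u w h : L).

Local Notation ip := (inner L).
Local Notation o := (tens L 1 1).
Local Notation A := (star_alg_gen [set` Y]).
Local Notation sA := (star_alg_gen_subalg [set` Y]).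
Local Notation E := (@centralE R M tau L Y).

Let AY (y : Y) : A (val y).
Proof. by apply: subset_star_alg_gen; exact: fsvalP. Qed.

Lemma der_norm_lt (d : M -> L) (e : R) : 0 < e ->
  (der_norm Y d < e%:C%C) = (\sum_(y : Y) nrm (d (val y)) ^+ 2 < e ^+ 2).
Proof.
move=> e0; rewrite /der_norm.
have -> : \sum_(y : Y) `|d (val y)| ^+ 2 = (\sum_(y : Y) nrm (d (val y)) ^+ 2)%:C%C.
  by rewrite rmorph_sum/=; apply: eq_bigr => y _; rewrite nrmE rcX.
set S := \sum_(y : Y) _; have S0 : 0 <= S by apply: sumr_ge0 => y _; exact: sqr_ge0.
rewrite -(@sqrCK _ e%:C%C) ?ler0c ?(ltW e0)// -rcX ltr_sqrtC ?ltcR//.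
  by rewrite nnegrE ler0c.
by rewrite nnegrE ler0c sqr_ge0.
Qed.

Lemma tends_cauchy (H : hilbertType R) (s : nat -> H) (u : H) : tends s u ->
  forall e : R, 0 < e -> exists N, forall m n, (N <= m)%N -> (m <= n)%N ->
    nrm (s n - s m) < e.
Proof.
move=> su e e0; have [|N hN] := su (e / 2); first by rewrite divr_gt0.
exists N => m n Nm mn; have := hN m Nm; have := hN n (leq_trans Nm mn).
by have := nrmDist (s n) u (s m); rewrite (nrmC u); lra.
Qed.

(** Convergence on the generators spreads to the whole algebra by linearity and the Leibniz rule;
    the limit is again a derivation, and the inner derivations at finite stages approximate it in
    the norm of Y. *)
Lemma inner_limit (h : nat -> L) : (forall n, L2sub A (h n)) ->
  (forall y, y \in Y -> exists w, tends (fun n => comd y (h n)) w) ->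
  exists delta : M -> L, Der11_closure Y delta /\
    forall y : Y, tends (fun n => comd (val y) (h n)) (delta (val y)).
Proof.
move=> Lh hY.
have cv a : A a -> exists w, tends (fun n => comd a (h n)) w.
  move=> Aa.
  (* Convergence at a and at [star a] is carried together, so that B is visibly stable under
     [star]. *)
  pose B := [set a | (exists w, tends (fun n => comd a (h n)) w) /\
                     (exists w, tends (fun n => comd (star a) (h n)) w)].
  suff : B a by case.
  apply: (Aa B); last first.
    by move=> y Yy; split; apply: hY => //; exact: saY.
  split.
  - by rewrite /B /= star1; split; exists 0; apply: tends_ext (tends_cst 0) _ => n; rewrite comd1.
  - move=> c x y [[x1 hx1] [x2 hx2]] [[y1 hy1] [y2 hy2]]; split.
      exists (c *: x1 + y1); apply: tends_ext (tendsD (tendsZ c hx1) hy1) _ => n.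
      exact: comd_comb.
    rewrite star_antilinear.
    exists (c^* *: x2 + y2); apply: tends_ext (tendsD (tendsZ _ hx2) hy2) _ => n.
    exact: comd_comb.
  - move=> x y [[x1 hx1] [x2 hx2]] [[y1 hy1] [y2 hy2]]; split.
      exists (lact L x 1 y1 + lact L 1 y x1).
      apply: tends_ext (tendsD (tends_op (lactb L x 1) hy1) (tends_op (lactb L 1 y) hx1)) _ => n.
      exact: comdM.
    exists (lact L (star x) 1 y2 + lact L 1 (star y) x2).
    apply: tends_ext (tendsD (tends_op (lactb L _ 1) hy2) (tends_op (lactb L 1 _) hx2)) _ => n.
    by rewrite (starMc comm); exact: comdM.
  - by move=> x [hx1 hx2]; split => //; rewrite starK.
pose delta a := xget 0 [set w | tends (fun n => comd a (h n)) w].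
have hd a : A a -> tends (fun n => comd a (h n)) (delta a).
  by move=> /cv[w hw]; apply: (@xgetPex _ 0 [set w | tends _ w]); exists w.
exists delta; split; last by move=> y; apply: hd.
split; first split.
- move=> a Aa; apply: L2sub_closed; apply: tends_closure (hd a Aa) => n.
  by apply: L2sub_comd => //; exact: sA.
- move=> c a b Aa Ab; apply: tends_unique (hd _ (subalgP sA c Aa Ab)) _.
  apply: tends_ext (tendsD (tendsZ c (hd _ Aa)) (hd _ Ab)) _ => n.
  exact: comd_comb.
- move=> a b Aa Ab; apply: tends_unique (hd _ (subalgM sA Aa Ab)) _.
  apply: tends_ext (tendsD (tends_op (lactb L a 1) (hd _ Ab)) (tends_op (lactb L 1 b) (hd _ Aa))) _ => n.
  exact: comdM.
- move=> e e0; have eE := ge0_ReE (ltW e0).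
  have e0' : 0 < complex.Re e by rewrite -rc_gt0 -eE.
  have nul : null (fun n => \sum_(y : Y) nrm (comd (val y) (h n) - delta (val y)) ^+ 2).
    apply: null_sum => y; have /tendsE := hd _ (AY y) => ny.
    have [C C0 hC] := null_bounded ny.
    apply: null_le (nullZ C ny) _ => n; rewrite ger0_norm ?sqr_ge0// expr2.
    by rewrite ler_wpM2r ?nrm_ge0// (le_trans _ (hC n))// ler_norm.
  have /nullP/(_ (complex.Re e ^+ 2))[|N /(_ N (leqnn N))] := nul; first by rewrite exprn_gt0.
  rewrite ger0_norm ?sumr_ge0// => [hN|y _]; last exact: sqr_ge0.
  exists (fun a => comd a (h N)); first by apply: inner_der11 => //; exact: sA.
  rewrite eE der_norm_lt//; apply: le_lt_trans hN.
  by apply: ler_sum => y _; rewrite nrmC.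
Qed.

(** The squared norm of W u is the sum of |D_z D_y u|^2 over all pairs in Y. Second differences of
    the Green sums therefore converge as soon as their Laplacians do. *)
Lemma energy_comd_le (y : Y) u : energy Y (comd (star (val y)) u) <= nrm (laplacian Y u) ^+ 2.
Proof.
rewrite nrm2_Re -laplacian_sym// ip_laplacian// raddf_sum/= /energy.
apply: ler_sum => z _; rewrite comdC//.
have -> : comd (val z) (laplacian Y u) = laplacian Y (comd (val z) u).
  by rewrite laplacian_comm// => [|a w]; [exact: comd_lin|exact: comdC].
rewrite energyE//= comd_nrm_star// /energy (bigD1 y)//= lerDl.
by apply: sumr_ge0 => ? _; exact: sqr_ge0.
Qed.

(** Formally D W^{-1} D^* is the projection onto the closure, and its value at the unit vector of
    coordinate y is the family, over z, of D_z D_y^* W^{-1} (1 (x) 1). Here [green] stands for the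
    inverse. *)
Lemma unit_projection_limit (y : Y) : exists delta : M -> L, Der11_closure Y delta /\
  forall z : Y, tends (fun n => comd (val z) (comd (star (val y)) (green Y n o))) (delta (val z)).
Proof.
apply: inner_limit.
  move=> n; apply: L2sub_comd => //; first exact: sA.
    exact: (subalg_star sA (AY y)).
  by apply: L2sub_green => //; apply: L2sub_tens; exact: subalg1 sA.
move=> z Yz; apply: cauchy_tends => e e0.
have [N hN] := tends_cauchy (tends_laplacian_green comm Y o) e0.
exists N => m n Nm mn; apply: le_lt_trans (hN m n Nm mn).
rewrite -(linearopB _ _ (comd_lin _)) -(linearopB _ _ (comd_lin _)).
have lW : linear (@laplacian R M tau L Y) by exact: laplacian_lin.
rewrite -(linearopB _ _ lW) -ler_sqr ?nnegrE ?nrm_ge0//.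
have h := energy_comd_le y (green Y n o - green Y m o).
rewrite (le_trans _ h)// /energy (bigD1 [` Yz]%fset)//= lerDl.
by apply: sumr_ge0 => ? _; exact: sqr_ge0.
Qed.

Lemma der11_closure_central delta (y : Y) : Der11_closure Y delta -> E (delta (val y)) = 0.
Proof.
move=> [dd cl]; apply: nrm_eq0; apply/eqP; rewrite eq_le nrm_ge0 andbT.
apply/ler_addgt0Pr => e e0; rewrite add0r.
have [|d' d'1] := cl e%:C%C; first by rewrite rc_gt0.
rewrite der_norm_lt// => hd.
have -> : E (delta (val y)) = E (delta (val y) - d' (val y)).
  have lE : linear E by exact: centralE_lin.
  by rewrite (linearopB _ _ lE) [E (d' _)]der11_central// subr0.
rewrite (le_trans (centralE_nrm comm _ _))//.
rewrite -ler_sqr ?nnegrE ?nrm_ge0 ?(ltW e0)//.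
apply: le_trans _ (ltW hd); rewrite (bigD1 y)//= lerDl.
by apply: sumr_ge0 => ? _; exact: sqr_ge0.
Qed.

(** With H = D^* delta, [der_comd] gives D_y H = W (delta y). Applying the Green sums yields inner
    derivations whose values at y tend to delta y - E (delta y), and the diagonal part is zero. *)
Lemma der11_closure_inner_limit delta : Der11_closure Y delta ->
  exists h : nat -> L, forall y : Y, tends (fun n => comd (val y) (h n)) (delta (val y)).
Proof.
move=> hd; pose H : L := \sum_(z : Y) comd (star (val z)) (delta (val z)).
exists (fun n => green Y n H) => y.
have := tends_laplacian_green comm Y (delta (val y)).
rewrite der11_closure_central// subr0 => /tends_ext; apply => n.
have gb := green_bounded L comm Y n.
have lg : linear (@green R M tau L Y n) by case: gb.
rewrite -green_comm//; [|exact: comd_lin|by move=> *; exact: comdC].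
have -> : comd (val y) H = laplacian Y (delta (val y)).
  rewrite /H (linearop_sum _ _ (comd_lin _)); apply: eq_bigr => z _.
  by rewrite comdC// (der_comd comm hd.1 (AY y) (AY z)).
rewrite green_comm//; first exact: laplacian_lin.
by move=> a w; rewrite laplacian_comm// => [|b v]; [exact: comd_lin|exact: comdC].
Qed.

Lemma projection_orthogonal (y : Y) (delta delta' : M -> L) :
  (forall z : Y, tends (fun n => comd (val z) (comd (star (val y)) (green Y n o))) (delta (val z))) ->
  Der11_closure Y delta' ->
  innerY (unitY L y - phi Y delta) (phi Y delta') = 0.
Proof.
move=> hd hd'.
have innerYB (p q r : {ffun Y -> L}) : innerY (p - q) r = innerY p r - innerY q r.
  by rewrite /innerY -sumrB; apply: eq_bigr => z _; rewrite !ffunE ipBl.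
(* Summed over z, the pairing is that of W D_y^* g_n (1 (x) 1) with h. In the limit it is <o - E o,
   D_y h>, and the part with E o vanishes because commutators kill it. *)
have inn h : \sum_(z : Y) ip (delta (val z)) (comd (val z) h) = ip o (comd (val y) h).
  have lim1 : null (fun n => cabs (ip (laplacian Y (comd (star (val y)) (green Y n o))) h -
      \sum_(z : Y) ip (delta (val z)) (comd (val z) h))).
    have := @null_sum R Y (index_enum Y) (fun z n => cabs (ip (comd (val z) (comd (star (val y)) (green Y n o))) (comd (val z) h) - ip (delta (val z)) (comd (val z) h))).
    move=> /(_ (fun z => tends_ip (comd (val z) h) (hd z))) nul.
    apply: null_le nul _ => n; rewrite ger0_norm ?cabs_ge0// ip_laplacian// -sumrB.
    elim/big_ind2 : _ => [|c1 d1 c2 d2 h1 h2|//]; first by rewrite cabs0.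
    by rewrite (le_trans (cabsD _ _))// lerD.
  apply/esym; apply: cnull_eq _ lim1.
  have := tends_ip (comd (val y) h) (tends_laplacian_green comm Y o).
  have -> : ip (o - E o) (comd (val y) h) = ip o (comd (val y) h).
    rewrite ipBl centralE_sym// centralE_comd// comd_centralE// ip0r.
    by rewrite subr0.
  move=> /null_ext; apply => n; congr (cabs (_ - _)).
  rewrite laplacian_comm//; [|exact: comd_lin|by move=> *; exact: comdC].
  by rewrite comd_adj// starK.
rewrite innerYB.
have [h hh] := der11_closure_inner_limit hd'.
have -> : innerY (unitY L y) (phi Y delta') = ip o (delta' (val y)).
  rewrite /innerY (bigD1 y)//= big1 => [|z zy]; last by rewrite !ffunE (negPf zy) ip0l.
  by rewrite !ffunE eqxx addr0.
apply/eqP; rewrite subr_eq0 eq_sym; apply/eqP.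
have lim1 : null (fun n => cabs (ip o (comd (val y) (h n)) - innerY (phi Y delta) (phi Y delta'))).
  have := @null_sum R Y (index_enum Y) (fun z n => cabs (ip (delta (val z)) (comd (val z) (h n)) - ip (delta (val z)) (delta' (val z)))).
  move=> /(_ (fun z => tends_ip2 (tends_cst (delta (val z))) (hh z))) nul.
  apply: null_le nul _ => n; rewrite ger0_norm ?cabs_ge0// -inn.
  have -> : innerY (phi Y delta) (phi Y delta') = \sum_(z : Y) ip (delta (val z)) (delta' (val z)).
    by apply: eq_bigr => z _; rewrite !ffunE.
  rewrite -sumrB.
  elim/big_ind2 : _ => [|c1 d1 c2 d2 h1 h2|//]; first by rewrite cabs0.
  by rewrite (le_trans (cabsD _ _))// lerD.
exact: cnull_eq lim1 (tends_ip2 (tends_cst o) (hh y)).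
Qed.

Lemma innerY_self0 (p : {ffun Y -> L}) : innerY p p = 0 -> p = 0.
Proof.
move=> h; apply/ffunP => z; rewrite ffunE.
have : \sum_(z : Y) nrm (p z) ^+ 2 = 0.
  have /(congr1 (@complex.Re R)) := h; rewrite /innerY raddf_sum/= => {2}<-.
  by apply: eq_bigr => i _; rewrite nrm2_Re.
move=> /eqP; rewrite psumr_eq0 => [/allP hz|i _]; last exact: sqr_ge0.
by have := hz z (mem_index_enum z); rewrite sqrf_eq0 => /eqP/nrm_eq0.
Qed.

Lemma projY_phi (y : Y) (delta : M -> L) : Der11_closure Y delta ->
  (forall z : Y, tends (fun n => comd (val z) (comd (star (val y)) (green Y n o))) (delta (val z))) ->
  projY (@phi R M tau L Y @` Der11_closure Y) (unitY L y) = phi Y delta.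
Proof.
move=> hd hl; rewrite /projY.
have innerYB (p q r : {ffun Y -> L}) : innerY (p - q) r = innerY p r - innerY q r.
  by rewrite /innerY -sumrB; apply: eq_bigr => z _; rewrite !ffunE ipBl.
have innerYBr (p q r : {ffun Y -> L}) : innerY r (p - q) = innerY r p - innerY r q.
  by rewrite /innerY -sumrB; apply: eq_bigr => z _; rewrite !ffunE ipBr.
have Pd : [set w | (@phi R M tau L Y @` Der11_closure Y) w /\
     forall k, (@phi R M tau L Y @` Der11_closure Y) k -> innerY (unitY L y - w) k = 0] (phi Y delta).
  split; first by exists delta.
  by move=> _ [d' hd' <-]; exact: projection_orthogonal.
apply: xget_unique => // w [Kw wo].
have eqk k : (@phi R M tau L Y @` Der11_closure Y) k -> innerY (w - phi Y delta) k = 0.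
  move=> Kk; have := wo k Kk; have := Pd.2 k Kk; rewrite !innerYB => /eqP.
  rewrite subr_eq0 => /eqP -> /eqP; rewrite subr_eq0 => /eqP ->.
  by rewrite subrr.
apply/eqP; rewrite -subr_eq0; apply/eqP/innerY_self0.
by rewrite innerYBr !eqk ?subr0//; exists delta.
Qed.

(** The diagonal entries D_y D_y^* g_n (1 (x) 1) add up to W g_n (1 (x) 1), which tends to o - E o;
    its inner product with o is the trace. *)
Lemma free_stein_dimE : free_stein_dim L Y = 1 - nrm (E o) ^+ 2.
Proof.
have /choice[delta hdelta] := unit_projection_limit.
rewrite /free_stein_dim /vn_dim -raddf_sum.
have -> : \sum_(y : Y) innerY (projY (@phi R M tau L Y @` Der11_closure Y) (unitY L y)) (unitY L y)
   = \sum_(y : Y) ip (delta y (val y)) o.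
  apply: eq_bigr => y _; rewrite (projY_phi (hdelta y).1 (hdelta y).2).
  rewrite /innerY (bigD1 y)//= big1 => [|z zy]; last by rewrite !ffunE (negPf zy) ip0r.
  by rewrite !ffunE eqxx addr0.
have lim1 : null (fun n => cabs (ip (laplacian Y (green Y n o)) o - \sum_(y : Y) ip (delta y (val y)) o)).
  have := @null_sum R Y (index_enum Y) (fun (y : Y) n => cabs (ip (comd (val y) (comd (star (val y)) (green Y n o))) o - ip (delta y (val y)) o)).
  move=> /(_ (fun y : Y => tends_ip o ((hdelta y).2 y))) nul.
  apply: null_le nul _ => n; rewrite ger0_norm ?cabs_ge0//.
  have -> : ip (laplacian Y (green Y n o)) o =
     \sum_(y : Y) ip (comd (val y) (comd (star (val y)) (green Y n o))) o.
    rewrite ip_laplacian//; apply: eq_bigr => y _.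
    by rewrite comdC// [RHS]comd_adj// starK.
  rewrite -sumrB.
  elim/big_ind2 : _ => [|c1 d1 c2 d2 h1 h2|//]; first by rewrite cabs0.
  by rewrite (le_trans (cabsD _ _))// lerD.
rewrite -(cnull_eq (tends_ip o (tends_laplacian_green comm Y o)) lim1).
rewrite ipBl -[X in _ - ip X _]centralE_idem// centralE_sym// !ipE nrm_one// expr1n.
by rewrite -rcB.
Qed.

End Dimension.

(** * The limit over generating sets *)

Section LimitOverGenerators.
Context {R : realType} {M : starAlgType R} {tau : M -> R[i]} (L : tensorL2 tau).
Hypothesis comm : is_abelian M.
Hypothesis tau1 : tau 1 = 1.
Implicit Types (a b x y p q : M) (u w h : L) (Y Q F : {fset M}).

Local Notation ip := (inner L).
Local Notation o := (tens L 1 1).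
Local Notation E Y := (@centralE R M tau L Y).
Local Notation mass p := (complex.Re (tau p)).

Definition orthogonal_projections Q :=
  (forall q, q \in Q -> is_projection q) /\
  (forall q r, q \in Q -> r \in Q -> q != r -> q * r = 0).

Lemma tauD a b : tau (a + b) = tau a + tau b.
Proof. by rewrite (tauE L tau1 (a + b)) tensDl ipDl -!tauE. Qed.
Lemma tau0 : tau 0 = 0.
Proof. by rewrite (tauE L tau1 0) tens0l ip0l. Qed.
Lemma tau_sum I (r : seq I) (f : I -> M) : tau (\sum_(i <- r) f i) = \sum_(i <- r) tau (f i).
Proof. by elim/big_rec2 : _ => [|i x y _ <-]; rewrite ?tau0 ?tauD. Qed.

Lemma tau_projection p : is_projection p -> tau p = (mass p)%:C%C /\ 0 <= mass p.
Proof.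
move=> [sp pp]; have h : tau p = (nrm (tens L p 1) ^+ 2)%:C%C.
  by rewrite -ipE ip_tens1// sp pp.
by rewrite h /= sqr_ge0.
Qed.

Lemma ip_diag p q : is_projection p -> is_projection q ->
  ip (tens L p p) (tens L q q) = tau (q * p) * tau (p * q).
Proof. by move=> [sp _] [sq _]; rewrite ip_tens sq. Qed.

Lemma nrm_diag Q : orthogonal_projections Q ->
  ip (\sum_(q <- Q) tens L q q) (\sum_(q <- Q) tens L q q) = (\sum_(q <- Q) mass q ^+ 2)%:C%C.
Proof.
move=> [Qp Qo].
have ips u (r : seq M) : ip u (\sum_(q <- r) tens L q q) = \sum_(q <- r) ip u (tens L q q).
  by elim/big_rec2 : _ => [|i x y _ <-]; rewrite ?ip0r ?ipDr.
have ipsl u (r : seq M) : ip (\sum_(q <- r) tens L q q) u = \sum_(q <- r) ip (tens L q q) u.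
  by elim/big_rec2 : _ => [|i x y _ <-]; rewrite ?ip0l ?ipDl.
rewrite ipsl rmorph_sum/=; apply: eq_big_seq => q qQ.
rewrite ips (big_rem q)//= big_seq big1 => [|r rQ]; last first.
  move: rQ; rewrite mem_rem_uniq ?fset_uniq// inE => /andP[rq rQ].
  by rewrite (ip_diag (Qp _ qQ) (Qp _ rQ)) Qo// tau0 mul0r.
rewrite addr0 (ip_diag (Qp _ qQ) (Qp _ qQ)) (Qp q qQ).2 rcX.
by rewrite -(tau_projection (Qp q qQ)).1 expr2.
Qed.

(** Both legs of y act by the same scalar on p (x) p, so s is central. Since <o, s> = |s|^2, the
    Cauchy-Schwarz inequality for E o and s gives the bound. *)
Lemma central_mass_ge Y F : self_adjoint_fset Y -> orthogonal_projections F ->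
  (forall p y, p \in F -> exists c : R[i], y * p = c *: p) ->
  \sum_(p <- F) mass p ^+ 2 <= nrm (E Y o) ^+ 2.
Proof.
move=> saY hF sc; set s := \sum_(p <- F) tens L p p; set S := \sum_(p <- F) _.
have S0 : 0 <= S by apply: sumr_ge0 => p _; exact: sqr_ge0.
have sS : nrm s ^+ 2 = S by rewrite nrm2_Re nrm_diag.
have Es : E Y s = s.
  apply: centralE_fix => // y _; rewrite /s (linearop_sum _ _ (comd_lin _)).
  rewrite big_seq big1// => p pF; have [c yp] := sc p y pF.
  by rewrite /comd !lact_tens mul1r mulr1 yp (comm p) yp tensZl tensZr subrr.
have os : ip o s = S%:C%C.
  rewrite /s /S; have -> : ip o (\sum_(p <- F) tens L p p) = \sum_(p <- F) ip o (tens L p p).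
    by elim/big_rec2 : _ => [|i x y _ <-]; rewrite ?ip0r ?ipDr.
  rewrite rmorph_sum/=; apply: eq_big_seq => p pF.
  have [sp _] := hF.1 p pF.
  by rewrite ip_tens sp mulr1 mul1r (tau_projection (hF.1 p pF)).1/= -expr2 rcX.
have : S <= nrm (E Y o) * nrm s.
  apply: le_trans (CS _ _); rewrite centralE_sym// Es os cabs_real.
  exact: ler_norm.
have n1 := nrm_ge0 (E Y o); have n2 := nrm_ge0 s.
rewrite -sS expr2; have [-> _|s0] := eqVneq (nrm s) 0; first by rewrite mul0r sqr_ge0.
rewrite ler_pM2r ?lt_def ?s0// => h.
by rewrite expr2 ler_pM.
Qed.

(** For a partition inside Y, E o is the sum of the q E o, and q E o = E (q (x) q) because q is an
    idempotent of the algebra. Hence E o = E s, and E is a contraction. *)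
Lemma central_mass_le Y Q : self_adjoint_fset Y -> orthogonal_projections Q ->
  \sum_(q <- Q) q = 1 -> (Q `<=` Y)%fset ->
  nrm (E Y o) ^+ 2 <= \sum_(q <- Q) mass q ^+ 2.
Proof.
move=> saY hQ Q1 QY; set s := \sum_(p <- Q) tens L p p.
have Es : E Y o = E Y s.
  have lE : linear (E Y) by exact: centralE_lin.
  rewrite (linearop_sum _ _ lE) -[LHS](lact11) -{1}Q1.
  have lsum (r : seq M) u : lact L (\sum_(q <- r) q) 1 u = \sum_(q <- r) lact L q 1 u.
    elim: r => [|q r IH].
      rewrite !big_nil; have := lactDl (-1) 0 0 1 u.
      by rewrite !scaleN1r oppr0 addr0 addNr.
    rewrite !big_cons -IH; have := lactDl 1 q (\sum_(j <- r) j) 1 u.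
    by rewrite !scale1r.
  rewrite lsum; apply: eq_big_seq => q qQ.
  have Aq : star_alg_gen [set` Y] q.
    by apply: subset_star_alg_gen; exact: (fsubsetP QY).
  by rewrite [RHS]centralE_tens// (hQ.1 q qQ).2.
have -> : \sum_(q <- Q) mass q ^+ 2 = nrm s ^+ 2 by rewrite nrm2_Re nrm_diag.
by rewrite Es ler_sqr ?nnegrE ?nrm_ge0// centralE_nrm.
Qed.

(** P stands for the minimal projections in one case and for the classes of atoms in the other; the
    limit argument is common to both. *)
Variable P : set M.
Hypothesis Pproj : forall p, P p -> is_projection p.
Hypothesis Porth : forall p q, P p -> P q -> p != q -> p * q = 0.
Hypothesis Pscal : forall p y, P p -> exists c : R[i], y * p = c *: p.
Hypothesis Ppart : forall e : R, 0 < e -> exists Q, [/\ orthogonal_projections Q,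
  \sum_(q <- Q) q = 1 & forall q, q \in Q -> P q \/ mass q <= e].

Let s : \bar R := (\esum_(p in P) (mass p ^+ 2)%:E)%E.

Lemma esum_fset_le F : [set` F] `<=` P -> ((\sum_(p <- F) mass p ^+ 2)%:E <= s)%E.
Proof.
move=> FP; apply: esum_ge; exists [set` F].
  by split=> //; exact: finite_fset.
by rewrite fsbig_finite ?set_fsetK//= sumEFin.
Qed.

Lemma esum_fset_ub (c : \bar R) :
  (forall F, [set` F] `<=` P -> ((\sum_(p <- F) mass p ^+ 2)%:E <= c)%E) -> (s <= c)%E.
Proof.
move=> h; apply: ub_ereal_sup => _ [B [fB BP] <-].
rewrite fsbig_finite//= sumEFin; apply: h => p /=.
by rewrite in_fset_set// => /set_mem/BP.
Qed.

Lemma stein_dim_le Y : self_adjoint_fset Y ->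
  ((free_stein_dim L Y)%:E <= 1 - s)%E.
Proof.
move=> saY; rewrite free_stein_dimE// EFinB leeB//.
apply: esum_fset_ub => F FP; rewrite lee_fin; apply: central_mass_ge => //.
  split=> [q qF|q r qF rF]; first exact: Pproj (FP _ qF).
  exact: Porth (FP _ qF) (FP _ rF).
by move=> p y pF; exact: Pscal (FP _ pF).
Qed.

(** In a partition, members of P contribute at most s to the sum of squares; each of the others has
    squared mass at most e times its mass, and the masses add up to 1. *)
Lemma stein_dim_ge (e : R) : 0 < e -> exists2 Y0, self_adjoint_fset Y0 &
  forall Y, self_adjoint_fset Y -> (Y0 `<=` Y)%fset ->
  (1 - s - e%:E <= (free_stein_dim L Y)%:E)%E.
Proof.
move=> e0; have [Q [Qo Q1 Qe]] := Ppart e0; exists Q.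
  by move=> q qQ; rewrite (Qo.1 q qQ).1.
move=> Y saY QY; rewrite free_stein_dimE// EFinB.
have := central_mass_le saY Qo Q1 QY.
set t := nrm _ ^+ 2 => ht.
suff ts : (t%:E <= s + e%:E)%E.
  have s0 : (0 <= s)%E by apply: esum_ge0 => p _; rewrite lee_fin sqr_ge0.
  move: ts s0; case: (s) => [r| |]//=.
    by rewrite -!EFinD !lee_fin; lra.
  by move=> _ _; rewrite addeNy addNye leNye.
pose F := [fset q in Q | `[< P q >]]%fset.
have h2 : ((\sum_(q <- F) mass q ^+ 2)%:E + e%:E <= s + e%:E)%E.
  rewrite leeD2r//; apply: esum_fset_le => q /=.
  by rewrite !inE => /andP[_ /asboolP].
apply: le_trans h2; rewrite -EFinD lee_fin (le_trans ht)//.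
rewrite (bigID (fun q => `[< P q >])) /= lerD//.
  by rewrite /F big_fset_condE.
have e1 : e * \sum_(q <- Q) mass q = e.
  rewrite -[RHS]mulr1; congr (_ * _).
  by rewrite -raddf_sum/= -tau_sum Q1 tau1.
rewrite -[X in _ <= X]e1 mulr_sumr big_mkcond/= [X in _ <= X]big_seq [X in X <= _]big_seq.
apply: ler_sum => q qQ; have [_ m0] := tau_projection (Qo.1 q qQ).
case: asboolP => [Pq|nPq]/=; first by rewrite mulr_ge0// ltW.
have [//|me] := Qe q qQ.
by rewrite expr2 ler_wpM2r.
Qed.

Lemma self_adjoint_fset0 : self_adjoint_fset (fset0 : {fset M}).
Proof. by move=> y; rewrite inE. Qed.

Lemma self_adjoint_fsetU Y Y' : self_adjoint_fset Y -> self_adjoint_fset Y' ->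
  self_adjoint_fset (Y `|` Y')%fset.
Proof.
move=> h h' y; rewrite !inE => /orP[/h -> //|/h' ->].
by rewrite orbT.
Qed.

Theorem stein_dim_limit :
  upper_free_stein_dim L = lower_free_stein_dim L /\
  upper_free_stein_dim L = (1 - s)%E.
Proof.
have s0 : (0 <= s)%E by apply: esum_ge0 => p _; rewrite lee_fin sqr_ge0.
(* The dimension of the empty set is a real number below 1 - s, which excludes an infinite s. *)
have sfin : s \is a fin_num.
  rewrite ge0_fin_numE//.
  have := stein_dim_le self_adjoint_fset0.
  by case: (s) => //= r _; rewrite ltry.
have eps (x : \bar R) : (forall e : R, 0 < e -> (1 - s - e%:E <= x)%E) -> (1 - s <= x)%E.
  move=> h; apply/lee_addgt0Pr => e e0; have := h e e0.
  by rewrite leeBlDr.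
have u : upper_free_stein_dim L = (1 - s)%E.
  apply/eqP; rewrite eq_le; apply/andP; split.
    apply: (@le_trans _ _ (ereal_sup [set (free_stein_dim L Y)%:E | Y in fset_tail fset0])%E).
      by apply: ereal_inf_lbound; exists fset0 => //; exact: self_adjoint_fset0.
    by apply: ub_ereal_sup => _ [Y [saY _] <-]; exact: stein_dim_le.
  apply: le_ereal_inf_tmp => _ [Y0 sa0 <-]; apply: eps => e e0.
  have [Y1 sa1 h] := stein_dim_ge e0.
  (* The union with Y1 belongs to the tail of Y0, so each tail contains sets of dimension at least 1
     - s - e. *)
  have sa := self_adjoint_fsetU sa0 sa1.
  apply: le_trans (h _ sa (fsubsetUr _ _)) _.
  apply: ereal_sup_ubound; exists (Y0 `|` Y1)%fset => //; split=> //.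
  exact: fsubsetUl.
split=> //; rewrite u; apply/eqP; rewrite eq_le; apply/andP; split.
  apply: eps => e e0; have [Y1 sa1 h] := stein_dim_ge e0.
  apply: (@le_trans _ _ (ereal_inf [set (free_stein_dim L Y)%:E | Y in fset_tail Y1])%E).
    by apply: le_ereal_inf_tmp => _ [Y [saY Y1Y] <-]; exact: h.
  by apply: ereal_sup_ubound; exists Y1.
apply: ub_ereal_sup => _ [Y0 sa0 <-].
apply: le_trans (stein_dim_le sa0).
by apply: ereal_inf_lbound; exists Y0 => //; split.
Qed.

End LimitOverGenerators.

(** * Exhaustion by small projections *)

Section Exhaustion.
Context {R : realType} {M : starAlgType R} (tau : M -> R[i]).
Hypothesis comm : is_abelian M.
Implicit Types (p q r : M).
Local Notation mass p := (complex.Re (tau p)).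
Hypothesis tau_additive : forall p q, tau (p + q) = tau p + tau q.
Hypothesis mass_ge0 : forall p, is_projection p -> 0 <= mass p.
Hypothesis mass_eq0 : forall p, is_projection p -> mass p = 0 -> p = 0.

Lemma proj0 : is_projection (0 : M).
Proof. by split; rewrite ?star0 ?mulr0. Qed.

Lemma proj1 : is_projection (1 : M).
Proof. by split; rewrite ?star1 ?mulr1. Qed.

Lemma projB p q : is_projection p -> is_projection q -> q * p = q -> is_projection (p - q).
Proof.
move=> [sp pp] [sq qq] qp; split; first by rewrite starB sp sq.
by rewrite mulrBl !mulrBr pp (comm p) qp qq subrr subr0.
Qed.

Lemma massB p q : mass (p - q) = mass p - mass q.
Proof. by have := tau_additive (p - q) q; rewrite subrK => ->; rewrite ReD addrK. Qed.

Lemma orthogonal_add (Q : {fset M}) r s : orthogonal_projections Q ->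
  \sum_(q <- Q) q = 1 - r -> is_projection s -> s * r = s ->
  exists Q' : {fset M}, [/\ orthogonal_projections Q', \sum_(q <- Q') q = 1 - (r - s) &
    forall q, q \in Q' -> q \in Q \/ q = s].
Proof.
move=> [Qp Qo] QS ps sr.
(* The zero projection may already be in Q; a nonzero s is orthogonal to Q, hence new. *)
have [->|s0] := eqVneq s 0.
  by exists Q; rewrite subr0; split=> // q qQ; left.
have sQ q : q \in Q -> s * q = 0.
  move=> qQ; rewrite -sr -mulrA; have -> : r = 1 - \sum_(q <- Q) q by rewrite QS opprB addrC subrK.
  rewrite mulrBl mul1r mulr_suml (big_rem q)//= (Qp q qQ).2 big_seq big1 ?addr0 ?subrr ?mulr0// => t.
  rewrite mem_rem_uniq ?fset_uniq// inE => /andP[tq tQ].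
  exact: Qo.
have snQ : s \notin Q.
  apply/negP => sQ'; have := sQ _ sQ'; rewrite ps.2 => s00.
  by rewrite s00 eqxx in s0.
exists (s |` Q)%fset; split.
- split=> [q|q t]; first by rewrite !inE => /orP[/eqP ->|/Qp].
  rewrite !inE => /orP[/eqP ->|qQ] /orP[/eqP ->|tQ]; rewrite ?eqxx//.
  + by rewrite sQ.
  + by rewrite comm sQ.
  + exact: Qo.
- by rewrite big_fsetU1//= QS opprB addrCA.
- by move=> q; rewrite !inE => /orP[/eqP ->|qQ]; [right|left].
Qed.

Variable P : set M.
Hypothesis splitting : forall p, is_projection p -> p != 0 -> ~ P p ->
  exists q, [/\ is_projection q, q * p = q, q != 0 & q != p].
Hypothesis decreasing : forall r : nat -> M, (forall n, is_projection (r n)) ->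
  (forall n, r n.+1 * r n = r n.+1) ->
  (forall q, is_projection q -> (forall n, q * r n = q) -> q = 0) ->
  null (fun n => mass (r n)).

Section Partition.
Variable e : R.
Hypothesis e0 : 0 < e.

Let good p := P p \/ mass p <= e.

(** A projection outside P splits into two pieces, one of which has at most half the mass. Finitely
    many halvings lead to P or below e. *)
Lemma good_subprojection r : is_projection r -> r != 0 ->
  exists q, [/\ is_projection q, q * r = q, q != 0 & good q].
Proof.
move=> pr r0.
have h n : forall r, is_projection r -> r != 0 -> mass r <= 2 ^+ n * e ->
    exists q, [/\ is_projection q, q * r = q, q != 0 & good q].
  elim: n => [|n IH] {pr r0}r pr r0 mr.
    by exists r; split=> //; [exact: pr.2|right; rewrite mul1r in mr].
  have [Pr|nPr] := pselect (P r).
    by exists r; split=> //; [exact: pr.2|left].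
  have [q [pq qr q0 qnr]] := splitting pr r0 nPr.
  have prq := projB pr pq qr.
  have rqr : (r - q) * r = r - q by rewrite mulrBl pr.2 qr.
  have rq0 : r - q != 0 by rewrite subr_eq0 eq_sym.
  have [hq|hq] := leP (mass q) (2 ^+ n * e).
    have [s [ps sq s0 gs]] := IH q pq q0 hq.
    by exists s; split=> //; rewrite -sq -mulrA qr.
  have [|s [ps sq s0 gs]] := IH (r - q) prq rq0.
    rewrite massB; have : 2 ^+ n.+1 * e = 2 ^+ n * e + 2 ^+ n * e.
      by rewrite exprS; ring.
    by move: hq mr; lra.
  by exists s; split=> //; rewrite -sq -mulrA rqr.
have [n hn] : exists n, mass r / e <= 2 ^+ n.
  exists (Num.bound (mass r / e)); apply: ltW.
  apply: (lt_le_trans (archi_boundP _)); first by rewrite divr_ge0 ?mass_ge0// ltW.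
  by rewrite -natrX ler_nat ltnW// ltn_expl.
by apply: (h n) => //; rewrite -ler_pdivrMr.
Qed.

(** The supremum of the masses of good subprojections need not be attained; half of it is enough for
    the exhaustion. *)
Lemma greedy_subprojection r : is_projection r -> exists q,
  [/\ is_projection q, q * r = q, good q &
   forall s, is_projection s -> s * r = s -> good s -> mass s <= 2 * mass q].
Proof.
move=> pr; pose S := [set mass s | s in [set s | [/\ is_projection s, s * r = s & good s]]].
have g0 : good 0.
  by right; rewrite -(subrr (0 : M)) massB subrr ltW.
have le_r s : is_projection s -> s * r = s -> mass s <= mass r.
  move=> ps sr; have := mass_ge0 (projB pr ps sr).
  by rewrite massB subr_ge0.
have hS : has_sup S.
  split; first by exists (mass 0); exists 0 => //; split=> //; [exact: proj0|rewrite mul0r].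
  by exists (mass r) => _ [s [ps sr _] <-]; exact: le_r.
have [s0|s0] := leP (sup S) 0.
  exists 0; split=> //; [exact: proj0|by rewrite mul0r|].
  move=> s ps sr gs; rewrite -(subrr (0 : M)) massB subrr mulr0.
  by apply: le_trans s0; apply: sup_upper_bound => //; exists s.
have s20 : 0 < sup S / 2 by rewrite divr_gt0.
have [_ [q [pq qr gq] <-] hq] := sup_adherent s20 hS.
exists q; split=> // s ps sr gs.
have : mass s <= sup S by apply: sup_upper_bound => //; exists s.
by move: hq; lra.
Qed.

(** Pieces of at least half the best mass are removed repeatedly, so their masses tend to 0. A
    nonzero projection below all remainders would contain a good one, whose mass is at most twice
    each removed mass, hence 0. The remainders thus shrink to mass 0. *)
Lemma good_partition : exists Q : {fset M},
  [/\ orthogonal_projections Q, \sum_(q <- Q) q = 1 &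
      forall q, q \in Q -> P q \/ mass q <= e].
Proof.
have /choice[f hf] : forall r, exists q, is_projection r -> [/\ is_projection q, q * r = q, good q &
   forall s, is_projection s -> s * r = s -> good s -> mass s <= 2 * mass q].
  move=> r; have [/greedy_subprojection[q hq]|] := pselect (is_projection r).
    by exists q.
  by exists 0.
pose r n := iter n (fun r => r - f r) 1.
have pr n : is_projection (r n).
  elim: n => [|n IH]; first exact: proj1.
  by have [pq qr _ _] := hf _ IH; exact: projB.
have rS n : r n.+1 * r n = r n.+1.
  have [pq qr _ _] := hf _ (pr n).
  by rewrite /r iterS -/(r n) mulrBl (pr n).2 qr.
have mf n : mass (f (r n)) = mass (r n) - mass (r n.+1).
  by rewrite [r n.+1]/(r n - f (r n)) massB opprB addrC subrK.
have nf : null (fun n => mass (f (r n))).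
  apply/nullP => d d0.
  have [||N hN] := nonincreasing_cauchy _ _ d0 (a := fun n => mass (r n)).
  - by move=> n; exact: mass_ge0.
  - move=> n; rewrite -subr_ge0 -mf.
    by have [pq _ _ _] := hf _ (pr n); exact: mass_ge0.
  exists N => n Nn; rewrite mf ger0_norm; first exact: hN.
  by rewrite -mf; have [pq _ _ _] := hf _ (pr n); exact: mass_ge0.
have nr : null (fun n => mass (r n)).
  apply: decreasing => // q pq qr; apply/eqP; apply: contraT => q0.
  have [s [ps sq s0 gs]] := good_subprojection pq q0.
  have sr n : s * r n = s by rewrite -sq -mulrA qr.
  suff : s = 0 by move=> s00; rewrite s00 eqxx in s0.
  apply: mass_eq0 => //; apply: null_cst; apply: null_le (nullZ 2 nf) _ => n.
  rewrite ger0_norm ?mass_ge0//.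
  by have [_ _ _] := hf _ (pr n); apply.
have [N hN] : exists N, mass (r N) <= e.
  have /nullP/(_ e e0)[N /(_ N (leqnn N)) hN] := nr; exists N.
  by rewrite (le_trans (ler_norm _))// ltW.
have part n : exists Q : {fset M}, [/\ orthogonal_projections Q, \sum_(q <- Q) q = 1 - r n &
      forall q, q \in Q -> good q].
  elim: n => [|n [Q [[Qp Qo] QS Qg]]].
    by exists fset0; rewrite big_seq_fset0 subrr; split=> //; split.
  have [pq qr gq _] := hf _ (pr n).
  have [Q' [Qo' QS' QQ']] := orthogonal_add (conj Qp Qo) QS pq qr.
  by exists Q'; split=> // q /QQ'[/Qg|->].
have [Q [Qo QS Qg]] := part N.
(* The remainder itself, of mass at most e, completes the finite partition. *)
have [Q' [Qo' QS' QQ']] := orthogonal_add Qo QS (pr N) (pr N).2.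
exists Q'; split=> //; first by rewrite QS' subrr subr0.
by move=> q /QQ'[/Qg//|->]; right.
Qed.

End Partition.
End Exhaustion.

(** * Abelian von Neumann algebras *)

Section AbelianVonNeumann.
Context {R : realType} {M : starAlgType R}.
Hypothesis comm : is_abelian M.
Implicit Types (a b x y p q r : M).

Lemma comm_mulACA a b x y : a * b * (x * y) = a * x * (b * y).
Proof. by rewrite -!mulrA; congr (_ * _); rewrite !mulrA (comm b). Qed.

Lemma comm_subr_sqr a b : (a - b) * (a + b) = a * a - b * b.
Proof. by rewrite mulrBl !mulrDr (comm b a) opprD addrA addrK. Qed.

Section Representation.
Variables (H : hilbertType R) (pi : M -> H -> H).
Hypothesis pi_inj : injective pi.
Hypothesis pi_bounded : forall x, bounded_op (pi x).
Hypothesis pi_comb : forall c x y v, pi (c *: x + y) v = c *: pi x v + pi y v.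
Hypothesis pi_one : pi 1 = id.
Hypothesis pi_mul : forall x y, pi (x * y) = pi x \o pi y.
Hypothesis pi_star : forall x u v, inner H (pi x u) v = inner H u (pi (star x) v).
Hypothesis pi_range : range pi = commutant (commutant (range pi)).
Local Notation ip := (inner H).
Implicit Types (u v w : H).

Lemma pi1 v : pi 1 v = v. Proof. by rewrite pi_one. Qed.
Lemma piM x y v : pi (x * y) v = pi x (pi y v). Proof. by rewrite pi_mul. Qed.
Lemma piD x y v : pi (x + y) v = pi x v + pi y v.
Proof. by have := pi_comb 1 x y v; rewrite !scale1r. Qed.
Lemma pi0 v : pi 0 v = 0.
Proof. by apply: (@addrI _ (pi 0 v)); rewrite -piD !addr0. Qed.
Lemma piZ c x v : pi (c *: x) v = c *: pi x v.
Proof. by have := pi_comb c x 0 v; rewrite pi0 !addr0. Qed.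
Lemma piN x v : pi (- x) v = - pi x v.
Proof. by rewrite -scaleN1r piZ scaleN1r. Qed.
Lemma piB x y v : pi (x - y) v = pi x v - pi y v.
Proof. by rewrite piD piN. Qed.
Lemma pi_lin x : linear (pi x).
Proof. by case: (pi_bounded x). Qed.

Lemma pi_eq x y : (forall v, pi x v = pi y v) -> x = y.
Proof. by move=> xy; apply: pi_inj; apply/funext. Qed.

Lemma pi_ip_ext x y : (forall u v, ip u (pi x v) = ip u (pi y v)) -> x = y.
Proof.
move=> h; apply: pi_eq => v; apply/eqP; rewrite -subr_eq0; apply/eqP/ip_self0.
by rewrite ipBr h subrr.
Qed.

Lemma pi_nrm_star x v : nrm (pi (star x) v) = nrm (pi x v).
Proof. by apply: eq_nrm; rewrite pi_star starK -piM comm piM -pi_star. Qed.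

Lemma pi_nrm2 x v : ip (pi (star x * x) v) v = (nrm (pi x v) ^+ 2)%:C%C.
Proof. by rewrite piM pi_star starK ipE. Qed.

(** A strong limit commutes with whatever commutes with the sequence, so the bicommutant property
    brings it back into the range of [pi]. *)
Lemma strong_limit (x : nat -> M) (T : H -> H) (C : R) : (forall n, star (x n) = x n) ->
  0 <= C -> (forall n v, nrm (pi (x n) v) <= C * nrm v) ->
  (forall v, tends (fun n => pi (x n) v) (T v)) ->
  exists y, [/\ star y = y, pi y = T & forall v, nrm (pi y v) <= C * nrm v].
Proof.
move=> sx C0 xC xT.
have TC v : nrm (T v) <= C * nrm v by apply: tends_nrm_le (xT v) _ => n.
have Tb : bounded_op T.
  apply/bounded_opP; split; last by exists C.
  move=> c u v; apply: tends_unique (xT _) _.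
  by apply: tends_ext (tendsD (tendsZ c (xT u)) (xT v)) _ => n; exact: pi_lin.
have : commutant (commutant (range pi)) T.
  split=> // s [sb hs]; apply/funext => v /=.
  apply: tends_unique (xT _) _.
  apply: tends_ext (tends_op sb (xT v)) _ => n.
  have := hs (pi (x n)) (ex_intro2 _ _ (x n) I erefl).
  by move=> /(congr1 (fun f => f v)) /= ->.
rewrite -pi_range => -[y _ yT]; exists y; split=> //; last by rewrite yT.
apply: pi_ip_ext => u v; rewrite -pi_star yT.
apply: cnull_eq (tends_ip v (xT u)) _.
apply: null_ext (tends_ip u (xT v)) _ => n.
by rewrite pi_star sx ipC (ipC u) -rmorphB/= cabsJ.
Qed.

Let yseq n : R := iter n (fun t => 2^-1 * (1 + t ^+ 2)) 0.

Lemma sqrt_scalar_bounds n : 0 <= yseq n <= 1.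
Proof.
elim: n => [|n]; first by rewrite /yseq/= lexx ler01.
rewrite /yseq iterS -/(yseq n) => /andP[y0 y1].
have : yseq n ^+ 2 <= 1 by rewrite expr_le1.
by have := sqr_ge0 (yseq n) => *; apply/andP; split; lra.
Qed.

Lemma sqrt_scalar_incr n : yseq n <= yseq n.+1.
Proof.
rewrite {2}/yseq iterS -/(yseq n) -subr_ge0.
have -> : 2^-1 * (1 + yseq n ^+ 2) - yseq n = 2^-1 * (1 - yseq n) ^+ 2 by field.
by rewrite mulr_ge0 ?sqr_ge0.
Qed.

(* Newton-type iteration X_{n+1} = (S + X_n^2) / 2 for 1 - sqrt(1 - S); its
   increments are dominated by those of the scalar case S = 1. *)
Lemma sqrt_exists s : star s = s -> (forall v, nrm (pi s v) <= nrm v) ->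
  exists z, [/\ star z = z, forall v, nrm (pi z v) <= nrm v &
    (1 - z) * (1 - z) = 1 - s].
Proof.
move=> ss sc; pose X n := iter n (fun t : M => (2^-1 : R)%:C%C *: (s + t * t)) 0.
have XS n : X n.+1 = (2^-1 : R)%:C%C *: (s + X n * X n) by [].
have sX n : star (X n) = X n.
  elim: n => [|n IH]; first exact: star0.
  by rewrite XS starZ conj_realC starD starM ss IH.
have hX n v : nrm (pi (X n) v) <= yseq n * nrm v.
  elim: n v => [|n IH] v; first by rewrite pi0 nrm0 mul0r.
  rewrite XS piZ nrmZ cabs_real ger0_norm ?invr_ge0// piD piM.
  have /andP[y0 _] := sqrt_scalar_bounds n.
  rewrite /yseq iterS -/(yseq n) -mulrA ler_wpM2l ?invr_ge0//.
  rewrite (le_trans (nrmD _ _))// mulrDl mul1r lerD//.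
  by rewrite (le_trans (IH _))// expr2 -mulrA ler_wpM2l.
have dX n v : nrm (pi (X n.+1 - X n) v) <= (yseq n.+1 - yseq n) * nrm v.
  elim: n v => [|n IH] v.
    rewrite XS mulr0 addr0 subr0 piZ nrmZ cabs_real ger0_norm ?invr_ge0//.
    by rewrite /yseq/= expr0n/= addr0 mulr1 subr0 ler_wpM2l ?invr_ge0.
  have -> : X n.+2 - X n.+1 = (2^-1 : R)%:C%C *: ((X n.+1 + X n) * (X n.+1 - X n)).
    rewrite (XS n.+1) {4}(XS n) -scalerBr opprD addrACA subrr add0r.
    by rewrite mulrDl !mulrBr (comm (X n) (X n.+1)) addrA subrK.
  have -> : yseq n.+2 - yseq n.+1 = 2^-1 * ((yseq n.+1 + yseq n) * (yseq n.+1 - yseq n)).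
    have ySS k : yseq k.+1 = 2^-1 * (1 + yseq k ^+ 2) by [].
    by rewrite (ySS n.+1) [X in _ - X = _]ySS; field.
  rewrite piZ nrmZ cabs_real ger0_norm ?invr_ge0// piM -!mulrA ler_wpM2l ?invr_ge0//.
  have /andP[y0 _] := sqrt_scalar_bounds n; have /andP[y0' _] := sqrt_scalar_bounds n.+1.
  rewrite piD (le_trans (nrmD _ _))//.
  rewrite (le_trans (lerD (hX n.+1 _) (hX n _)))// -mulrDl ler_wpM2l ?addr_ge0//.
have dXm m n v : (m <= n)%N -> nrm (pi (X n) v - pi (X m) v) <= (yseq n - yseq m) * nrm v.
  elim: n => [|n IH]; first by rewrite leqn0 => /eqP ->; rewrite !subrr nrm0 mul0r.
  rewrite leq_eqVlt => /orP[/eqP ->|]; first by rewrite !subrr nrm0 mul0r.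
  rewrite ltnS => /IH h; apply: le_trans (nrmDist _ (pi (X n) v) _) _.
  have := dX n v; rewrite piB => h'; rewrite (le_trans (lerD h' h))//.
  by rewrite -mulrDl addrA subrK.
have /choice[T hT] v : exists w, tends (fun n => pi (X n) v) w.
  apply: cauchy_tends => e e0.
  have v0 : 0 < nrm v + 1 by rewrite ltr_wpDl ?nrm_ge0.
  have y1 n : 0 <= 1 - yseq n by rewrite subr_ge0; have /andP[] := sqrt_scalar_bounds n.
  have yS n : 1 - yseq n.+1 <= 1 - yseq n by rewrite lerB// sqrt_scalar_incr.
  have [N hN] := nonincreasing_cauchy y1 yS (divr_gt0 e0 v0).
  exists N => m n Nm mn; apply: le_lt_trans (dXm _ _ _ mn) _.
  have := hN m n Nm mn; rewrite ltr_pdivlMr// => h; apply: le_lt_trans h.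
  rewrite (_ : 1 - yseq m - (1 - yseq n) = yseq n - yseq m); last by ring.
  have ymn : yseq m <= yseq n.
    by have /nondecreasing_seqP := sqrt_scalar_incr; exact.
  by rewrite ler_wpM2l ?subr_ge0// lerDl.
have hX1 n v : nrm (pi (X n) v) <= 1 * nrm v.
  rewrite (le_trans (hX n v))// ler_wpM2r ?nrm_ge0//.
  by have /andP[] := sqrt_scalar_bounds n.
have [z [sz zT zC]] := strong_limit sX ler01 hX1 hT.
exists z; split=> //; first by move=> v; have := zC v; rewrite mul1r.
(* The fixed point equation 2 z = s + z^2 is the wanted identity (1 - z)^2 = 1 - s. *)
have e : z = (2^-1 : R)%:C%C *: (s + z * z).
  apply: pi_eq => v; rewrite zT; apply: tends_unique (_ : tends (fun n => pi (X n.+1) v) _) _.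
    apply/tendsE; have /tendsE/(null_shift 1) := hT v.
    by move=> /null_ext; apply => n; rewrite addn1.
  rewrite piZ piD piM zT.
  apply: tends_ext (tendsZ _ (tendsD (tends_cst (pi s v)) (_ : tends (fun n => pi (X n) (pi (X n) v)) _))) _.
    apply/tendsE; have /tendsE h1 := hT v; have /tendsE h2 := hT (T v).
    apply: null_le (nullD h1 h2) _ => n; rewrite ger0_norm ?nrm_ge0//.
    apply: le_trans (nrmDist _ (pi (X n) (T v)) _) _; rewrite lerD2r.
    rewrite -(linearopB _ _ (pi_lin _)).
    by have := hX1 n (pi (X n) v - T v); rewrite mul1r.
  by move=> n; rewrite XS piZ piD piM.
have e2 : z + z = s + z * z.
  rewrite {1 2}e -scalerDl -rcD.
  by rewrite (_ : 2^-1 + 2^-1 = 1 :> R) ?scale1r//; field.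
rewrite mulrBl mul1r mulrBr mulr1 opprB addrA addrAC -(addrA 1) -opprD e2.
by rewrite opprD addrA subrK.
Qed.

Lemma contraction_scaling x : exists2 c : R, 0 < c & forall v, nrm (pi (c%:C%C *: x) v) <= nrm v.
Proof.
have [_ [C C0 hC]] := (bounded_opP (pi x)).1 (pi_bounded x).
exists (C + 1)^-1; first by rewrite invr_gt0; lra.
move=> v; rewrite piZ nrmZ cabs_real ger0_norm ?invr_ge0; last by lra.
rewrite ler_pdivrMl; last by lra.
by rewrite (le_trans (hC v))// ler_wpM2r ?nrm_ge0//; lra.
Qed.

(** The square expands to |v|^2 - 2 |x v|^2 + |x^2 v|^2. As with [markov_nrm], the loss shows that
    vectors of preserved norm lie in the kernel of x. *)
Lemma one_minus_square_nrm x v : star x = x -> (forall v, nrm (pi x v) <= nrm v) ->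
  nrm (pi (1 - x * x) v) ^+ 2 <= nrm v ^+ 2 - nrm (pi x v) ^+ 2.
Proof.
move=> sx xc; have e : ip v (pi (x * x) v) = (nrm (pi x v) ^+ 2)%:C%C.
  by rewrite piM -{1}sx -pi_star ipE.
rewrite piB pi1 nrmB2 e /= piM.
have : nrm (pi x (pi x v)) ^+ 2 <= nrm (pi x v) ^+ 2.
  by rewrite ler_sqr ?nnegrE ?nrm_ge0.
lra.
Qed.

Lemma one_minus_square_contraction x : star x = x -> (forall v, nrm (pi x v) <= nrm v) ->
  forall v, nrm (pi (1 - x * x) v) <= nrm v.
Proof.
move=> sx xc v; rewrite -ler_sqr ?nnegrE ?nrm_ge0//.
apply: le_trans (one_minus_square_nrm v sx xc) _.
by rewrite gerBl sqr_ge0.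
Qed.

(** After scaling a to a contraction x, the even powers of 1 - x^2 converge strongly to the
    projection onto the kernel, and [strong_limit] places it in M. *)
Lemma kernel_projection a : star a = a -> exists k,
  [/\ is_projection k, a * k = 0 & forall b, a * b = 0 -> k * b = b].
Proof.
move=> sa; have [c c0 hc] := contraction_scaling a.
pose x := c%:C%C *: a.
have sx : star x = x by rewrite starZ conj_realC sa.
pose y := 1 - x * x; have sy : star y = y by rewrite starB star1 starM sx.
have By : sa_contraction (pi y).
  split; [exact: pi_lin|exact: one_minus_square_contraction|].
  by move=> u v; rewrite pi_star sy.
have sX n : star (y ^+ n) = y ^+ n.
  by elim: n => [|n IH]; rewrite ?expr0 ?star1// exprS starM IH sy comm.
have piX n v : pi (y ^+ n) v = iter n (pi y) v.
  by elim: n => [|n IH]; rewrite ?expr0 ?pi1// exprS piM IH.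
have bX n v : nrm (pi (y ^+ n.*2) v) <= 1 * nrm v by rewrite mul1r piX iter_nrm.
have tX v : tends (fun n => pi (y ^+ n.*2) v) (power_limit (pi y) v).
  by apply: tends_ext (power_limitP By v) _ => n; rewrite piX.
have [k [sk kT _]] := strong_limit (fun n => sX n.*2) ler01 bX tX.
exists k; split.
- by split=> //; apply: pi_eq => v; rewrite piM kT power_limit_idem.
- suff xk : x * k = 0.
    have : (c%:C%C : R[i]) != 0 by rewrite gt_eqF// rc_gt0.
    by move: xk; rewrite /x -scalerAl => /eqP; rewrite scaler_eq0 => /orP[->//|/eqP].
  apply: pi_eq => v; rewrite piM pi0; apply: nrm_eq0.
  have := one_minus_square_nrm (pi k v) sx hc.
  rewrite -/y kT power_limit_isometric// => h.
  apply/eqP; rewrite -sqrf_eq0 eq_le sqr_ge0 andbT; move: h; lra.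
- move=> b ab; apply: pi_eq => v; rewrite piM kT power_limit_fix//.
  by rewrite -piM mulrBl mul1r /x -!scalerAl -mulrA -scalerAl ab !scaler0 mulr0 scaler0 subr0.
Qed.

Lemma pi_projection_nrm q v : is_projection q -> nrm (pi q v) <= nrm v.
Proof.
move=> [sq qq]; have h : nrm (pi q v) ^+ 2 <= nrm (pi q v) * nrm v.
  apply: le_trans (CS _ _).
  have -> : ip (pi q v) v = (nrm (pi q v) ^+ 2)%:C%C by rewrite -{1}qq -{1}sq pi_nrm2.
  by rewrite cabs_real ler_norm.
have [->|r0] := eqVneq (nrm (pi q v)) 0; first exact: nrm_ge0.
by move: h; rewrite expr2 ler_pM2l// lt_def r0 nrm_ge0.
Qed.

(** For m <= n the squared distance of the images of v is the drop of their squared norms, so the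
    sequence converges. Its limit is a projection below every r n, which must be 0. *)
Lemma decreasing_limit (r : nat -> M) : (forall n, is_projection (r n)) ->
  (forall n, r n.+1 * r n = r n.+1) ->
  (forall q, is_projection q -> (forall n, q * r n = q) -> q = 0) ->
  forall v, tends (fun n => pi (r n) v) 0.
Proof.
move=> pr rS inf0.
have rmn m n : (m <= n)%N -> r n * r m = r n.
  elim: n => [|n IH]; first by rewrite leqn0 => /eqP ->; exact: (pr 0%N).2.
  rewrite leq_eqVlt => /orP[/eqP ->|]; first exact: (pr n.+1).2.
  by rewrite ltnS => /IH h; rewrite -(rS n) -mulrA h.
have nq q v : is_projection q -> ip (pi q v) v = (nrm (pi q v) ^+ 2)%:C%C.
  by move=> [sq qq]; rewrite -{1}qq -{1}sq pi_nrm2.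
have rc n v : nrm (pi (r n) v) <= 1 * nrm v by rewrite mul1r pi_projection_nrm.
have /choice[T hT] v : exists w, tends (fun n => pi (r n) v) w.
  apply: cauchy_tends => e e0.
  have dif m n : (m <= n)%N -> nrm (pi (r n) v - pi (r m) v) ^+ 2 =
      nrm (pi (r m) v) ^+ 2 - nrm (pi (r n) v) ^+ 2.
    move=> mn; rewrite nrmC -piB.
    have := nq _ v (projB comm (pr m) (pr n) (rmn _ _ mn)).
    rewrite piB ipBl !nq// -rcB => /(congr1 (@complex.Re R)) /= <-.
    by [].
  have hS n : nrm (pi (r n.+1) v) ^+ 2 <= nrm (pi (r n) v) ^+ 2.
    by rewrite -subr_ge0 -dif// sqr_ge0.
  have [N hN] := nonincreasing_cauchy (fun n => sqr_ge0 _) hS (exprn_gt0 2 e0).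
  exists N => m n Nm mn; rewrite -ltr_sqr ?nnegrE ?nrm_ge0 ?(ltW e0)// dif//.
  exact: hN.
have sr n : star (r n) = r n by have [] := pr n.
have [q [sq qT _]] := strong_limit sr ler01 rc hT.
have qr n : q * r n = q.
  apply: pi_eq => v; rewrite piM qT.
  apply: tends_unique (hT _) _; apply/tendsE.
  have /tendsE/(null_shift n) h := hT v.
  have /tendsE h2 := hT (pi (r n) v); apply/nullP => e e0.
  have /nullP/(_ e e0)[N hN] := h; exists (N + n)%N => k Nk.
  have nk : (n <= k)%N by apply: leq_trans Nk; exact: leq_addl.
  have Nkn : (N <= k - n)%N by rewrite leq_subRL// addnC.
  rewrite -piM (rmn _ _ nk).
  by have := hN _ Nkn; rewrite (subnK nk).
have pq : is_projection q.
  split=> //; apply: pi_eq => v; rewrite piM.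
  have h := tends_op (pi_bounded q) (hT v).
  rewrite -qT in h; apply: tends_unique h _.
  by apply: tends_ext (tends_cst _) _ => n; rewrite -piM qr.
have q0 := inf0 q pq qr.
by move=> v; have := hT v; rewrite -qT q0 pi0.
Qed.

Variable tau : M -> R[i].
Hypothesis htau : is_tracial_von_neumann tau.
Local Notation mass p := (complex.Re (tau p)).

Lemma tvn_comb c x y : tau (c *: x + y) = c * tau x + tau y.
Proof. exact: tvn_linear htau c x y. Qed.
Lemma tvnD x y : tau (x + y) = tau x + tau y.
Proof. by have := tvn_comb 1 x y; rewrite scale1r mul1r. Qed.
Lemma tvn0 : tau 0 = 0.
Proof. by apply: (@addrI _ (tau 0)); rewrite -tvnD !addr0. Qed.
Lemma tvnZ c x : tau (c *: x) = c * tau x.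
Proof. by have := tvn_comb c x 0; rewrite tvn0 !addr0. Qed.
Lemma tvnB x y : tau (x - y) = tau x - tau y.
Proof. by rewrite tvnD -scaleN1r tvnZ mulN1r. Qed.

Lemma tvn_square_eq0 z : mass (star z * z) = 0 -> z = 0.
Proof.
move=> m0; apply: (tvn_faithful htau).
by rewrite (ge0_ReE (tvn_positive htau z)) m0.
Qed.

Lemma tvn_mass_ge0 p : is_projection p -> 0 <= mass p.
Proof.
move=> [sp pp]; have := tvn_positive htau p; rewrite sp pp => h.
by rewrite -ler0c -ge0_ReE.
Qed.

Lemma tvn_mass_eq0 p : is_projection p -> mass p = 0 -> p = 0.
Proof. by move=> [sp pp] m0; apply: tvn_square_eq0; rewrite sp pp. Qed.

(* If y' = (y - lambda) p has trace 0, then |y'| = +- y' by minimality of p and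
   the kernel projections, so |y'| has trace 0. *)
Lemma minimal_scalar_sa p y : minimal_projections p -> star y = y ->
  exists c : R[i], y * p = c *: p.
Proof.
move=> [[sp pp] p0 pmin] sy.
(* The only real candidate, by comparing traces; [mass p] is nonzero by faithfulness. *)
pose lam := mass (y * p) / mass p; exists lam%:C%C.
have mp0 : mass p != 0.
  by apply: contra_neq p0; exact: tvn_mass_eq0.
pose y' := y * p - lam%:C%C *: p.
suff : y' = 0 by move=> /eqP; rewrite subr_eq0 => /eqP.
have sy' : star y' = y' by rewrite starB (starMc comm) starZ conj_realC sy sp.
have y'p : y' * p = y' by rewrite mulrBl -mulrA pp -scalerAl pp.
have my' : mass y' = 0.
  rewrite tvnB tvnZ ReB.
  have -> : complex.Re (lam%:C%C * tau p) = lam * mass p.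
    by case: (tau p) => s t /=; rewrite mul0r subr0.
  by rewrite /lam divfK// subrr.
have [c c0 hc] := contraction_scaling y'.
pose x := c%:C%C *: y'.
have sx : star x = x by rewrite starZ conj_realC sy'.
have xp : x * p = x by rewrite -scalerAl y'p.
have sxx : star (1 - x * x) = 1 - x * x by rewrite starB star1 (starMc comm) sx.
(* Two roots in succession: (1 - z)^2 = x^2, so that g = 1 - z plays the role of |x|, and (1 - w)^2
   = g exhibits g as a square. *)
have [z [sz zc ez]] := sqrt_exists sxx (one_minus_square_contraction sx hc).
have [w [sw wc ew]] := sqrt_exists sz zc.
pose g := 1 - z; have sg : star g = g by rewrite starB star1 sz.
have gg : g * g = x * x by rewrite ez opprB addrC subrK.
have gp0 : g * p = x \/ g * p = - x.
  (* Since (g - x) p and (g + x) p multiply to 0, the kernel projection k of the former fixes the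
     latter. Minimality leaves k p = 0 or k p = p, that is g p = - x or g p = x. *)
  have sgx : star ((g - x) * p) = (g - x) * p by rewrite (starMc comm) starB sg sx sp.
  have [k [pk ak kb]] := kernel_projection sgx.
  have ab : (g - x) * p * ((g + x) * p) = 0.
    by rewrite comm_mulACA comm_subr_sqr gg subrr mul0r.
  have kpp : k * p * p = k * p by rewrite -mulrA pp.
  have pkp : is_projection (k * p).
    split; first by rewrite (starMc comm) sp pk.1.
    by rewrite comm_mulACA pp pk.2.
  have [kp0|kp1] := pmin _ pkp kpp.
    right; apply/eqP; rewrite -addr_eq0; apply/eqP.
    have := kb _ ab; rewrite (comm (g + x)) mulrA kp0 mul0r mulrDr (comm p) (comm p x) xp.
    by move=> <-.
  left; have : (g - x) * p = 0 by rewrite -{1}kp1 (comm k) mulrA ak.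
  by rewrite mulrBl xp => /eqP; rewrite subr_eq0 => /eqP.
have mgp : mass (g * p) = 0.
  have mx : mass x = 0.
    rewrite /x tvnZ; have -> : complex.Re (c%:C%C * tau y') = c * mass y'.
      by case: (tau y') => s t /=; rewrite mul0r subr0.
    by rewrite my' mulr0.
  by case: gp0 => ->; rewrite ?mx// -scaleN1r tvnZ mulN1r ReN mx oppr0.
(* The square of the self-adjoint (1 - w) p is g p, of trace zero in real part, so faithfulness
   applies. *)
have wp0 : (1 - w) * p = 0.
  apply: tvn_square_eq0.
  by rewrite (starMc comm) starB star1 sw sp comm_mulACA ew pp.
have gp : g * p = 0 by rewrite /g -ew -mulrA wp0 mulr0.
have : x = 0.
  by case: gp0; rewrite gp => /esym// /eqP; rewrite oppr_eq0 => /eqP.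
move=> /eqP; rewrite scaler_eq0 => /orP[|/eqP//].
by rewrite gt_eqF// rc_gt0.
Qed.

Lemma minimal_scalar p y : minimal_projections p -> exists c : R[i], y * p = c *: p.
Proof.
move=> hp; have s1 : star (y + star y) = y + star y by rewrite starD starK addrC.
have s2 : star ('i *: (y - star y)) = 'i *: (y - star y).
  by rewrite starZ conjCi starB starK scaleNr -scalerN opprB.
have [c1 h1] := minimal_scalar_sa hp s1; have [c2 h2] := minimal_scalar_sa hp s2.
exists (2^-1 * (c1 - 'i * c2)).
have -> : y = (2^-1 : R[i]) *: ((y + star y) - 'i *: ('i *: (y - star y))).
  rewrite scalerA -expr2 sqrCi scaleN1r opprK addrACA subrr addr0.
  have -> : y + y = (2%:R : R[i]) *: y by rewrite scaler_nat mulr2n.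
  by rewrite scalerA mulVf ?scale1r// pnatr_eq0.
by rewrite -scalerAl mulrBl h1 -scalerAl h2 (scalerA 'i) -scalerBl scalerA.
Qed.

(** Normality refers to least upper bounds for [star_le], so 1 has to be shown least among the
    bounds t of the 1 - r n. The difference t - 1 is a strong limit of the positive (1 - r n) (t -
    1), and [sqrt_exists] then writes it as [star z * z]. *)
Lemma tvn_decreasing (r : nat -> M) : (forall n, is_projection (r n)) ->
  (forall n, r n.+1 * r n = r n.+1) ->
  (forall q, is_projection q -> (forall n, q * r n = q) -> q = 0) ->
  null (fun n => mass (r n)).
Proof.
move=> pr rS inf0; have lim := decreasing_limit pr rS inf0.
have rmn m n : (m <= n)%N -> r n * r m = r n.
  elim: n => [|n IH]; first by rewrite leqn0 => /eqP ->; exact: (pr 0%N).2.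
  rewrite leq_eqVlt => /orP[/eqP ->|]; first exact: (pr n.+1).2.
  by rewrite ltnS => /IH h; rewrite -(rS n) -mulrA h.
have prc n : is_projection (1 - r n).
  by apply: projB => //; [exact: proj1|rewrite mulr1].
have prd m n : (m <= n)%N -> is_projection (r m - r n).
  by move=> mn; apply: projB => //; exact: rmn.
pose D := [set 1 - r n | n in [set: nat]].
have sle a b : is_projection (b - a) -> star_le a b.
  by move=> [s1 s2]; exists (b - a); rewrite s1 s2.
have ubound n : star_le (1 - r n) 1.
  by apply: sle; rewrite opprB addrC subrK.
have lub t : (forall x, D x -> star_le x t) -> star_le 1 t.
  move=> ht; have /choice[z hz] : forall n, exists z, t - (1 - r n) = star z * z.
    by move=> n; apply: ht; exists n.
  pose h := t - 1.
  have hE n : h = star (z n) * z n - r n.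
    by rewrite -hz opprB addrA addrAC addrK.
  have sh : star h = h.
    by rewrite (hE 0%N) starB starM starK (pr 0%N).1.
  have [C C0 hC] : exists2 C : R, 0 < C & forall v, nrm (pi h v) <= C * nrm v.
    have [_ [C C0 hC]] := (bounded_opP (pi h)).1 (pi_bounded h).
    exists (C + 1) => [|v]; first by lra.
    by rewrite (le_trans (hC v))// ler_wpM2r ?nrm_ge0//; lra.
  (* Multiplying h = star (z n) * z n - r n by 1 - r n removes the negative term, which makes (1 - r
     n) h positive. *)
  pose w n := (1 - r n) * z n.
  have ww n : star (w n) * w n = (1 - r n) * h.
    rewrite /w (starMc comm) (prc n).1 comm_mulACA (prc n).2 (hE n) mulrBr.
    by rewrite mulrBl mul1r mulrBl mul1r (pr n).2 subrr subr0.
  have est n v : nrm (pi ((1 - r n) * h) v) ^+ 2 <=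
      C * complex.Re (ip (pi ((1 - r n) * h) v) v).
    have wE u : nrm (pi (w n) u) ^+ 2 = complex.Re (ip (pi ((1 - r n) * h) u) u).
      by rewrite -ww pi_nrm2.
    have wC u : nrm (pi (w n) u) ^+ 2 <= C * nrm u ^+ 2.
      rewrite wE (le_trans (ler_norm _))// (le_trans (Re_le_cabs _))// (le_trans (CS _ _))//.
      rewrite expr2 mulrA ler_wpM2r ?nrm_ge0// piM (le_trans (pi_projection_nrm _ (prc n)))//.
    by rewrite -wE -ww piM pi_nrm_star.
  have hq v : tends (fun n => pi ((1 - r n) * h) v) (pi h v).
    rewrite -[pi h v in X in tends _ X]subr0.
    apply: tends_ext (tendsB (tends_cst (pi h v)) (lim (pi h v))) _ => n.
    by rewrite piM piB pi1.
  (* This says h^2 <= C h, a form of 0 <= h <= C that survives strong limits. *)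
  have pos v : nrm (pi h v) ^+ 2 <= C * complex.Re (ip (pi h v) v).
    rewrite -subr_ge0.
    apply: (@null_ge0 R (fun n => C * complex.Re (ip (pi ((1 - r n) * h) v) v) -
        nrm (pi ((1 - r n) * h) v) ^+ 2)); last by move=> n; rewrite subr_ge0.
    apply: null_le (nullD (nullZ C (tends_ip v (hq v))) (tends_ip2 (hq v) (hq v))) _ => n.
    rewrite !nrm2_Re.
    set a := ip _ v; set b := ip (pi h v) v; set c := ip _ _; set d := ip (pi h v) _.
    have -> : C * complex.Re a - complex.Re c - (C * complex.Re b - complex.Re d) =
       C * complex.Re (a - b) - complex.Re (c - d) by rewrite !ReB; ring.
    rewrite (le_trans (ler_normB _ _))// normrM (gtr0_norm C0) lerD ?Re_le_cabs//.
    by rewrite ler_wpM2l ?Re_le_cabs// ltW.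
  (* By [pos], x is a contraction, so 1 - x = h / C has a self-adjoint square root. *)
  pose x := 1 - C^-1%:C%C *: h.
  have sx : star x = x by rewrite starB star1 starZ conj_realC sh.
  have xc v : nrm (pi x v) <= nrm v.
    rewrite -ler_sqr ?nnegrE ?nrm_ge0// piB pi1 piZ nrmB2 nrmZ ipZr conj_realC.
    rewrite cabs_real gtr0_norm ?invr_gt0// ipC.
    have -> : complex.Re (C^-1%:C%C * (ip (pi h v) v)^*) = C^-1 * complex.Re (ip (pi h v) v).
      by case: (ip _ _) => s' t' /=; rewrite mul0r subr0.
    have := pos v; set y := complex.Re _ => hy.
    have y0 : 0 <= C^-1 * y.
      by rewrite mulr_ge0 ?invr_ge0 ?(ltW C0)// -(pmulr_rge0 _ C0) (le_trans _ hy)// sqr_ge0.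
    have : (C^-1 * nrm (pi h v)) ^+ 2 <= C^-1 * y.
      by rewrite exprMn expr2 -mulrA ler_pM2l ?invr_gt0// ler_pdivrMl.
    by move: y0; lra.
  have [y [sy yc ey]] := sqrt_exists sx xc.
  exists ((Num.sqrt C)%:C%C *: (1 - y)).
  rewrite starZ conj_realC starB star1 sy -scalerAl -scalerAr scalerA ey.
  rewrite -rcM -expr2 sqr_sqrtr ?(ltW C0)// /x opprB addrCA subrr addr0 scalerA -rcM.
  by rewrite mulfV ?gt_eqF// scale1r.
have nD : D !=set0 by exists (1 - r 0%N); exists 0%N.
have pD x : D x -> star_le 0 x by move=> [n _ <-]; apply: sle; rewrite subr0.
have dD x y : D x -> D y -> exists z, [/\ D z, star_le x z & star_le y z].
  move=> [m _ <-] [n _ <-]; exists (1 - r (maxn m n)).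
  have e k : (1 - r (maxn m n)) - (1 - r k) = r k - r (maxn m n).
    by rewrite opprB addrC addrA subrK.
  split; first by exists (maxn m n).
    by apply: sle; rewrite e; apply: prd; exact: leq_maxl.
  by apply: sle; rewrite e; apply: prd; exact: leq_maxr.
have uD x : D x -> star_le x 1 by move=> [n _ <-].
have supE := tvn_normal htau nD pD dD uD lub.
have mr n : mass (1 - r n) = 1 - mass (r n).
  by rewrite tvnB ReB (tvn_unital htau).
apply/nullP => e e0.
have hS : has_sup [set mass x | x in D].
  split; first by exists (mass (1 - r 0%N)); exists (1 - r 0%N) => //; exists 0%N.
  exists 1 => _ [_ [n _ <-] <-]; rewrite mr gerBl.
  exact: tvn_mass_ge0.
have [_ [_ [N _ <-] <-]] := sup_adherent e0 hS.
rewrite -supE (tvn_unital htau) mr /= => hN.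
exists N => n Nn; rewrite ger0_norm ?tvn_mass_ge0//.
have := tvn_mass_ge0 (prd _ _ Nn); rewrite tvnB ReB; lra.
Qed.

End Representation.
End AbelianVonNeumann.

(** * Reduction to properties of the family of atoms *)

Section Assembly.
Context {R : realType} {M : starAlgType R} {tau : M -> R[i]} (L : tensorL2 tau).
Hypothesis comm : is_abelian M.
Hypothesis tau1 : tau 1 = 1.
Local Notation mass p := (complex.Re (tau p)).

Lemma stein_dim_atoms (P : set M) :
  (forall p, P p -> is_projection p) ->
  (forall p q, P p -> P q -> p != q -> p * q = 0) ->
  (forall p y, P p -> exists c : R[i], y * p = c *: p) ->
  (forall p, is_projection p -> mass p = 0 -> p = 0) ->
  (forall p, is_projection p -> p != 0 -> ~ P p ->
    exists q, [/\ is_projection q, q * p = q, q != 0 & q != p]) ->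
  (forall r : nat -> M, (forall n, is_projection (r n)) ->
    (forall n, r n.+1 * r n = r n.+1) ->
    (forall q, is_projection q -> (forall n, q * r n = q) -> q = 0) ->
    null (fun n => mass (r n))) ->
  upper_free_stein_dim L = lower_free_stein_dim L /\
  upper_free_stein_dim L = (1 - \esum_(p in P) (mass p ^+ 2)%:E)%E.
Proof.
move=> Pp Po Ps m0 split decr; apply: stein_dim_limit => // e e0.
apply: (good_partition comm) => //; first exact: tauD.
by move=> p /(tau_projection L tau1)[].
Qed.

Lemma minimal_projections_orthogonal (p q : M) :
  minimal_projections p -> minimal_projections q -> p != q -> p * q = 0.
Proof.
move=> [[sp pp] p0 pmin] [[sq qq] q0 qmin] pq.
have ppq : is_projection (p * q).
  by split; rewrite ?(starMc comm) ?sp ?sq// comm_mulACA// pp qq.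
have e1 : p * q * p = p * q by rewrite -mulrA (comm q) mulrA pp.
have e2 : p * q * q = p * q by rewrite -mulrA qq.
have [//|h1] := pmin _ ppq e1; have [//|h2] := qmin _ ppq e2.
by move: pq; rewrite -{1}h1 h2 eqxx.
Qed.

Lemma not_minimal_split (p : M) : is_projection p -> p != 0 -> ~ minimal_projections p ->
  exists q, [/\ is_projection q, q * p = q, q != 0 & q != p].
Proof.
move=> pp p0 nmin; apply: contrapT => h; apply: nmin; split=> // q pq qp.
have [->|q0] := eqVneq q 0; first by left.
have [->|qnp] := eqVneq q p; first by right.
by exfalso; apply: h; exists q.
Qed.

End Assembly.

Lemma stein_dim_von_neumann (R : realType) (M : starAlgType R) (tau : M -> R[i])
    (L : tensorL2 tau) : is_tracial_von_neumann tau -> is_abelian M ->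
  upper_free_stein_dim L = lower_free_stein_dim L /\
  upper_free_stein_dim L =
    (1 - \esum_(p in @minimal_projections R M) (complex.Re (tau p) ^+ 2)%:E)%E.
Proof.
move=> htau comm; have tau1 := tvn_unital htau.
have [H [pi [[pinj pib] picomb [pi1 pim] pis pir]]] := tvn_von_neumann htau.
apply: stein_dim_atoms => //.
- by move=> p [].
- exact: minimal_projections_orthogonal.
- move=> p y; exact: (minimal_scalar comm pinj pib picomb pi1 pim pis pir htau).
- exact: tvn_mass_eq0.
- exact: not_minimal_split.
- move=> r pr rS; exact: (tvn_decreasing comm pinj pib picomb pi1 pim pis pir htau).
Qed.

(** * Essentially bounded functions *)

Section LInfinity.
Context {d : measure_display} {X : measurableType d} {R : realType}.
Variable mu : probability X R.
Local Notation Linf := (Linfty mu).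
Local Notation mass p := (complex.Re (expect mu p)).
Implicit Types (A B C : set X) (f g : Linf_fun mu).
Local Open Scope quotient_scope.

Lemma indic_Linf_subproof B : measurable B ->
  (fun x => (\1_B x : R)%:C%C) \in Linf_pred mu.
Proof.
move=> mB; apply/asboolP; split.
  split; first exact: measurable_indic.
  exact: measurable_cst.
exists 1; apply: filterE => x.
rewrite cabsE lecR cabs_real indicE.
by case: (x \in B); rewrite ?normr1 ?normr0.
Qed.

(* The class of the indicator of [B], when [B] is measurable; 0 otherwise. *)
Definition Linf_indic B : Linf :=
  \pi_Linf (insubd (0 : Linf_fun mu) (fun x => (\1_B x : R)%:C%C)).

Lemma val_Linf_indic B : measurable B ->
  val (insubd (0 : Linf_fun mu) (fun x => (\1_B x : R)%:C%C)) = (fun x => (\1_B x)%:C%C).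
Proof. by move=> mB; rewrite insubdK//; exact: indic_Linf_subproof. Qed.

Lemma Linf_mul_pi f g : \pi_Linf f * \pi_Linf g = \pi_Linf (f * g).
Proof. by rewrite -rmorphM. Qed.

Lemma Linf_indicP f B : measurable B ->
  \pi_Linf f = Linf_indic B <-> {ae mu, forall x, val f x = (\1_B x)%:C%C}.
Proof. by move=> mB; rewrite /Linf_indic -Linfty_eqP val_Linf_indic. Qed.

Lemma Linf_indicM B C : measurable B -> measurable C ->
  Linf_indic B * Linf_indic C = Linf_indic (B `&` C).
Proof.
move=> mB mC; rewrite [Linf_indic B]/Linf_indic [Linf_indic C]/Linf_indic Linf_mul_pi.
apply/Linf_indicP; first exact: measurableI.
apply: filterE => x.
have -> : forall f g, val (f * g) x = val f x * val g x by move=> f g; rewrite rmorphM.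
by rewrite !val_Linf_indic// -rcM indicI.
Qed.

Lemma Linf_indic_star B : measurable B -> star (Linf_indic B) = Linf_indic B.
Proof.
move=> mB; rewrite /star/= [X in Linfty_star X]/Linf_indic Linfty_star_pi.
apply/Linf_indicP => //; apply: filterE => x /=.
by have /= -> := val_Linf_indic mB; rewrite conjc_real.
Qed.

Lemma Linf_indic_projection B : measurable B -> is_projection (Linf_indic B).
Proof. by move=> mB; split; [exact: Linf_indic_star|rewrite Linf_indicM// setIid]. Qed.

Lemma Linf_projection_indic p : is_projection p ->
  exists2 B, measurable B & p = Linf_indic B.
Proof.
elim/quotW: p => f [_]; rewrite Linf_mul_pi => /Linfty_eqP ff.
pose B := (fun x => complex.Re (val f x)) @^-1` [set 1].
have mB : measurable B.
  have /asboolP[[mf _] _] := valP f.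
  by rewrite -[B]setTI; exact: mf.
exists B => //; apply/Linf_indicP => //; apply: filterS ff => x.
have -> : val (f * f) x = val f x * val f x by rewrite rmorphM.
move=> e; have : val f x * (val f x - 1) == 0 by rewrite mulrBr mulr1 e subrr.
rewrite mulf_eq0 subr_eq0 indicE => /orP[] /eqP fx; rewrite fx.
  by rewrite memNset// /B/= fx /= => /esym/eqP; rewrite oner_eq0.
by rewrite mem_set// /B/= fx.
Qed.

(** [expect] integrates the representative picked by [repr]; equality almost everywhere makes that
    choice immaterial. *)
Lemma expect_pi f : expect mu (\pi_Linf f) =
  Complex (\int[mu]_x complex.Re (val f x)) (\int[mu]_x complex.Im (val f x)).
Proof.
have h : {ae mu, forall x, val (repr (\pi_Linf f)) x = val f x}.
  by apply/Linfty_eqP; rewrite reprK.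
have /asboolP[[m1 m2] _] := valP f.
have /asboolP[[m3 m4] _] := valP (repr (\pi_Linf f)).
rewrite /expect /Rintegral; congr (Complex (fine _) (fine _)).
  apply: ae_eq_integral => //; [exact/measurable_EFinP|exact/measurable_EFinP|].
  by apply: filterS h => x -> _.
apply: ae_eq_integral => //; [exact/measurable_EFinP|exact/measurable_EFinP|].
by apply: filterS h => x -> _.
Qed.

Lemma mass_Linf_indic B : measurable B -> (mass (Linf_indic B))%:E = mu B.
Proof.
move=> mB; rewrite /Linf_indic expect_pi /= val_Linf_indic// /Rintegral/=.
rewrite integral_indic// setIT fineK//.
exact: fin_num_measure.
Qed.

Lemma expect1 : expect mu 1 = 1.
Proof.
have -> : (1 : Linf) = \pi_Linf 1 by rewrite rmorph1.
rewrite expect_pi /=.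
rewrite (_ : (fun x => complex.Re (val (1 : Linf_fun mu) x)) = fun=> 1); last first.
  by apply/funext => x; rewrite rmorph1.
rewrite (_ : (fun x => complex.Im (val (1 : Linf_fun mu) x)) = fun=> 0); last first.
  by apply/funext => x; rewrite rmorph1.
have e : fine (mu [set: X]) = 1 by rewrite probability_setT.
rewrite !Rintegral_cst// mul0r mul1r.
by have := congr1 (fun t : R => Complex t (0 : R)) e => /= e'; rewrite [LHS]e'.
Qed.

Lemma Linf_indic_eq B C : measurable B -> measurable C ->
  Linf_indic B = Linf_indic C <-> mu ((B `\` C) `|` (C `\` B)) = 0%E.
Proof.
move=> mB mC; have mD : measurable ((B `\` C) `|` (C `\` B)).
  by apply: measurableU; exact: measurableD.
rewrite {1}/Linf_indic Linf_indicP// val_Linf_indic// -negligibleP//.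
split; last first.
  move=> [N [mN N0 sN]]; exists N; split=> // x /= nx; apply: sN.
  apply: contrapT => h; apply: nx; rewrite !indicE; congr (_%:R%:C%C).
  have [Bx|nBx] := pselect (B x); have [Cx|nCx] := pselect (C x).
  - by rewrite !mem_set.
  - by exfalso; apply: h; left.
  - by exfalso; apply: h; right.
  - by rewrite !memNset.
move=> [N [mN N0 sN]]; exists N; split=> // x /= bx; apply: sN => /= e.
have {}e : (x \in B) = (x \in C).
  have /(congr1 (@complex.Re R)) := e; rewrite !indicE /=.
  by case: (x \in B); case: (x \in C) => //= /eqP; rewrite ?oner_eq0// eq_sym oner_eq0.
case: bx => -[h1 h2]; apply: h2.
  by apply: set_mem; rewrite -e; exact: mem_set.
by apply: set_mem; rewrite e; exact: mem_set.
Qed.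

Lemma Linf_indic0 : Linf_indic set0 = 0.
Proof.
apply/esym; have -> : (0 : Linf) = \pi_Linf 0 by rewrite rmorph0.
apply/Linf_indicP => //; apply: filterE => x.
by rewrite indic0.
Qed.

Lemma Linf_indic_eq0 B : measurable B -> Linf_indic B = 0 <-> mu B = 0%E.
Proof.
move=> mB; rewrite -Linf_indic0 Linf_indic_eq//.
by rewrite setD0 set0D setU0.
Qed.

(** The underlying sets decrease only up to null sets. Finite intersections give truly decreasing
    sets with the same classes; their intersection is null by hypothesis, and continuity from above
    concludes. *)
Lemma Linf_decreasing (r : nat -> Linf) : (forall n, is_projection (r n)) ->
  (forall n, r n.+1 * r n = r n.+1) ->
  (forall q, is_projection q -> (forall n, q * r n = q) -> q = 0) ->
  null (fun n => mass (r n)).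
Proof.
move=> pr rS inf0.
have /choice[B hB] n : exists B, measurable B /\ r n = Linf_indic B.
  by have [B mB e] := Linf_projection_indic (pr n); exists B.
have mB n : measurable (B n) by have [] := hB n.
pose D n := \big[setI/setT]_(k < n.+1) B k.
have mD n : measurable (D n) by apply: bigsetI_measurable.
have DS n : D n.+1 = D n `&` B n.+1 by rewrite /D big_ord_recr.
have rD n : r n = Linf_indic (D n).
  elim: n => [|n IH]; first by rewrite /D big_ord_recr big_ord0 /= setTI; have [] := hB 0%N.
  by rewrite DS -Linf_indicM// -IH -(hB n.+1).2 mulrC rS.
have Dn : nonincreasing_seq D.
  by apply/nonincreasing_seqP => n; rewrite subsetEset DS; exact: subIsetl.
have mC : measurable (\bigcap_n D n) by exact: bigcap_measurable.
have C0 : mu (\bigcap_n D n) = 0%E.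
  apply/Linf_indic_eq0 => //; apply: inf0; first exact: Linf_indic_projection.
  move=> n; rewrite rD Linf_indicM//; congr Linf_indic.
  by apply/setIidPl => x; apply.
have fin0 : (mu (D 0%N) < +oo)%E by rewrite (le_lt_trans (probability_le1 _ _))// ltry.
have h : mu \o D @ \oo --> mu (\bigcap_n D n) := nonincreasing_cvg_mu fin0 mD mC Dn.
rewrite C0 in h; move/fine_cvgP: h => [_] h.
apply: null_ext h _ => n /=.
by rewrite rD -mass_Linf_indic.
Qed.

Lemma ae_not_measure0 B : measurable B -> mu B = 0%E -> {ae mu, forall x, ~ B x}.
Proof. by move=> mB B0; exists B; split=> // x /= /contrapT. Qed.

Lemma prob_setD0 B C : measurable B -> measurable C -> C `<=` B -> mu C = mu B ->
  mu (B `\` C) = 0%E.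
Proof.
move=> mB mC CB CE.
have finB : (mu B < +oo)%E by rewrite (le_lt_trans (probability_le1 _ _))// ltry.
have e : mu (B `\` C) = (mu B - mu (B `&` C))%E := measureD mB mC finB.
by rewrite e (setIidr CB) CE subee//; exact: fin_num_measure.
Qed.

(* The constant is the infimum of the t with g <= t a.e. on the atom. *)
Lemma atom_ae_cst A (g : X -> R) (K : R) : atom mu A -> measurable_fun setT g ->
  {ae mu, forall x, `|g x| <= K} -> exists c : R, {ae mu, forall x, A x -> g x = c}.
Proof.
move=> [mA A0 Amin] mg gK.
have mt t : measurable (g @^-1` `]-oo, t]).
  by rewrite -[_ @^-1` _]setTI; apply: mg => //; exact: measurable_itv.
(* Each sublevel set meets the atom in a set of measure zero or full measure. *)
have dich t : {ae mu, forall x, A x -> t < g x} \/ {ae mu, forall x, A x -> g x <= t}.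
  have mAt : measurable (A `&` g @^-1` `]-oo, t]) by exact: measurableI.
  have [h|h] := Amin _ mAt (@subIsetl _ _ _); [left|right].
    apply: filterS (ae_not_measure0 mAt h) => x hx Ax.
    by rewrite ltNge; apply/negP => gt; apply: hx; split=> //=; rewrite in_itv.
  have mAd : measurable (A `\` (A `&` g @^-1` `]-oo, t])) by exact: measurableD.
  have h0 := prob_setD0 mA mAt (@subIsetl _ _ _) h.
  apply: filterS (ae_not_measure0 mAd h0) => x hx Ax.
  by rewrite leNgt; apply/negP => gt; apply: hx; split=> // -[_] /=; rewrite in_itv/= leNgt gt.
pose S := [set t | {ae mu, forall x, A x -> g x <= t}].
have nonnull : ~ {ae mu, forall x, ~ A x}.
  move=> [N [mN N0 sN]]; have : (mu A <= mu N)%E.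
    apply: le_measure; [exact/mem_set|exact/mem_set|] => x Ax; apply: sN => /=.
    by move/(_ Ax).
  by rewrite N0 leNgt A0.
have lbS t : S t -> - K <= t.
  move=> St; rewrite leNgt; apply/negP => tK; apply: nonnull.
  apply: filterS2 St gK => x gt gKx Ax; have := gt Ax.
  by move: gKx; rewrite ler_norml => /andP[+ _]; lra.
have hS : has_inf S.
  split; last by exists (- K) => t; exact: lbS.
  by exists K; apply: filterS gK => x gx _; rewrite (le_trans (ler_norm _)).
exists (inf S).
have up n : {ae mu, forall x, A x -> g x <= inf S + n.+1%:R^-1}.
  have [|t St tn] := @inf_adherent _ S n.+1%:R^-1 _ hS => //.
  by apply: filterS St => x gx Ax; rewrite (le_trans (gx Ax))// ltW.
have dn n : {ae mu, forall x, A x -> inf S - n.+1%:R^-1 < g x}.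
  have [//|h] := dich (inf S - n.+1%:R^-1).
  have : inf S <= inf S - n.+1%:R^-1 by apply: ge_inf; [exact: hS.2|].
  have : 0 < n.+1%:R^-1 :> R by rewrite invr_gt0.
  by set y := _^-1; lra.
(* Approximation by 1/(n+1) keeps the exceptional sets countable in number, so one null set serves
   for all n. *)
apply: filterS2 (ae_foralln up) (ae_foralln dn) => x hu hd Ax.
have sm (e : R) : 0 < e -> exists n : nat, n.+1%:R^-1 < e.
  move=> e0; have /nullP/(_ e e0)[N /(_ N (leqnn N)) hN] := null_inv (1 : R).
  by exists N; rewrite -div1r (le_lt_trans (ler_norm _)).
apply/eqP; rewrite eq_le; apply/andP; split; apply/ler_addgt0Pr => e /sm[n hn].
  by rewrite (le_trans (hu n Ax))// lerD2l ltW.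
by rewrite -lerBlDr (le_trans _ (ltW (hd n Ax)))// lerB// ltW.
Qed.

Lemma atom_scalar A (y : Linf) : atom mu A ->
  exists c : R[i], y * Linf_indic A = c *: Linf_indic A.
Proof.
move=> aA; have [mA _ _] := aA; elim/quotW: y => f.
have /asboolP[[m1 m2] [K hK]] := valP f.
have h1 : {ae mu, forall x, `|complex.Re (val f x)| <= K}.
  apply: filterS hK => x; rewrite cabsE lecR => h.
  by rewrite (le_trans (Re_le_cabs _)).
have h2 : {ae mu, forall x, `|complex.Im (val f x)| <= K}.
  apply: filterS hK => x; rewrite cabsE lecR => h.
  (* The imaginary part is, up to sign, the real part of i times the value. *)
  rewrite (le_trans _ h)//; have := Re_le_cabs ('i * val f x).
  rewrite cabsM (_ : cabs 'i = 1) ?mul1r; last by rewrite /cabs normCi.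
  by case: (val f x) => s t; rewrite -complexiE /= mul0r mul1r sub0r normrN.
have [c1 hc1] := atom_ae_cst aA m1 h1; have [c2 hc2] := atom_ae_cst aA m2 h2.
exists (Complex c1 c2).
rewrite /GRing.scale/= /Linfty_scale {1 2}/Linf_indic !Linf_mul_pi.
apply/Linfty_eqP; apply: filterS2 hc1 hc2 => x e1 e2.
have vM g g' : val (g * g') x = val g x * val g' x by rewrite rmorphM.
rewrite !vM val_Linf_indic// indicE.
have [Ax|nAx] := pselect (A x); last by rewrite memNset// !mulr0.
have -> : val f x = Complex c1 c2 by rewrite -(e1 Ax) -(e2 Ax); case: (val f x).
by [].
Qed.

(** P consists of the classes of indicators of members of AA, and distinct members have distinct
    classes, so the sum over AA is a sum over P. What remains are statements on measurable sets
    modulo null sets. *)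
Lemma stein_dim_Linfty (L : tensorL2 (expect mu)) (AA : set (set X)) :
  atoms_upto_null mu AA ->
  upper_free_stein_dim L = lower_free_stein_dim L /\
  upper_free_stein_dim L = (1 - \esum_(A in AA) mu A ^+ 2)%E.
Proof.
move=> [AAatom AAall AAuniq]; pose P := Linf_indic @` AA.
have mAA A : AA A -> measurable A by move=> /AAatom[].
have inj : set_inj AA Linf_indic.
  move=> A B /set_mem AAA /set_mem AAB /Linf_indic_eq h; apply: AAuniq => //.
  by apply: h; exact: mAA.
have comm : is_abelian Linf by move=> x y; exact: mulrC.
have -> : (\esum_(A in AA) mu A ^+ 2 = \esum_(p in P) (mass p ^+ 2)%:E)%E.
  rewrite esum_image//; apply: eq_esum => A AAA.
  by rewrite -mass_Linf_indic ?EFin_expe//; exact: mAA.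
apply: stein_dim_atoms => //.
- exact: expect1.
- by move=> _ [A AAA <-]; apply: Linf_indic_projection; exact: mAA.
- move=> _ _ [A AAA <-] [B AAB <-] AB.
  have mA := mAA _ AAA; have mB := mAA _ AAB; have mAB := measurableI _ _ mA mB.
  rewrite Linf_indicM//; apply/Linf_indic_eq0 => //.
  have [_ _ Amin] := AAatom _ AAA; have [_ _ Bmin] := AAatom _ AAB.
  have [//|hA] := Amin _ mAB (@subIsetl _ _ _).
  have [//|hB] := Bmin _ mAB (@subIsetr _ _ _).
  exfalso; move/eqP: AB; apply; apply/Linf_indic_eq => //.
  have z1 := prob_setD0 mA mAB (@subIsetl _ _ _) hA.
  have z2 := prob_setD0 mB mAB (@subIsetr _ _ _) hB.
  rewrite setDIr setDv set0U in z1; rewrite setDIr setDv setU0 in z2.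
  have e : mu ((A `\` B) `|` (B `\` A)) = mu (A `\` B).
    by apply: measureU0 => //; exact: measurableD.
  by rewrite e.
- by move=> _ y [A AAA <-]; apply: atom_scalar; exact: AAatom.
- move=> p /Linf_projection_indic[B mB ->] m0.
  by apply/Linf_indic_eq0 => //; rewrite -mass_Linf_indic// m0.
- move=> p /Linf_projection_indic[B mB ->] B0 nP.
  have muB0 : mu B <> 0%E by move=> h; move/eqP: B0; apply; exact/Linf_indic_eq0.
  (* AA represents every atom up to null sets, so an atom B would have its class in P. *)
  have nat_ : ~ atom mu B.
    move=> /AAall[A AAA hA]; apply: nP; exists A => //.
    by apply/Linf_indic_eq; [exact: mAA|exact: mB|rewrite setUC].
  have [C [mC CB C0 CnB]] : exists C, [/\ measurable C, C `<=` B, mu C <> 0%E & mu C <> mu B].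
    apply: contrapT => h; apply: nat_; split=> //.
      by rewrite lt_def measure_ge0 andbT; apply/eqP.
    move=> C mC CB; have [?|C0] := pselect (mu C = 0%E); [by left|right].
    by apply: contrapT => CnB; apply: h; exists C.
  exists (Linf_indic C); split; first exact: Linf_indic_projection.
  + by rewrite Linf_indicM// (setIidl CB).
  + by apply/eqP => /(Linf_indic_eq0 mC)/C0.
  + by apply/eqP => e; apply: CnB; rewrite -(mass_Linf_indic mC) e mass_Linf_indic.
- exact: Linf_decreasing.
Qed.

End LInfinity.

Local Open Scope ereal_scope.

Theorem theorem6p6 (R : realType) :
  (forall (M : starAlgType R) (tau : M -> R[i]) (L : tensorL2 tau),
      is_tracial_von_neumann tau -> is_abelian M ->
      upper_free_stein_dim L = lower_free_stein_dim L /\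
      upper_free_stein_dim L =
        1 - \esum_(p in @minimal_projections R M)
              (complex.Re (tau p) ^+ 2)%R%:E)
  /\
  (forall (d : measure_display) (X : measurableType d) (mu : probability X R)
      (L : tensorL2 (expect mu)) (AA : set (set X)),
      atoms_upto_null mu AA ->
      upper_free_stein_dim L = lower_free_stein_dim L /\
      upper_free_stein_dim L = 1 - \esum_(A in AA) mu A ^+ 2).
Proof.
split=> [M tau L htau comm|d X mu L AA hAA].
  exact: stein_dim_von_neumann.
exact: stein_dim_Linfty.
Qed.
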